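(* Let $(X,J_X,\omega_X)$ be a closed Hermitian manifold of complex dimension $n-1\ge 1$ and $(S,J_S,\omega_S)$ a compact Riemann surface with boundary $\partial S\in C^{2,\beta}$, $0<\beta<1$. Let $M=X\times S$ with the induced (product) complex structure $J$, let $\omega$ be any Hermitian metric on $\bar M$ compatible with $J$, and let $\chi$ be a smooth real $(1,1)$-form on $\bar M$. Let $\pi_2:X\times S\to S$ be the projection and let $h$ be the solution of $\Delta_S h=1$ in $S$, $h=0$ on $\partial S$. Let $f:\Gamma\to\mathbb R$ (with $f,\Gamma$ as in the context) satisfy $f_i=\partial f/\partial\lambda_i>0$ in $\Gamma$ for all $i$ and be concave in $\Gamma$. Let $\psi\in C(\bar M)$ and let $\varphi\in C^{2,1}(\bar M)$ be an admissible function with $$\lim_{t\to+\infty}f\big(\lambda(\mathfrak g[\varphi]+t\,\pi_2^*\omega_S)\big)>\psi\quad\text{in }\bar M .$$ Then for all sufficiently large $t$ the function $\underline u=\varphi+t\,\pi_2^*h$ is a strictly admissible subsolution, i.e. $\underline u$ is admissible, $f(\lambda(\mathfrak g[\underline u]))>\psi$ in $\bar M$ and $\underline u=\varphi$ on $\partial M$; moreover $\frac{\partial\underline u}{\partial\nu}\big|_{\partial M}<0$ for $t$ sufficiently large, where $\nu$ is the unit inner normal along $\partial M$.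
   Context: $\partial M=X\times\partial S$, $\bar M=M\cup\partial M$. $\mathfrak g[u]:=\chi+\sqrt{-1}\partial\overline\partial u$; $\lambda(\cdot)$ denotes the eigenvalues of a real $(1,1)$-form with respect to $\omega$. $\Delta_S$ is the Laplacian of $(S,J_S,\omega_S)$, normalized so that $\sqrt{-1}\partial\overline\partial h=(\Delta_Sh)\,\omega_S$; $h\in C^\infty(S)\cap C^{2,\beta}(\bar S)$. $\pi_2^*h=h\circ\pi_2$. $\Gamma\subset\mathbb R^n$ is an open symmetric convex cone with vertex at the origin, containing $\Gamma_n=\{\lambda:\text{each }\lambda_i>0\}$, with $\partial\Gamma\ne\emptyset$; $f$ is a smooth symmetric function on $\Gamma$. $w\in C^2(\bar M)$ is admissible if $\lambda(\mathfrak g[w])\in\Gamma$ in $\bar M$. *)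

(* Defs.v *)
From HB Require Import structures.
From mathcomp Require Import all_boot all_order all_algebra perm.
From mathcomp Require Import complex.
From mathcomp Require Import all_classical all_reals all_analysis.
Set Implicit Arguments.
Unset Strict Implicit.
Unset Printing Implicit Defensive.
Import Order.TTheory GRing.Theory Num.Theory.
Import numFieldNormedType.Exports.
Local Open Scope classical_set_scope.
Local Open Scope ring_scope.

(* In the function classes below, the sets A are either open or contained in
   the closure of their interior; derivatives live in the interior and are
   extended to A by continuity. *)

(* [iterD [:: v1; ..; vk] g] is D_v1 (.. (D_vk g)) *)
Definition iterD (R : realType) (V W : normedModType R)
    (vs : seq V) (g : V -> W) : V -> W :=
  foldr (fun v g' => 'D_v g') g vs.

Definition derive_bd (R : realType) (V W : normedModType R)
    (A : set V) (vs : seq V) (g : V -> W) (x : V) : W :=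
  lim (iterD vs g y @[y --> within A° (nbhs x)]).

Definition Ck (R : realType) (V W : normedModType R) (k : nat)
    (A : set V) (g : V -> W) : Prop :=
  {within A, continuous g} /\
  forall vs : seq V, (size vs <= k)%N ->
    ((size vs < k)%N ->
       forall x, A° x -> forall v, derivable (iterD vs g) x v) /\
    exists G : V -> W,
      {within A, continuous G} /\ forall x, A° x -> G x = iterD vs g x.

(* C^{k,b}: the Hölder bound is local near each point of A, boundary points
   included, which on a compact manifold is the usual global class. *)
Definition CkHolder (R : realType) (V W : normedModType R) (k : nat) (b : R)
    (A : set V) (g : V -> W) : Prop :=
  Ck k A g /\
  forall vs : seq V, size vs = k -> forall x, A x ->
    exists C : R, exists2 U : set V, nbhs x U &
      forall y z, (U `&` A°) y -> (U `&` A°) z ->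
        `|iterD vs g y - iterD vs g z| <= C * `|y - z| `^ b.

(* C^m, a point x + sqrt(-1) y being stored as (x, y) *)
Notation Cn R m := ('rV[R]_m * 'rV[R]_m)%type.

Definition Jc (R : realType) (m : nat) (v : Cn R m) : Cn R m := (- v.2, v.1).

(* the coordinate vectors d/dx_j; d/dy_j is [Jc (evec R j)] *)
Definition evec (R : realType) (m : nat) (j : 'I_m) : Cn R m :=
  (delta_mx 0 j, 0).

Record charts (R : realType) (T : topologicalType) (m : nat) := Charts {
  idx : Type;
  dom : idx -> set T;
  coord : idx -> T -> Cn R m;
  param : idx -> Cn R m -> T }.

Definition img (R : realType) (T : topologicalType) (m : nat)
    (A : charts R T m) (i : idx A) : set (Cn R m) := coord i @` dom i.

Definition overlap (R : realType) (T : topologicalType) (m : nat)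
    (A : charts R T m) (i j : idx A) : set (Cn R m) :=
  coord i @` (dom i `&` dom j).

Definition trans (R : realType) (T : topologicalType) (m : nat)
    (A : charts R T m) (i j : idx A) : Cn R m -> Cn R m :=
  coord j \o param i.

(* The map [param i] inverts [coord i] on [dom i] and is arbitrary off the image.
   The charts need not have open image: boundary points are those sent to
   non-interior points of the image. The last clause, that all charts agree on
   which points these are, is automatic by invariance of domain. *)
Definition complex_atlas (R : realType) (T : topologicalType) (m : nat)
    (A : charts R T m) : Prop :=
  (forall p, exists i : idx A, dom i p) /\
  (forall i : idx A, open (dom i)) /\
  (forall i : idx A, {within dom i, continuous (coord i)}) /\
  (forall i : idx A, {within img i, continuous (param i)}) /\
  (forall (i : idx A) p, dom i p -> param i (coord i p) = p) /\
  (forall i : idx A, img i `<=` closure (img i)°) /\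
  (forall (i j : idx A) k, Ck k (overlap i j) (trans i j)) /\
  (forall (i j : idx A) z, (overlap i j)° z -> forall v,
     'D_(Jc v) (trans i j) z = Jc ('D_v (trans i j) z)) /\
  (forall (i j : idx A) p, dom i p -> dom j p ->
     (img i)° (coord i p) -> (img j)° (coord j p)).

Definition bdry (R : realType) (T : topologicalType) (m : nat)
    (A : charts R T m) : set T :=
  [set p | exists2 i : idx A, dom i p & ~ (img i)° (coord i p)].

(* near z, the set A is the sublevel set {rho <= 0}, with d(rho) <> 0 at z *)
Definition defining_fun (R : realType) (m : nat)
    (A : set (Cn R m)) (z : Cn R m) (W : set (Cn R m)) (rho : Cn R m -> R) :
    Prop :=
  open W /\ W z /\ Ck 1 W rho /\ rho z = 0 /\
  (A `&` W = [set y | rho y <= 0] `&` W) /\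
  exists v, 'D_v rho z != 0.

Definition bdry_class (R : realType) (T : topologicalType) (m : nat)
    (A : charts R T m) (k : nat) (b : R) : Prop :=
  forall (i : idx A) p, dom i p -> ~ (img i)° (coord i p) ->
    exists W rho,
      defining_fun (img i) (coord i p) W rho /\ CkHolder k b W rho.

Definition mfd_Ck (R : realType) (T : topologicalType) (m : nat)
    (A : charts R T m) (k : nat) (u : T -> R) : Prop :=
  forall i : idx A, Ck k (img i) (u \o param i).

Definition mfd_CkHolder (R : realType) (T : topologicalType) (m : nat)
    (A : charts R T m) (k : nat) (b : R) (u : T -> R) : Prop :=
  forall i : idx A, CkHolder k b (img i) (u \o param i).

Definition mfd_smooth_int (R : realType) (T : topologicalType) (m : nat)
    (A : charts R T m) (u : T -> R) : Prop :=
  forall (i : idx A) k, Ck k (img i)° (u \o param i).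

(* a 2-form given by its local expressions: [al i p v w] is its value at p on
   the vectors with coordinates v, w in the chart i *)
Definition form2 (R : realType) (T : topologicalType) (m : nat)
    (A : charts R T m) := idx A -> T -> Cn R m -> Cn R m -> R.

Definition real11form (R : realType) (T : topologicalType) (m : nat)
    (A : charts R T m) (al : form2 A) : Prop :=
  (forall i p, dom i p -> forall (a : R) v1 v2 w,
     al i p (a *: v1 + v2) w = a * al i p v1 w + al i p v2 w) /\
  (forall i p, dom i p -> forall v w, al i p v w = - al i p w v) /\
  (forall i p, dom i p -> forall v w, al i p (Jc v) (Jc w) = al i p v w) /\
  (forall i j p, dom i p -> dom j p -> forall v w,
     let d x := derive_bd (overlap i j) [:: x] (trans i j) (coord i p) in
     al i p v w = al j p (d v) (d w)).

Definition smooth_form (R : realType) (T : topologicalType) (m : nat)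
    (A : charts R T m) (al : form2 A) : Prop :=
  forall (i : idx A) k v w,
    Ck k (img i) (fun z => al i (param i z) v w).

(* a Hermitian metric compatible with J, given by its fundamental form;
   the associated Riemannian metric is om(v, J w) *)
Definition hermitian_metric (R : realType) (T : topologicalType) (m : nat)
    (A : charts R T m) (om : form2 A) : Prop :=
  real11form om /\ smooth_form om /\
  forall i p, dom i p -> forall v, v != 0 -> 0 < om i p v (Jc v).

(* sqrt(-1) d d-bar u = sqrt(-1) sum_jk u_{j kbar} dz_j /\ dzbar_k, evaluated
   on real vectors: (D^2u(Jv, w) - D^2u(v, Jw)) / 2.  For instance
   u = |z|^2 gives 2 dx /\ dy in dimension 1. *)
Definition iddbar (R : realType) (T : topologicalType) (m : nat)
    (A : charts R T m) (u : T -> R) : form2 A :=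
  fun i p v w =>
    let D2 a b := derive_bd (img i) [:: a; b] (u \o param i) (coord i p) in
    (D2 (Jc v) w - D2 v (Jc w)) / 2%:R.

(* the Hermitian matrix (al_{j kbar}) such that
   al = sqrt(-1) sum_jk al_{j kbar} dz_j /\ dzbar_k, that is
   al_{j kbar} = - sqrt(-1) al(d/dz_j, d/dzbar_k) *)
Definition coef11 (R : realType) (m : nat) (al : Cn R m -> Cn R m -> R) :
    'M[R[i]]_m :=
  \matrix_(j, k) Complex (al (evec R j) (Jc (evec R k)) / 2%:R)
                         (- al (evec R j) (evec R k) / 2%:R).

(* the eigenvalues, with multiplicity, of al with respect to om: the roots of
   det (x om_{j kbar} - al_{j kbar}), listed in an unspecified order *)
Definition eigen11 (R : realType) (m : nat)
    (om al : Cn R m -> Cn R m -> R) : 'rV[R]_m :=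
  get [set l : 'rV[R]_m |
    char_poly (invmx (coef11 om) *m coef11 al) =
    \prod_(i < m) ('X - (real_complex R (l 0 i))%:P)].

Definition form_add (R : realType) (T : topologicalType) (m : nat)
    (A : charts R T m) (al be : form2 A) : form2 A :=
  fun i p v w => al i p v w + be i p v w.

Definition form_scale (R : realType) (T : topologicalType) (m : nat)
    (A : charts R T m) (c : R) (al : form2 A) : form2 A :=
  fun i p v w => c * al i p v w.

Definition gform (R : realType) (T : topologicalType) (m : nat)
    (A : charts R T m) (chi : form2 A) (u : T -> R) : form2 A :=
  form_add chi (iddbar u).

(* lambda(al) at p, computed in the chart i; it depends on i at most through
   the order in which the eigenvalues are listed *)
Definition lambda (R : realType) (T : topologicalType) (m : nat)
    (A : charts R T m) (om al : form2 A) (i : idx A) (p : T) : 'rV[R]_m :=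
  eigen11 (om i p) (al i p).

Definition admissible (R : realType) (T : topologicalType) (m : nat)
    (A : charts R T m) (om chi : form2 A) (Gam : set 'rV[R]_m) (w : T -> R) :
    Prop :=
  mfd_Ck A 2 w /\
  forall i p, dom i p -> Gam (lambda om (gform chi w) i p).

(* Laplacian on a Riemann surface, normalized by
   sqrt(-1) d d-bar h = (Laplacian h) om: [is_laplacian om h p c] says that
   the Laplacian of h at p is c *)
Definition is_laplacian (R : realType) (T : topologicalType)
    (A : charts R T 1) (om : form2 A) (h : T -> R) (p : T) (c : R) : Prop :=
  forall i, dom i p -> forall v w, iddbar h i p v w = c * om i p v w.

(* nu is the unit inner normal of the boundary at p, in the chart i, for the
   Riemannian metric om(v, J w) *)
Definition unit_inner_normal (R : realType) (T : topologicalType) (m : nat)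
    (A : charts R T m) (om : form2 A) (i : idx A) (p : T) (nu : Cn R m) :
    Prop :=
  om i p nu (Jc nu) = 1 /\
  exists W rho, defining_fun (img i) (coord i p) W rho /\
    (forall v, 'D_v rho (coord i p) = 0 -> om i p nu (Jc v) = 0) /\
    'D_nu rho (coord i p) < 0.

Definition normal_derive (R : realType) (T : topologicalType) (m : nat)
    (A : charts R T m) (u : T -> R) (i : idx A) (p : T) (nu : Cn R m) : R :=
  derive_bd (img i) [:: nu] (u \o param i) (coord i p).

Definition Cn_pair (R : realType) (m n : nat) (z : Cn R m) (w : Cn R n) :
    Cn R (m + n) := (row_mx z.1 w.1, row_mx z.2 w.2).
Definition Cn_fst (R : realType) (m n : nat) (z : Cn R (m + n)) : Cn R m :=
  (lsubmx z.1, lsubmx z.2).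
Definition Cn_snd (R : realType) (m n : nat) (z : Cn R (m + n)) : Cn R n :=
  (rsubmx z.1, rsubmx z.2).

Definition prod_charts (R : realType) (T1 T2 : topologicalType) (m n : nat)
    (A : charts R T1 m) (B : charts R T2 n) :
    charts R (T1 * T2)%type (m + n) :=
  @Charts R (T1 * T2)%type (m + n) (idx A * idx B)%type
    (fun k => dom k.1 `*` dom k.2)
    (fun k p => Cn_pair (coord k.1 p.1) (coord k.2 p.2))
    (fun k z => (param k.1 (Cn_fst z), param k.2 (Cn_snd z))).

(* pi_2^* al, for the projection pi_2 to the second factor *)
Definition pull2 (R : realType) (T1 T2 : topologicalType) (m n : nat)
    (A : charts R T1 m) (B : charts R T2 n) (al : form2 B) :
    form2 (prod_charts A B) :=
  fun k p v w => al k.2 p.2 (Cn_snd v) (Cn_snd w).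

Definition symmetric_cone (R : realType) (n : nat) (Gam : set 'rV[R]_n) :
    Prop :=
  open Gam /\
  (forall (s : 'S_n) l, Gam l -> Gam (col_perm s l)) /\
  (forall l1 l2 (t : R), Gam l1 -> Gam l2 -> 0 <= t <= 1 ->
     Gam (t *: l1 + (1 - t) *: l2)) /\
  (forall (c : R) l, 0 < c -> Gam l -> Gam (c *: l)) /\
  [set l : 'rV[R]_n | forall i, 0 < l 0 i] `<=` Gam /\
  closure Gam `\` Gam° !=set0.

Definition smooth_symmetric (R : realType) (n : nat) (Gam : set 'rV[R]_n)
    (f : 'rV[R]_n -> R) : Prop :=
  (forall k, Ck k Gam f) /\
  forall (s : 'S_n) l, Gam l -> f (col_perm s l) = f l.

Definition increasing_on (R : realType) (n : nat) (Gam : set 'rV[R]_n)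
    (f : 'rV[R]_n -> R) : Prop :=
  forall l (i : 'I_n), Gam l -> 0 < 'D_(delta_mx 0 i) f l.

Definition concave_on (R : realType) (n : nat) (Gam : set 'rV[R]_n)
    (f : 'rV[R]_n -> R) : Prop :=
  forall l1 l2 (t : R), Gam l1 -> Gam l2 -> 0 <= t <= 1 ->
    t * f l1 + (1 - t) * f l2 <= f (t *: l1 + (1 - t) *: l2).

(* Main.v *)
From Pilot Require Import Defs.
From HB Require Import structures.
From mathcomp Require Import all_boot all_order all_algebra perm.
From mathcomp Require Import complex.
From mathcomp Require Import all_classical all_reals all_analysis.
From mathcomp Require Import ring lra.
Set Implicit Arguments.
Unset Strict Implicit.
Unset Printing Implicit Defensive.
Import Order.TTheory GRing.Theory Num.Theory.
Import numFieldNormedType.Exports.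
Local Open Scope classical_set_scope.
Local Open Scope ring_scope.

(* Since i d dbar h = omega_S on the whole of S, boundary included by continuity,
   g[u] = g[phi] + t pi_2^* omega_S is nondecreasing in t.  By Weyl's
   inequalities its eigenvalues, suitably ordered, are nondecreasing too, so that
   they stay in Gamma, and f of them increases with t.  The eigenvalues are lower
   semicontinuous in the point, so that the strict inequality with psi, valid at
   each point for large t, is valid for the same t nearby, and for one t
   everywhere by compactness.  By the maximum principle h <= 0, and the Hopf lemma
   bounds its normal derivative away from 0, locally and hence uniformly on the
   boundary, whereas that of phi is bounded.  The charts being arbitrary, all
   local estimates are made in one chart and carried to the others through the
   invariance of i d dbar under holomorphic changes of coordinates. *)

(** * Derivatives of C^1 and C^2 functions *)

(** Three features of the definitions shape the proof. [Ck] provides directional derivatives only,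
    so linearity in the direction, the chain rule and the symmetry of second derivatives are all
    derived from the mean value theorem. At boundary points derivatives are limits from the
    interior: each identity between them is proved in the interior and extended by uniqueness of
    continuous extensions, a chart image lying in the closure of its interior. Eigenvalues are
    listed in an arbitrary order, so [lambda] need not be continuous; what survives is a comparison
    up to a permutation and a loss e. It is enough because [Gam] and [f] are symmetric, and adding a
    vector with nonnegative entries keeps a point in [Gam] and does not decrease [f]. The Hopf lemma
    yields a nonzero derivative of h in some direction only. Since h is maximal on the boundary, dh
    is there a multiple of om(nu, J .), and Cauchy-Schwarz turns that derivative into a lower bound
    for the normal one. *)

Lemma cvg_is_derive (R : realType) (V W : normedModType R) (g : V -> W) x v l :
  (h^-1 *: (g (h *: v + x) - g x) @[h --> 0^']) --> l -> is_derive x v g l.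
Proof.
move=> gl; apply: DeriveDef; first by apply/cvg_ex; exists l.
by apply: cvg_lim => //; exact: norm_hausdorff.
Qed.

Lemma derivable_cvg (R : realType) (V W : normedModType R) (g : V -> W) x v :
  derivable g x v ->
  (h^-1 *: (g (h *: v + x) - g x) @[h --> 0^']) --> 'D_v g x.
Proof. by []. Qed.

Lemma is_derive_line (R : realType) (V W : normedModType R) (g : V -> W) x v s :
  derivable g (x + s *: v) v ->
  is_derive s (1 : R) (fun r => g (x + r *: v)) ('D_v g (x + s *: v)).
Proof.
move=> /derivable_cvg gs; apply: cvg_is_derive.
apply: cvg_trans gs; apply: near_eq_cvg; near=> r => /=.
by rewrite [r%:A]mulr1 scalerDl addrCA.
Unshelve. all: by end_near. Qed.

Lemma mvt_pos (R : realType) (V : normedModType R) (g : V -> R) x v (a : R) :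
  0 <= a -> (forall s, 0 <= s <= a -> derivable g (x + s *: v) v) ->
  exists2 c, 0 <= c <= a & g (x + a *: v) - g x = a * 'D_v g (x + c *: v).
Proof.
rewrite le_eqVlt => /orP[/eqP<- _|a0 dg].
  by exists 0; rewrite ?lexx // !scale0r addr0 subrr mul0r.
pose k s := g (x + s *: v).
have dk s : 0 <= s <= a -> is_derive s (1 : R) k ('D_v g (x + s *: v)).
  by move=> /dg /is_derive_line.
have [s|s|c cI E] := @MVT R k (fun s => 'D_v g (x + s *: v)) 0 a a0.
- by rewrite in_itv /= => /andP[s0 sa]; apply: dk; rewrite !ltW.
- apply: derivable_within_continuous => {}s; rewrite in_itv /= => sI.
  by have [] := dk s sI.
move: cI; rewrite in_itv /= => /andP[c0 ca].
exists c; first by rewrite !ltW.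
by move: E; rewrite /k scale0r addr0 subr0 mulrC.
Qed.

Lemma mvt_line (R : realType) (V : normedModType R) (g : V -> R) x v (a : R) :
  (forall s, `|s| <= `|a| -> derivable g (x + s *: v) v) ->
  exists2 c, `|c| <= `|a| & g (x + a *: v) - g x = a * 'D_v g (x + c *: v).
Proof.
move=> dg; have [a0|a0] := leP 0 a.
  have [s /andP[s0 sa]|c /andP[c0 ca] E] := @mvt_pos R V g x v a a0.
    by apply: dg; rewrite !ger0_norm.
  by exists c => //; rewrite !ger0_norm.
have na0 : 0 <= - a by rewrite oppr_ge0 ltW.
have [s /andP[s0 sa]|c /andP[c0 ca] E] := @mvt_pos R V g (x + a *: v) v (- a) na0.
  rewrite -addrA -scalerDl; apply: dg.
  by rewrite (ltr0_norm a0) ler_norml; apply/andP; split; lra.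
move: E; rewrite scaleNr addrK -addrA -scalerDl => E.
exists (a + c).
  by rewrite (ltr0_norm a0) ler_norml; apply/andP; split; lra.
by rewrite -opprB E mulNr opprK.
Qed.

(* Strict differentiability along [v]: the base point [c t] may move. *)
Lemma increment_cvg (R : realType) (V : normedModType R) (g : V -> R) x v
    (T : Type) (F : set_system T) {FF : Filter F} (c : T -> V) (a : T -> R) :
  (\forall y \near x, derivable g y v) -> {for x, continuous ('D_v g)} ->
  c @ F --> x -> a @ F --> (0 : R) ->
  exists2 th : T -> R, th @ F --> 'D_v g x &
    \forall t \near F, g (c t + a t *: v) - g (c t) = a t * th t.
Proof.
move=> dg cg cx a0.
pose P t r := g (c t + a t *: v) - g (c t) = a t * r.
have key (e : R) : 0 < e -> \forall t \near F,
    exists2 r, P t r & `|'D_v g x - r| < e.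
  move=> e0.
  have : \forall y \near x, derivable g y v /\ `|'D_v g x - 'D_v g y| < e.
    near=> y; split; near: y => //.
    by move/cvgrPdist_lt: cg; exact.
  move=> /nbhs_ballP[d /= d0 dP].
  have d20 : 0 < d / 2 by rewrite divr_gt0.
  have v0 : 0 < `|v| + 1 by rewrite ltr_wpDl.
  near=> t.
  have ct : `|x - c t| < d / 2 by near: t; move/cvgrPdist_lt: cx; exact.
  have at_ : `|a t| * (`|v| + 1) < d / 2.
    rewrite -ltr_pdivlMr //; near: t.
    move/cvgrPdist_lt: a0 => /(_ (d / 2 / (`|v| + 1)) (divr_gt0 d20 v0)).
    by apply: filterS => t; rewrite sub0r normrN.
  have inb s : `|s| <= `|a t| -> ball x d (c t + s *: v).
    move=> sa; rewrite -ball_normE /= opprD addrA.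
    apply: (le_lt_trans (ler_normB _ _)); rewrite normrZ.
    have : `|s| * `|v| <= `|a t| * (`|v| + 1).
      by apply: ler_pM => //; rewrite lerDl.
    by move=> ?; lra.
  have [s /inb/dP[]//|s sa E] := @mvt_line R V g (c t) v (a t).
  by exists ('D_v g (c t + s *: v)) => //; have [] := dP _ (inb _ sa).
(* When [a t = 0] the equation leaves r free; imposing the limit value there makes [th] converge. *)
have /choice[th thP] : forall t, exists r, (exists r, P t r) ->
    P t r /\ (a t = 0 -> r = 'D_v g x).
  move=> t.
  have [[r Pr]|nP] := pselect (exists r, P t r); last by exists 0 => /nP.
  have [a00|a00] := eqVneq (a t) 0.
    exists ('D_v g x) => _; split => //.
    by move: Pr; rewrite /P a00 !mul0r.
  by exists r => _; split => // /eqP; rewrite (negbTE a00).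
exists th.
  apply/cvgrPdist_lt => e e0; apply: filterS (key e e0) => t [r Pr re].
  have [Pt t0] := thP t (ex_intro _ r Pr).
  have [a00|a00] := eqVneq (a t) 0; first by rewrite t0 // subrr normr0.
  suff -> : th t = r by [].
  by apply: (mulfI a00); rewrite -Pt -Pr.
by apply: filterS (key 1 ltr01) => t [r Pr _]; have [] := thP t (ex_intro _ r Pr).
Unshelve. all: by end_near. Qed.

(** Exactly what the mean value argument of [increment_cvg] needs at x, direction by direction; no
    differential is introduced. *)
Definition c1at (R : realType) (V : normedModType R) (g : V -> R) x :=
  forall v, (\forall y \near x, derivable g y v) /\ {for x, continuous ('D_v g)}.

(* All at once the linearity of [v |-> D_v g] and the chain rule for C^1
   functions; [w i s] is a difference quotient. *)
Lemma increment_sum_cvg (R : realType) (V : normedModType R) (g : V -> R) x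
    (I : Type) (r : seq I) (e : I -> V) (w : I -> R -> R) (w0 : I -> R) :
  c1at g x -> (forall i, w i s @[s --> 0^'] --> w0 i) ->
  s^-1 * (g (x + s *: \sum_(i <- r) w i s *: e i) - g x) @[s --> (0 : R)^']
    --> \sum_(i <- r) w0 i * 'D_(e i) g x.
Proof.
move=> gx ww; elim: r => [|i r IHr].
  rewrite big_nil; under eq_fun do rewrite big_nil scaler0 addr0 subrr mulr0.
  exact: cvg_cst.
have s0 : (s @[s --> (0 : R)^']) --> (0 : R).
  exact: (@cvg_within_filter _ _ id _ (nbhs_filter (0 : R))).
have [dgi cgi] := gx (e i).
(* The increments in the remaining directions are absorbed by the moving base point. *)
pose c (s : R) := x + s *: \sum_(j <- r) w j s *: e j.
have cx : c s @[s --> 0^'] --> x.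
  rewrite -[X in _ --> X]addr0; apply: cvgD; first exact: cvg_cst.
  rewrite -[X in _ --> X](scale0r (\sum_(j <- r) w0 j *: e j)).
  apply: cvgZ => //; elim: r {IHr c} => [|j r IHr].
    by rewrite big_nil; under eq_fun do rewrite big_nil; exact: cvg_cst.
  rewrite big_cons; under eq_fun do rewrite big_cons.
  by apply: cvgD => //; apply: cvgZr_tmp.
have a0 : s * w i s @[s --> (0 : R)^'] --> (0 : R).
  rewrite -[X in _ --> X](mul0r (w0 i)); exact: cvgM.
have [th thl thE] := increment_cvg dgi cgi cx a0.
rewrite big_cons; apply: cvg_trans (cvgD (cvgM (ww i) thl) IHr).
apply: near_eq_cvg; near=> s => /=.
have sn0 : s != 0 by near: s; exact: nbhs_dnbhs_neq.
have -> : x + s *: (\sum_(j <- i :: r) w j s *: e j) = c s + (s * w i s) *: e i.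
  by rewrite big_cons scalerDr scalerA addrCA addrC.
have thEs : g (c s + (s * w i s) *: e i) - g (c s) = s * w i s * th s.
  by near: s.
rewrite -(subrK (g (c s)) (g (c s + _))) thEs -addrA mulrDr !mulrA mulVf //.
by rewrite mul1r.
Unshelve. all: by end_near. Qed.

Section LinearMaps.
Context (R : realType) (V W : normedModType R) (L : V -> W).
Hypothesis Llin : linear L.

Lemma lin0 : L 0 = 0.
Proof. by have := Llin (-1) 0 0; rewrite scaler0 addr0 scaleN1r addNr. Qed.

Lemma linZ a v : L (a *: v) = a *: L v.
Proof. by have := Llin a v 0; rewrite !addr0 lin0 addr0. Qed.

Lemma linD v w : L (v + w) = L v + L w.
Proof. by have := Llin 1 v w; rewrite !scale1r. Qed.

Lemma linB v w : L (v - w) = L v - L w.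
Proof. by rewrite -scaleN1r linD linZ scaleN1r. Qed.

Lemma is_derive_lin_post (U : normedModType R) (g : U -> V) x v :
  continuous L -> derivable g x v -> is_derive x v (L \o g) (L ('D_v g x)).
Proof.
move=> Lc /derivable_cvg gx; apply: cvg_is_derive.
apply: cvg_trans (@continuous_cvg _ _ _ _ _ _ L _ (Lc _) gx).
by apply: near_eq_cvg; near=> h => /=; rewrite linZ linB.
Unshelve. all: by end_near. Qed.

Lemma derive_lin_pre (U : normedModType R) (g : W -> U) x v :
  'D_v (g \o L) x = 'D_(L v) g (L x).
Proof. by rewrite /derive; under eq_fun do rewrite /= Llin. Qed.

Lemma derivable_lin_pre (U : normedModType R) (g : W -> U) x v :
  derivable (g \o L) x v = derivable g (L x) (L v).
Proof. by rewrite /derivable; under eq_fun do rewrite /= Llin. Qed.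
End LinearMaps.

Section Coordinates.
Context (R : realType) (m : nat).
Implicit Types (v w : Cn R m) (b : bool * 'I_m).

(** The real basis of C^m, [true] marking the vectors d/dy_j; [crd] is the dual basis. *)
Definition bas b : Cn R m := if b.1 then Jc (evec R b.2) else evec R b.2.
Definition crd b v : R := if b.1 then v.2 0 b.2 else v.1 0 b.2.

Lemma crd_lin b : linear (crd b : Cn R m -> R^o).
Proof. by case: b => -[] j a v w; rewrite /crd /= !mxE. Qed.

Lemma crd_continuous b : continuous (crd b).
Proof.
case: b => -[] j v; rewrite /crd /=.
  apply: (@continuous_comp _ _ _ snd (fun x : 'rV[R]_m => x 0 j)).
    exact: cvg_snd.
  exact: coord_continuous.
apply: (@continuous_comp _ _ _ fst (fun x : 'rV[R]_m => x 0 j)).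
  exact: cvg_fst.
exact: coord_continuous.
Qed.

Lemma bas_expand v : v = \sum_b crd b v *: bas b.
Proof.
rewrite -(pair_bigA _ (fun x j => crd (x, j) v *: bas (x, j))) /= big_bool /=.
rewrite /crd /bas /Jc /evec /= oppr0.
case: v => x y; rewrite [in LHS](row_sum_delta x) [in LHS](row_sum_delta y) /=.
have sum_fst : forall F : 'I_m -> Cn R m, (\sum_j F j).1 = \sum_j (F j).1.
  by move=> F; apply: (big_morph fst) => // -[? ?] [? ?].
have sum_snd : forall F : 'I_m -> Cn R m, (\sum_j F j).2 = \sum_j (F j).2.
  by move=> F; apply: (big_morph snd) => // -[? ?] [? ?].
by apply/pair_equal_spec; rewrite /= !sum_fst !sum_snd /=; split;
  [rewrite [X in _ = X + _]big1 ?add0r // => j _; rewrite scaler0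
  |rewrite [X in _ = _ + X]big1 ?addr0 // => j _; rewrite scaler0].
Qed.

Lemma crd_inj v w : (forall b, crd b v = crd b w) -> v = w.
Proof.
by move=> E; rewrite (bas_expand v) (bas_expand w); apply: eq_bigr => b _; rewrite E.
Qed.

Lemma is_derive_crd (U : normedModType R) (g : U -> Cn R m) b (x v : U) :
  derivable g x v -> is_derive x v (crd b \o g) (crd b ('D_v g x)).
Proof. exact: (is_derive_lin_post (crd_lin b) (@crd_continuous b)). Qed.

(** With the difference quotients of the coordinates of [tau] as weights, the increment of [tau] is
    represented exactly, so [increment_sum_cvg] applies without a remainder term. *)
Lemma is_derive_comp_sum (U : normedModType R) (tau : U -> Cn R m)
    (g : Cn R m -> R) (z v : U) :
  derivable tau z v -> c1at g (tau z) ->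
  is_derive z v (g \o tau)
    (\sum_b crd b ('D_v tau z) * 'D_(bas b) g (tau z)).
Proof.
move=> tz gz; apply: cvg_is_derive.
pose w b (s : R) := crd b (s^-1 *: (tau (s *: v + z) - tau z)).
have ww b : w b s @[s --> 0^'] --> crd b ('D_v tau z).
  exact: (@continuous_cvg _ _ _ _ _ _ (crd b) _ (@crd_continuous b _) (derivable_cvg tz)).
apply: cvg_trans
  (@increment_sum_cvg R _ g _ _ (index_enum (bool * 'I_m)%type) bas w _ gz ww).
apply: near_eq_cvg; near=> s => /=.
have s0 : s != 0 by near: s; exact: nbhs_dnbhs_neq.
by rewrite -(bas_expand (s^-1 *: _)) scalerA mulfV // scale1r subrKC.
Unshelve. all: by end_near. Qed.

(** The chain rule for the identity map is linearity in the direction. *)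
Lemma derive_sum_bas (g : Cn R m -> R) x v : c1at g x ->
  'D_v g x = \sum_b crd b v * 'D_(bas b) g x.
Proof.
move=> gx; have [_] := is_derive_comp_sum (@derivable_id _ _ x v) gx.
by rewrite derive_id => <-.
Qed.

Lemma is_derive_comp (U : normedModType R) (tau : U -> Cn R m)
    (g : Cn R m -> R) (z v : U) :
  derivable tau z v -> c1at g (tau z) ->
  is_derive z v (g \o tau) ('D_('D_v tau z) g (tau z)).
Proof. by move=> tz gz; rewrite derive_sum_bas //; exact: is_derive_comp_sum. Qed.

Lemma derive_linear (g : Cn R m -> R) x a v w : c1at g x ->
  'D_(a *: v + w) g x = a * 'D_v g x + 'D_w g x.
Proof.
move=> gx; rewrite !(derive_sum_bas _ gx) mulr_sumr -big_split /=.
by apply: eq_bigr => b _; rewrite (crd_lin b a v w) mulrDl mulrA.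
Qed.

End Coordinates.

Definition c2at (R : realType) (V : normedModType R) (g : V -> R) (x : V) :=
  \forall y \near x, c1at g y /\ forall v, c1at ('D_v g) y.

Lemma c2at_c1at (R : realType) (V : normedModType R) (g : V -> R) (x : V) :
  c2at g x -> c1at g x.
Proof. by move=> /nbhs_singleton[]. Qed.

Lemma c2at_c1at_derive (R : realType) (V : normedModType R) (g : V -> R) (x v : V) :
  c2at g x -> c1at ('D_v g) x.
Proof. by move=> /nbhs_singleton[_]. Qed.

Lemma derivable_c1at (R : realType) (V : normedModType R) (g : V -> R) (x v : V) :
  c1at g x -> derivable g x v.
Proof. by move=> /(_ v)[/nbhs_singleton]. Qed.

(** The mean value theorem is applied along a to y -> g (y + d b) - g y, then along b to D_a g. *)
Lemma second_difference (R : realType) (V : normedModType R) (g : V -> R) (x a b : V)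
    (d : R) :
  (forall r s, `|r| <= d -> `|s| <= d ->
     c1at g (x + r *: a + s *: b) /\ c1at ('D_a g) (x + r *: a + s *: b)) ->
  0 <= d ->
  exists r s, [/\ `|r| <= d, `|s| <= d &
    g (x + d *: a + d *: b) - g (x + d *: a) - (g (x + d *: b) - g x)
    = d * (d * 'D_b ('D_a g) (x + r *: a + s *: b))].
Proof.
move=> H d0; have nd : `|d| = d by rewrite ger0_norm.
pose k y := g (y + d *: b) - g y.
have dk r : `|r| <= d -> is_derive (x + r *: a) a k
   ('D_a g (x + r *: a + d *: b) - 'D_a g (x + r *: a)).
  move=> rd; have [|g1 _] := H r d rd; first by rewrite nd.
  have [|g0 _] := H r 0 rd; first by rewrite normr0.
  rewrite scale0r addr0 in g0.
  have T : is_derive (x + r *: a) a (fun y => g (y + d *: b))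
     ('D_a g (x + r *: a + d *: b)).
    have E := derivable_cvg (derivable_c1at (v := a) g1).
    apply: cvg_is_derive; apply: cvg_trans E.
    by under [in X in X `=>` _]eq_fun do rewrite -addrA.
  have T' : is_derive (x + r *: a) a g ('D_a g (x + r *: a)).
    by apply/derivableP/derivable_c1at/g0.
  exact: is_deriveB.
have [r|r rd E1] := @mvt_line R V k x a d.
  by rewrite nd => /dk[].
rewrite nd in rd; have [_ dkE] := dk r rd; rewrite dkE in E1.
have [s|s sd E2] := @mvt_line R V ('D_a g) (x + r *: a) b d.
  by rewrite nd => sd; apply: derivable_c1at; have [] := H r s rd sd.
exists r, s; split; rewrite ?nd // in sd *.
by rewrite -E2 -E1 /k addrAC.
Qed.

(** The second difference of g over the parallelogram spanned by u a and u b is symmetric in a and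
    b. Dividing by u^2 gives equal mixed derivatives at two points close to x, and continuity
    concludes. *)
Lemma schwarz (R : realType) (V : normedModType R) (g : V -> R) (x a b : V) :
  c2at g x -> 'D_a ('D_b g) x = 'D_b ('D_a g) x.
Proof.
move=> gx; apply/eqP; rewrite -subr_eq0 -normr_le0; apply/ler_addgt0Pr => e e0.
have e20 : 0 < e / 2 by rewrite divr_gt0.
have [_ cab] := c2at_c1at_derive b gx a.
have [_ cba] := c2at_c1at_derive a gx b.
have near3 (P : set V) (p q : V -> R) : (\forall y \near x, P y) ->
    {for x, continuous p} -> {for x, continuous q} ->
    \forall y \near x, [/\ P y, `|p x - p y| < e / 2 & `|q x - q y| < e / 2].
  move=> Px /cvgrPdist_lt/(_ _ e20) px /cvgrPdist_lt/(_ _ e20) qx.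
  by apply: filterS3 Px px qx => y; split.
have := near3 _ _ _ gx cab cba.
move=> /nbhs_ballP[d /= d0 dP].
(* The intermediate points, at distance at most u (|a| + |b|) from x, stay in the ball of radius d;
   the 1 in N covers a = b = 0. *)
pose N := `|a| + `|b| + 1; pose u := d / 2 / N.
have N0 : 0 < N by rewrite /N ltr_wpDl // addr_ge0.
have u0 : 0 < u by rewrite !divr_gt0.
have inb r s : `|r| <= u -> `|s| <= u -> ball x d (x + r *: a + s *: b).
  move=> ru su; rewrite -ball_normE /= -addrA opprD addrA subrr sub0r normrN.
  apply: (le_lt_trans (ler_normD _ _)); rewrite !normrZ.
  have uN : u * N = d / 2 by rewrite /u divfK // gt_eqF.
  have := ler_wpM2r (normr_ge0 a) ru; have := ler_wpM2r (normr_ge0 b) su.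
  by move: uN; rewrite /N !mulrDr mulr1 => *; lra.
have [|r [s [ru su E1]]] := @second_difference R V g x a b u _ (ltW u0).
  by move=> r s ru su; have [[? ?] _ _] := dP _ (inb _ _ ru su).
have inb' r' s' : `|r'| <= u -> `|s'| <= u -> ball x d (x + r' *: b + s' *: a).
  by move=> *; rewrite addrAC; exact: inb.
have [|r' [s' [ru' su' E2]]] := @second_difference R V g x b a u _ (ltW u0).
  by move=> ? ? ru' su'; have [[? ?] _ _] := dP _ (inb' _ _ ru' su').
have [_ _ B1] := dP _ (inb _ _ ru su).
have [_ B2 _] := dP _ (inb' _ _ ru' su').
rewrite add0r; cbv beta in B1, B2; move: B1 B2 E1 E2.
move: ('D_b ('D_a g) (x + r *: a + s *: b)) => p.
move: ('D_a ('D_b g) (x + r' *: b + s' *: a)) => q.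
move: ('D_b ('D_a g) x) ('D_a ('D_b g) x) => px qx.
rewrite [x + u *: b + u *: a]addrAC.
move=> B1 B2 E1 E2; have E : u * (u * p) = u * (u * q).
  by rewrite -E1 -E2; lra.
have un0 : u != 0 by rewrite gt_eqF.
move/(mulfI un0)/(mulfI un0): E => E; rewrite E in B1.
have -> : qx - px = (qx - q) - (px - q) by rewrite opprB addrA subrK.
by apply: (le_trans (ler_normB _ _)); lra.
Qed.

(* [iterD] would otherwise denote the addition law of iterates. *)
Local Notation iterD := Pilot.Defs.iterD.

(** * Extension of derivatives to the boundary *)

(** On such sets a continuous extension from the interior is unique, which gives derivatives
    well-defined boundary values. *)
Definition regular (T : topologicalType) (A : set T) := A `<=` closure A°.

Lemma within_subset_cvg (T U : topologicalType) (A B : set T) (h : T -> U)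
    (x : T) (l : U) :
  A `<=` B -> h @ within B (nbhs x) --> l -> h @ within A (nbhs x) --> l.
Proof.
move=> AB hl P /hl; rewrite /= !nbhs_simpl /within /=.
by apply: filterS => y H Ay; apply: H; exact: AB.
Qed.

Section ContinuousWithin.
Context (T : topologicalType) (A : set T).

Lemma withinP (U : topologicalType) (f : T -> U) :
  {within A, continuous f} <->
  forall x, A x -> f @ within A (nbhs x) --> f x.
Proof. exact: subspace_continuousP. Qed.

Lemma within_cst (U : topologicalType) (c : U) :
  {within A, continuous (fun _ : T => c)}.
Proof. by apply/withinP => x _; exact: cvg_cst. Qed.

Lemma within_comp (U W : topologicalType) (B : set U) (f : T -> U) (g : U -> W) :
  (forall x, A x -> B (f x)) -> {within A, continuous f} ->
  {within B, continuous g} -> {within A, continuous (g \o f)}.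
Proof.
move=> AB /withinP fc /subspace_continuousP gc; apply/withinP => x Ax.
move=> P /(gc _ (AB _ Ax)) /= gP; have := fc x Ax _ gP.
by rewrite /= !nbhs_simpl /within /=; apply: filterS => y H Ay; exact: H (AB _ Ay).
Qed.

Lemma continuous_comp_within (U W : topologicalType) (f : T -> U) (g : U -> W) :
  {within A, continuous f} -> continuous g -> {within A, continuous (g \o f)}.
Proof.
move=> /withinP fc gc; apply/withinP => x Ax.
exact: (cvg_comp _ _ (fc x Ax) (gc _)).
Qed.

Lemma within_eq (U : topologicalType) (f g : T -> U) :
  (forall x, A x -> f x = g x) -> {within A, continuous f} ->
  {within A, continuous g}.
Proof.
move=> fg /withinP fc; apply/withinP => x Ax; rewrite -fg //.
apply: cvg_trans (fc x Ax); apply: near_eq_cvg.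
by apply: (filterS (P := A)) => [y /fg|]; last exact: withinT.
Qed.

Context (R : realType) (W : normedModType R).

Lemma within_add (f g : T -> W) : {within A, continuous f} ->
  {within A, continuous g} -> {within A, continuous (fun x => f x + g x)}.
Proof.
by move=> /withinP fc /withinP gc; apply/withinP => x Ax; apply: cvgD; auto.
Qed.

Lemma within_scale (f : T -> R) (g : T -> W) : {within A, continuous f} ->
  {within A, continuous g} -> {within A, continuous (fun x => f x *: g x)}.
Proof.
by move=> /withinP fc /withinP gc; apply/withinP => x Ax; apply: cvgZ; auto.
Qed.

Lemma within_sum (I : Type) (r : seq I) (f : I -> T -> W) :
  (forall i, {within A, continuous (f i)}) ->
  {within A, continuous (fun x => \sum_(i <- r) f i x)}.
Proof.
move=> fc; elim: r => [|i r IHr].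
  apply: (@within_eq W (fun _ => 0) _ _ (@within_cst W 0)) => x _; by rewrite big_nil.
apply: (@within_eq W _ _ _ (within_add (fc i) IHr)) => x _; by rewrite big_cons.
Qed.

Lemma within_unique (f g : T -> W) : regular A ->
  {within A, continuous f} -> {within A, continuous g} ->
  (forall x, A° x -> f x = g x) -> forall x, A x -> f x = g x.
Proof.
move=> regA /withinP fc /withinP gc fg x Ax.
have FF : ProperFilter (within A° (nbhs x)).
  by apply: within_nbhs_proper; exact: regA.
have cf := within_subset_cvg (@interior_subset _ A) (fc x Ax).
have cg := within_subset_cvg (@interior_subset _ A) (gc x Ax).
apply: (cvg_unique _ cf); first exact: norm_hausdorff.
apply: cvg_trans cg; apply: near_eq_cvg; rewrite near_withinE.
by near=> y => Ay; rewrite fg.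
Unshelve. all: by end_near. Qed.

End ContinuousWithin.

Section CkTheory.
Context (R : realType).

(** [derive_bd] is a [lim], hence a default value unless the limit exists; a continuous extension G
    certifies the limit and computes it. *)
Lemma derive_bd_ext (V W : normedModType R) (A : set V) vs (g G : V -> W) :
  regular A -> {within A, continuous G} ->
  (forall x, A° x -> G x = iterD vs g x) ->
  forall x, A x -> derive_bd A vs g x = G x.
Proof.
move=> regA /withinP Gc Gg x Ax.
have FF : ProperFilter (within A° (nbhs x)).
  by apply: within_nbhs_proper; exact: regA.
apply: cvg_lim; first exact: norm_hausdorff.
apply: cvg_trans (within_subset_cvg (@interior_subset _ A) (Gc x Ax)).
apply: near_eq_cvg; rewrite near_withinE.
by near=> y => Ay; rewrite Gg.
Unshelve. all: by end_near. Qed.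

Lemma Ck_derive_bd (V W : normedModType R) (A : set V) k vs (g : V -> W) :
  regular A -> Ck k A g -> (size vs <= k)%N ->
  {within A, continuous (derive_bd A vs g)} /\
  forall x, A° x -> derive_bd A vs g x = iterD vs g x.
Proof.
move=> regA [_ H] /H[_ [G [Gc Gg]]].
have E := derive_bd_ext regA Gc Gg; split.
  by apply: (within_eq _ Gc) => x Ax; rewrite E.
by move=> x Ax; rewrite E ?Gg //; exact: interior_subset.
Qed.

Lemma Ck_open_c1at (V : normedModType R) (A : set V) k vs (g : V -> R) x :
  Ck k A g -> (size vs < k)%N -> A° x -> c1at (iterD vs g) x.
Proof.
move=> [_ H] sk Ax v; split.
  near=> y; apply: (proj1 (H vs (ltnW sk))) => //; near: y.
  exact: (open_nbhs_nbhs (conj (@open_interior _ A) Ax)).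
have [_ [G [/withinP Gc Gg]]] := H (v :: vs) sk.
have Gx := Gc x (interior_subset Ax).
rewrite (within_interior Ax) in Gx.
have GE : G x = 'D_v (iterD vs g) x by exact: Gg.
suff cG : 'D_v (iterD vs g) y @[y --> x] --> G x by rewrite GE in cG; exact: cG.
apply: cvg_trans Gx; apply: near_eq_cvg.
near=> y; rewrite Gg //; near: y.
exact: (open_nbhs_nbhs (conj (@open_interior _ A) Ax)).
Unshelve. all: by end_near. Qed.

Lemma Ck_c2at (V : normedModType R) (A : set V) k vs (g : V -> R) x :
  Ck k A g -> ((size vs).+1 < k)%N -> A° x -> c2at (iterD vs g) x.
Proof.
move=> gk sk Ax; near=> y.
have Ay : A° y.
  near: y; exact: (open_nbhs_nbhs (conj (@open_interior _ A) Ax)).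
split=> [|v]; first exact: (Ck_open_c1at gk (ltnW sk) Ay).
exact: (@Ck_open_c1at _ _ _ (v :: vs) _ _ gk).
Unshelve. all: by end_near. Qed.

Lemma derive_eq_open (V W : normedModType R) (O : set V) (f g : V -> W) x v :
  open O -> O x -> (forall y, O y -> f y = g y) ->
  'D_v f x = 'D_v g x /\ (derivable f x v -> derivable g x v).
Proof.
move=> Oo Ox fg.
have nfg : {near x, f =1 g}.
  by near=> y; apply: fg; near: y; exact: open_nbhs_nbhs.
by split; [exact: near_eq_derive|exact: near_eq_derivable].
Unshelve. all: by end_near. Qed.

Lemma iterD_lin_pre (V V' W : normedModType R) (L : V -> V') (g : V' -> W) vs :
  linear L -> iterD vs (g \o L) = iterD (map L vs) g \o L.
Proof.
move=> Llin; elim: vs => //= v vs ->; apply/funext => x.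
exact: derive_lin_pre.
Qed.

Lemma Ck_lin_pre (V V' W : normedModType R) (L : V -> V') (g : V' -> W) A B k :
  linear L -> continuous L -> (forall z, A z -> B (L z)) ->
  (forall z, A° z -> B° (L z)) -> Ck k B g -> Ck k A (g \o L).
Proof.
move=> Llin Lc AB ABi [gc H].
have cL : {within A, continuous L} by exact: continuous_subspaceT.
split; first exact: within_comp gc.
move=> vs; rewrite -(size_map L) iterD_lin_pre // => sk.
have [Hd [G [Gc Gg]]] := H _ sk; split.
  move=> sk' z Az v; rewrite derivable_lin_pre //.
  by apply: Hd => //; exact: ABi.
exists (G \o L); split; first exact: within_comp Gc.
by move=> z Az /=; apply: Gg; exact: ABi.
Qed.

Lemma Ck_lin_post (V W W' : normedModType R) (L : W -> W') (g : V -> W) A k :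
  linear L -> continuous L -> Ck k A g -> Ck k A (L \o g) /\
  forall vs, (size vs <= k)%N -> forall x, A° x ->
    iterD vs (L \o g) x = L (iterD vs g x).
Proof.
move=> Llin Lc [gc H].
have E vs : (size vs <= k)%N -> forall x, A° x ->
    iterD vs (L \o g) x = L (iterD vs g x).
  elim: vs => //= v vs IH sk x Ax.
  have [-> _] := derive_eq_open v (@open_interior _ A) Ax (IH (ltnW sk)).
  have [Hd _] := H vs (ltnW sk).
  by have [_ ->] := is_derive_lin_post Llin Lc (Hd sk x Ax v).
split=> //; split; first exact: continuous_comp_within.
move=> vs sk; have [Hd [G [Gc Gg]]] := H vs sk; split.
  move=> sk' x Ax v.
  have E' y : A° y -> (L \o iterD vs g) y = iterD vs (L \o g) y.
    by move=> Ay; rewrite (E vs sk).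
  have [_ ] := derive_eq_open v (@open_interior _ A) Ax E'; apply.
  by have [] := is_derive_lin_post Llin Lc (Hd sk' x Ax v).
exists (L \o G); split; first exact: continuous_comp_within.
by move=> x Ax /=; rewrite Gg // E.
Qed.

Lemma Ck_add_scale (V W : normedModType R) (f g : V -> W) (c : R) A k :
  Ck k A f -> Ck k A g -> Ck k A (fun x => f x + c *: g x) /\
  forall vs, (size vs <= k)%N -> forall x, A° x ->
    iterD vs (fun x => f x + c *: g x) x = iterD vs f x + c *: iterD vs g x.
Proof.
move=> [fc Hf] [gc Hg]; set u := fun x => _.
have D vs x v : (size vs < k)%N -> A° x ->
    is_derive x v (fun x => iterD vs f x + c *: iterD vs g x)
      ('D_v (iterD vs f) x + c *: 'D_v (iterD vs g) x).
  move=> sk Ax; have [df _] := Hf vs (ltnW sk); have [dg _] := Hg vs (ltnW sk).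
  have Df := derivableP (df sk x Ax v); have Dg := derivableP (dg sk x Ax v).
  exact: (is_deriveD Df (is_deriveZ c Dg)).
have E vs : (size vs <= k)%N -> forall x, A° x ->
    iterD vs u x = iterD vs f x + c *: iterD vs g x.
  elim: vs => //= v vs IH sk x Ax.
  have [-> _] := derive_eq_open v (@open_interior _ A) Ax (IH (ltnW sk)).
  by have [_ ->] := D vs x v sk Ax.
have wc (F G : V -> W) : {within A, continuous F} -> {within A, continuous G} ->
    {within A, continuous (fun x => F x + c *: G x)}.
  move=> Fc Gc; apply: within_add => //.
  exact: (within_scale (@within_cst _ A R c) Gc).
split=> //; split; first exact: wc.
move=> vs sk; have [_ [F [Fc Ff]]] := Hf vs sk; have [_ [G [Gc Gg]]] := Hg vs sk.
split.
  move=> sk' x Ax v.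
  have E' y : A° y -> (fun x => iterD vs f x + c *: iterD vs g x) y = iterD vs u y.
    by move=> Ay; rewrite (E vs sk).
  have [_ ] := derive_eq_open v (@open_interior _ A) Ax E'; apply.
  by have [] := D vs x v sk' Ax.
exists (fun x => F x + c *: G x); split; first exact: wc.
by move=> x Ax; rewrite E // Ff // Gg.
Qed.

Lemma derive_bd_add_scale (V W : normedModType R) (f g : V -> W) (c : R) A k vs x :
  regular A -> Ck k A f -> Ck k A g -> (size vs <= k)%N -> A x ->
  derive_bd A vs (fun x => f x + c *: g x) x =
  derive_bd A vs f x + c *: derive_bd A vs g x.
Proof.
move=> regA fk gk sk Ax.
have [fc fE] := Ck_derive_bd regA fk sk; have [gc gE] := Ck_derive_bd regA gk sk.
have [_ E] := Ck_add_scale c fk gk.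
pose G x := derive_bd A vs f x + c *: derive_bd A vs g x.
apply: (@derive_bd_ext _ _ _ _ _ G) => //.
  by apply: within_add => //; exact: (within_scale (@within_cst _ A R c) gc).
by move=> y Ay; rewrite /G E // fE // gE.
Qed.

Lemma derive_bd_lin_pre (V V' W : normedModType R) (L : V -> V') (g : V' -> W)
    A B k vs x :
  linear L -> continuous L -> (forall z, A z -> B (L z)) ->
  (forall z, A° z -> B° (L z)) -> regular A -> regular B -> Ck k B g ->
  (size vs <= k)%N -> A x ->
  derive_bd A vs (g \o L) x = derive_bd B (map L vs) g (L x).
Proof.
move=> Llin Lc AB ABi regA regB gk sk Ax.
have [|gc gE] := @Ck_derive_bd _ _ B k (map L vs) g regB gk.
  by rewrite size_map.
apply: (@derive_bd_ext _ _ A _ _ (derive_bd B (map L vs) g \o L)) => //.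
  by apply: (within_comp AB) => //; exact: continuous_subspaceT.
by move=> y Ay /=; rewrite iterD_lin_pre // gE //; exact: ABi.
Qed.

End CkTheory.

Lemma within_mul (R : realType) (T : topologicalType) (A : set T)
    (f g : T -> R) : {within A, continuous f} -> {within A, continuous g} ->
  {within A, continuous (fun x => f x * g x)}.
Proof.
by move=> /withinP fc /withinP gc; apply/withinP => x Ax; apply: cvgM; auto.
Qed.

Lemma within_opp (R : realType) (T : topologicalType) (A : set T)
    (f : T -> R) : {within A, continuous f} ->
  {within A, continuous (fun x => - f x)}.
Proof.
by move=> /withinP fc; apply/withinP => x Ax; apply: cvgN; auto.
Qed.

Lemma within_mulr (R : realType) (T : topologicalType) (A : set T)
    (f : T -> R) (c : R) : {within A, continuous f} ->
  {within A, continuous (fun x => c * f x)}.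
Proof. by apply: within_mul; exact: within_cst. Qed.

Lemma within_addR (R : realType) (T : topologicalType) (A : set T)
    (f g : T -> R) : {within A, continuous f} -> {within A, continuous g} ->
  {within A, continuous (fun x => f x + g x)}.
Proof.
by move=> /withinP fc /withinP gc; apply/withinP => x Ax; apply: cvgD; auto.
Qed.

Lemma within_sumR (R : realType) (T : topologicalType) (A : set T)
    (I : Type) (r : seq I) (f : I -> T -> R) :
  (forall i, {within A, continuous (f i)}) ->
  {within A, continuous (fun x => \sum_(i <- r) f i x)}.
Proof. exact: (@within_sum _ A R R^o). Qed.

Lemma within_uniqueR (R : realType) (T : topologicalType) (A : set T)
    (f g : T -> R) : regular A ->
  {within A, continuous f} -> {within A, continuous g} ->
  (forall x, A° x -> f x = g x) -> forall x, A x -> f x = g x.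
Proof. exact: (@within_unique _ A R R^o). Qed.

(** * The Levi form of a function, up to the boundary *)

Section JLemmas.
Context (R : realType) (m : nat).
Implicit Types v w : Cn R m.

Lemma Jc_lin : linear (@Jc R m).
Proof.
move=> a [v1 v2] [w1 w2]; rewrite /Jc /= opprD -scalerN.
by [].
Qed.

Lemma JcK v : Jc (Jc v) = - v.
Proof. by case: v. Qed.

Lemma Jc_continuous : continuous (@Jc R m).
Proof.
move=> v; have H1 : x.1 @[x --> v] --> v.1 by exact: cvg_fst.
have H2 : - x.2 @[x --> v] --> - v.2 by apply: cvgN; exact: cvg_snd.
exact: (cvg_pair H2 H1).
Qed.

Lemma lin_expand (L : Cn R m -> R) :
  (forall a v w, L (a *: v + w) = a * L v + L w) ->
  forall v, L v = \sum_k crd k v * L (bas R k).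
Proof.
move=> Ll v; have L0 : L 0 = 0.
  have := Ll 1 0 0; rewrite scaler0 addr0 mul1r; lra.
rewrite [in LHS](bas_expand v); elim: (index_enum _) => [|k r IH].
  by rewrite !big_nil.
by rewrite !big_cons Ll IH.
Qed.

Lemma bilin_expand (B : Cn R m -> Cn R m -> R) :
  (forall a v1 v2 w, B (a *: v1 + v2) w = a * B v1 w + B v2 w) ->
  (forall v w, B v w = - B w v) ->
  forall v w, B v w =
    \sum_k crd k v * \sum_l crd l w * B (bas R k) (bas R l).
Proof.
move=> Bl Ba v w; rewrite (lin_expand (fun a v1 v2 => Bl a v1 v2 w)).
apply: eq_bigr => k _; congr (_ * _).
apply: (@lin_expand (B (bas R k))) => a w1 w2.
by rewrite Ba Bl opprD -mulrN -!Ba.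
Qed.
End JLemmas.

Section LeviAlgebra.
Context (R : realType) (m : nat) (H : Cn R m -> Cn R m -> R).
Implicit Types v w : Cn R m.
Hypothesis Hlin : forall a v1 v2 w, H (a *: v1 + v2) w = a * H v1 w + H v2 w.
Hypothesis Hsym : forall v w, H v w = H w v.

(** For symmetric H this is H'(Jv, w), where H'(v, w) = (H(v, w) + H(Jv, Jw)) / 2 is the J-invariant
    part of H. *)
Definition levi_of v w : R := (H (Jc v) w - H v (Jc w)) / 2%:R.

Lemma levi_of_linear a v1 v2 w :
  levi_of (a *: v1 + v2) w = a * levi_of v1 w + levi_of v2 w.
Proof. by rewrite /levi_of Jc_lin !Hlin; field. Qed.

Lemma levi_of_antisym v w : levi_of v w = - levi_of w v.
Proof. by rewrite /levi_of (Hsym (Jc v)) (Hsym v); field. Qed.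

Lemma levi_of_J v w : levi_of (Jc v) (Jc w) = levi_of v w.
Proof.
have HN v' w' : H (- v') w' = - H v' w'.
  have H0 : H 0 w' = 0.
    by have := Hlin 1 0 0 w'; rewrite scaler0 addr0 mul1r; lra.
  by have := Hlin (-1) v' 0 w'; rewrite scaleN1r addr0 H0; lra.
by rewrite /levi_of !JcK HN (Hsym (Jc v) (- w)) HN (Hsym w); field.
Qed.
End LeviAlgebra.

Section Hessian.
Context (R : realType) (m : nat) (g : Cn R m -> R) (x : Cn R m).
Hypothesis gx : c2at g x.

Lemma hess_linear a v1 v2 w :
  'D_(a *: v1 + v2) ('D_w g) x = a * 'D_v1 ('D_w g) x + 'D_v2 ('D_w g) x.
Proof. exact: (derive_linear a v1 v2 (c2at_c1at_derive w gx)). Qed.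

Lemma hess_sym v w : 'D_v ('D_w g) x = 'D_w ('D_v g) x.
Proof. exact: schwarz. Qed.
End Hessian.

Section Levi.
Context (R : realType) (m : nat).
Implicit Types (g : Cn R m -> R) (v w x : Cn R m) (A : set (Cn R m)).

(** Made of true second derivatives, hence accessible to calculus, but only in the interior; [levi]
    is its extension to the boundary and is what [iddbar] unfolds to. *)
Definition levi_int g x := levi_of (fun a b => 'D_a ('D_b g) x).

Lemma levi_int_linear g x a v1 v2 w : c2at g x ->
  levi_int g x (a *: v1 + v2) w = a * levi_int g x v1 w + levi_int g x v2 w.
Proof. by move=> gx; apply: levi_of_linear; exact: hess_linear. Qed.

Lemma levi_int_antisym g x v w : c2at g x ->
  levi_int g x v w = - levi_int g x w v.
Proof. by move=> gx; apply: levi_of_antisym; exact: hess_sym. Qed.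

Lemma levi_int_J g x v w : c2at g x ->
  levi_int g x (Jc v) (Jc w) = levi_int g x v w.
Proof.
by move=> gx; apply: levi_of_J; [exact: hess_linear|exact: hess_sym].
Qed.

Definition levi A g x v w : R :=
  (derive_bd A [:: Jc v; w] g x - derive_bd A [:: v; Jc w] g x) / 2%:R.

Context (A : set (Cn R m)) (g : Cn R m -> R).
Hypotheses (regA : regular A) (gA : Ck 2 A g).

Lemma Ck2_c2at x : A° x -> c2at g x.
Proof. exact: (Ck_c2at (vs := [::]) gA). Qed.

Lemma levi_int_eq x v w : A° x -> levi A g x v w = levi_int g x v w.
Proof.
move=> Ax; rewrite /levi /levi_int /levi_of.
have [_ E1] := @Ck_derive_bd R _ _ A 2 [:: Jc v; w] g regA gA isT.
have [_ E2] := @Ck_derive_bd R _ _ A 2 [:: v; Jc w] g regA gA isT.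
by rewrite (E1 x Ax) (E2 x Ax).
Qed.

Lemma levi_continuous v w : {within A, continuous (fun x => levi A g x v w)}.
Proof.
have [E1 _] := @Ck_derive_bd R _ _ A 2 [:: Jc v; w] g regA gA isT.
have [E2 _] := @Ck_derive_bd R _ _ A 2 [:: v; Jc w] g regA gA isT.
move: E1 E2; rewrite /levi.
move: (derive_bd _ _ _) (derive_bd _ _ _) => p q pc qc.
apply/withinP => x Ax; move/withinP: pc => /(_ x Ax) pc.
by move/withinP: qc => /(_ x Ax) qc; apply: cvgMl; apply: cvgB.
Qed.

Lemma levi_linear x a v1 v2 w : A x ->
  levi A g x (a *: v1 + v2) w = a * levi A g x v1 w + levi A g x v2 w.
Proof.
move: x; apply: (within_uniqueR regA); first exact: levi_continuous.
  by apply: within_addR; [apply: within_mulr|]; exact: levi_continuous.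
move=> x Ax; rewrite (levi_int_eq (a *: v1 + v2) w Ax).
rewrite (levi_int_eq v1 w Ax) (levi_int_eq v2 w Ax).
exact: (levi_int_linear _ _ _ _ (Ck2_c2at Ax)).
Qed.

Lemma levi_antisym x v w : A x -> levi A g x v w = - levi A g x w v.
Proof.
move: x; apply: (within_uniqueR regA); first exact: levi_continuous.
  by apply: within_opp; exact: levi_continuous.
move=> x Ax; rewrite (levi_int_eq v w Ax) (levi_int_eq w v Ax).
exact: (levi_int_antisym _ _ (Ck2_c2at Ax)).
Qed.

Lemma levi_J x v w : A x -> levi A g x (Jc v) (Jc w) = levi A g x v w.
Proof.
move=> Ax; apply: (@within_uniqueR _ _ _ (fun x => levi A g x (Jc v) (Jc w))
    (fun x => levi A g x v w) regA _ _ _ x Ax).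
- exact: levi_continuous.
- exact: levi_continuous.
move=> y Ay; rewrite (levi_int_eq (Jc v) (Jc w) Ay) (levi_int_eq v w Ay).
exact: (levi_int_J _ _ (Ck2_c2at Ay)).
Qed.

Lemma derive_bd_expand x v : A x ->
  derive_bd A [:: v] g x = \sum_k crd k v * derive_bd A [:: bas R k] g x.
Proof.
have D w := @Ck_derive_bd R _ _ A 2 [:: w] g regA gA isT.
move: x; apply: (within_uniqueR regA); first by have [] := D v.
  apply: within_sumR => k; have [Dk _] := D (bas R k).
  exact: within_mulr.
move=> x Ax; have [_ ->//] := D v.
rewrite [RHS](_ : _ = \sum_k crd k v * 'D_(bas R k) g x).
  exact: (derive_sum_bas _ (c2at_c1at (Ck2_c2at Ax))).
by apply: eq_bigr => k _; have [_ ->] := D (bas R k).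
Qed.
End Levi.

Local Notation coord := Pilot.Defs.coord.

(** * Change of charts *)

Section Atlas.
Context (R : realType) (T : topologicalType) (m : nat) (A : charts R T m).
Hypothesis atlas : complex_atlas A.

Lemma atlas_cover p : exists i : idx A, dom i p.
Proof. by case: atlas. Qed.
Lemma atlas_open (i : idx A) : open (dom i).
Proof. by case: atlas => _ []. Qed.
Lemma atlas_coord (i : idx A) : {within dom i, continuous (coord i)}.
Proof. by case: atlas => _ [_ []]. Qed.
Lemma atlas_param (i : idx A) : {within img i, continuous (param i)}.
Proof. by case: atlas => _ [_ [_ []]]. Qed.
Lemma atlas_paramK (i : idx A) p : dom i p -> param i (coord i p) = p.
Proof. by case: atlas => _ [_ [_ [_ [+ _]]]]; exact. Qed.
Lemma atlas_regular (i : idx A) : regular (img i).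
Proof. by case: atlas => _ [_ [_ [_ [_ [+ _]]]]]; exact. Qed.
Lemma atlas_trans (i j : idx A) k : Ck k (overlap i j) (trans i j).
Proof. by case: atlas => _ [_ [_ [_ [_ [_ [+ _]]]]]]; exact. Qed.
Lemma atlas_holo (i j : idx A) z v : (overlap i j)° z ->
  'D_(Jc v) (trans i j) z = Jc ('D_v (trans i j) z).
Proof. by case: atlas => _ [_ [_ [_ [_ [_ [_ [+ _]]]]]]] => H /H; exact. Qed.
Lemma atlas_interior (i j : idx A) p : dom i p -> dom j p ->
  (img i)° (coord i p) -> (img j)° (coord j p).
Proof. by case: atlas => _ [_ [_ [_ [_ [_ [_ [_ +]]]]]]]; exact. Qed.

Lemma img_coord (i : idx A) p : dom i p -> img i (coord i p).
Proof. by move=> ip; exists p. Qed.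

Lemma dom_param (i : idx A) z : img i z -> dom i (param i z).
Proof. by move=> [p ip <-]; rewrite atlas_paramK. Qed.

Lemma coord_param (i : idx A) z : img i z -> coord i (param i z) = z.
Proof. by move=> [p ip <-]; rewrite atlas_paramK. Qed.

Lemma overlapP (i j : idx A) z :
  overlap i j z <-> img i z /\ dom j (param i z).
Proof.
split=> [[p [ip jp] <-]|[iz jz]].
  by split; [exact: img_coord|rewrite atlas_paramK].
by exists (param i z); [split => //; exact: dom_param|exact: coord_param].
Qed.

Lemma coord_continuous_at (i : idx A) p : dom i p -> {for p, continuous (coord i)}.
Proof.
move=> ip; have /withinP/(_ p ip) := @atlas_coord i.
by rewrite within_interior //; exact: (open_nbhs_nbhs (conj (@atlas_open i) ip)).
Qed.

(** The overlap is relatively open in [img i], since [param i] is continuous there and [dom j] is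
    open. *)
Lemma overlap_near (i j : idx A) z : overlap i j z ->
  \forall y \near z, img i y -> overlap i j y.
Proof.
move=> /overlapP[iz jz].
have /withinP/(_ z iz) := @atlas_param i.
move=> /(_ (dom j) (open_nbhs_nbhs (conj (@atlas_open j) jz))).
rewrite /= !nbhs_simpl /within /=; apply: filterS => y H iy.
by apply/overlapP; split => //; exact: H.
Qed.

Lemma overlap_interior (i j : idx A) z : overlap i j z -> (img i)° z ->
  (overlap i j)° z.
Proof.
move=> oz iz; have := overlap_near oz.
by apply: filterS2 iz => y iy; exact.
Qed.

(** A relatively open part of a regular set is regular. *)
Lemma overlap_regular (i j : idx A) : regular (overlap i j).
Proof.
move=> z oz N Nz; have /overlapP[iz _] := oz.
pose U := [set y | img i y -> overlap i j y]°.
have Uo : open U by exact: open_interior.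
have Uz : U z by exact: (overlap_near oz).
have NU : nbhs z (N `&` U).
  by apply: filterI => //; exact: open_nbhs_nbhs.
have [y [iy [Ny Uy]]] := atlas_regular iz NU.
exists y; split => //; apply: overlap_interior => //.
exact: (interior_subset Uy (interior_subset iy)).
Qed.

Lemma overlap_img (i j : idx A) z : overlap i j z -> img i z.
Proof. by move=> /overlapP[]. Qed.

Lemma overlap_img_interior (i j : idx A) z : (overlap i j)° z -> (img i)° z.
Proof. by apply: filterS => y; exact: overlap_img. Qed.

Lemma trans_img (i j : idx A) z : overlap i j z -> img j (trans i j z).
Proof. by move=> /overlapP[_ jz]; exact: img_coord. Qed.

(** Charts agree on interior points by the last clause of [complex_atlas]; hence the derivatives of
    u in the chart j are available at the image point. *)
Lemma trans_interior (i j : idx A) z : (overlap i j)° z ->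
  (img j)° (trans i j z).
Proof.
move=> oz; have /overlapP[iz jz] := interior_subset oz.
apply: (@atlas_interior i j _ (dom_param iz) jz).
by rewrite coord_param //; exact: overlap_img_interior oz.
Qed.

Lemma trans_coord (i j : idx A) p : dom i p -> trans i j (coord i p) = coord j p.
Proof. by move=> ip; rewrite /trans /= atlas_paramK. Qed.

Lemma param_trans (i j : idx A) z : overlap i j z ->
  param j (trans i j z) = param i z.
Proof. by move=> /overlapP[_ jz]; rewrite /trans /= atlas_paramK. Qed.

Lemma overlap_coord (i j : idx A) p : dom i p -> dom j p ->
  overlap i j (coord i p).
Proof. by move=> ip jp; exists p. Qed.

Lemma trans_derivable (i j : idx A) z v : (overlap i j)° z ->
  derivable (trans i j) z v.
Proof.
by move=> oz; have [_ /(_ [::] isT)[+ _]] := @atlas_trans i j 1; exact.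
Qed.

(** Schwarz's theorem and linearity in the direction are known for real functions; they reach the
    vector-valued transition maps one coordinate at a time. *)
Lemma trans_crd_Ck (i j : idx A) b k : Ck k (overlap i j) (crd b \o trans i j) /\
  forall vs, (size vs <= k)%N -> forall x, (overlap i j)° x ->
    iterD vs (crd b \o trans i j : _ -> R^o) x = crd b (iterD vs (trans i j) x).
Proof.
exact: (Ck_lin_post (crd_lin b) (@crd_continuous _ _ b) (@atlas_trans i j k)).
Qed.

Lemma trans_schwarz (i j : idx A) z v w : (overlap i j)° z ->
  'D_v ('D_w (trans i j)) z = 'D_w ('D_v (trans i j)) z.
Proof.
move=> oz; apply: crd_inj => b; have [C E] := @trans_crd_Ck i j b 2.
have C2 : c2at (crd b \o trans i j) z := Ck_c2at (vs := [::]) C isT oz.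
have Evw := E [:: v; w] isT z oz; have Ewv := E [:: w; v] isT z oz.
exact: (eq_trans (esym Evw) (eq_trans (schwarz v w C2) Ewv)).
Qed.

(** The Cauchy-Riemann relation [atlas_holo] holds on an open set, so it may be differentiated; J is
    linear and continuous. *)
Lemma trans_holo2 (i j : idx A) z v w : (overlap i j)° z ->
  'D_v ('D_(Jc w) (trans i j)) z = Jc ('D_v ('D_w (trans i j)) z).
Proof.
move=> oz.
have [E _] := @derive_eq_open R _ _ _ (fun y => 'D_(Jc w) (trans i j) y)
  (@Jc R m \o (fun y => 'D_w (trans i j) y)) z v (@open_interior _ _) oz
  (fun y oy => atlas_holo w oy).
have d2 : derivable (fun y => 'D_w (trans i j) y) z v.
  by have [_ /(_ [:: w] isT)[+ _]] := @atlas_trans i j 2; exact.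
have [_ E2] := is_derive_lin_post (@Jc_lin R m) (@Jc_continuous R m) d2.
exact: (eq_trans E E2).
Qed.

Lemma trans_holo2' (i j : idx A) z v w : (overlap i j)° z ->
  'D_(Jc v) ('D_w (trans i j)) z = Jc ('D_v ('D_w (trans i j)) z).
Proof.
move=> oz; apply: (eq_trans (trans_schwarz (Jc v) w oz)).
apply: (eq_trans (trans_holo2 w v oz)).
exact: (congr1 (@Jc R m) (trans_schwarz w v oz)).
Qed.

(** The differential of the transition map, boundary points included: the map [d] of
    [real11form]. *)
Definition dtr (i j : idx A) (z v : Cn R m) : Cn R m :=
  derive_bd (overlap i j) [:: v] (trans i j) z.

Lemma dtr_within (i j : idx A) v :
  {within overlap i j, continuous (fun z => dtr i j z v)} /\
  forall z, (overlap i j)° z -> dtr i j z v = 'D_v (trans i j) z.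
Proof.
exact: (@Ck_derive_bd R _ _ _ 1 [:: v] _ (@overlap_regular i j)
  (@atlas_trans i j 1) isT).
Qed.

Lemma dtr_continuous (i j : idx A) v :
  {within overlap i j, continuous (fun z => dtr i j z v)}.
Proof. by case: (dtr_within i j v). Qed.

Lemma dtr_int (i j : idx A) v z : (overlap i j)° z ->
  dtr i j z v = 'D_v (trans i j) z.
Proof. by case: (dtr_within i j v) => _; exact. Qed.

Lemma dtr_J (i j : idx A) z v : overlap i j z ->
  dtr i j z (Jc v) = Jc (dtr i j z v).
Proof.
move=> oz; apply: (@within_unique _ _ R (Cn R m) (fun z => dtr i j z (Jc v))
  (fun z => Jc (dtr i j z v)) (@overlap_regular i j) _ _ _ z oz).
- exact: dtr_continuous.
- apply: (@continuous_comp_within _ _ _ _ (fun z => dtr i j z v) (@Jc R m)).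
    exact: dtr_continuous.
  exact: Jc_continuous.
move=> y oy; rewrite (dtr_int (Jc v) oy) (dtr_int v oy).
exact: atlas_holo.
Qed.

Lemma trans_derive_linear (i j : idx A) z a v w : (overlap i j)° z ->
  'D_(a *: v + w) (trans i j) z = a *: 'D_v (trans i j) z + 'D_w (trans i j) z.
Proof.
move=> oz; apply: crd_inj => b; have [C E] := @trans_crd_Ck i j b 1.
have C1 : c1at (crd b \o trans i j) z := Ck_open_c1at (vs := [::]) C isT oz.
rewrite (crd_lin b a ('D_v (trans i j) z) ('D_w (trans i j) z)).
have Ev := E [:: v] isT z oz; have Ew := E [:: w] isT z oz.
have Ea := E [:: a *: v + w] isT z oz.
apply: (eq_trans (esym Ea)); apply: (eq_trans (derive_linear a v w C1)).
exact: (congr2 (fun p q => a * p + q) Ev Ew).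
Qed.

Lemma dtr_linear (i j : idx A) z a v w : overlap i j z ->
  dtr i j z (a *: v + w) = a *: dtr i j z v + dtr i j z w.
Proof.
move=> oz; apply: (@within_unique _ _ R (Cn R m)
  (fun z => dtr i j z (a *: v + w))
  (fun z => a *: dtr i j z v + dtr i j z w) (@overlap_regular i j) _ _ _ z oz).
- exact: dtr_continuous.
- apply: within_add; last exact: dtr_continuous.
  by apply: within_scale; [exact: within_cst|exact: dtr_continuous].
move=> y oy; rewrite (dtr_int _ oy) (dtr_int v oy) (dtr_int w oy).
exact: trans_derive_linear.
Qed.

Lemma crd_dtr_continuous (i j : idx A) v k :
  {within overlap i j, continuous (fun z => crd k (dtr i j z v))}.
Proof.
apply: (@continuous_comp_within _ _ _ _ (fun z => dtr i j z v) (crd k)).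
  exact: dtr_continuous.
exact: crd_continuous.
Qed.
End Atlas.

Lemma is_derive_sum_mul (R : realType) (U : normedModType R) (z a : U)
    (I : Type) (r : seq I) (p q : I -> U -> R) (dp dq : I -> R) :
  (forall i, is_derive z a (p i) (dp i)) ->
  (forall i, is_derive z a (q i) (dq i)) ->
  is_derive z a (fun y => \sum_(i <- r) p i y * q i y)
    (\sum_(i <- r) dp i * q i z + \sum_(i <- r) p i z * dq i).
Proof.
move=> Dp Dq; elim: r => [|i r IH].
  rewrite !big_nil addr0; apply: (@near_eq_is_derive _ _ _ (cst 0)).
    by apply: nearW => y; rewrite big_nil.
have D := is_deriveD (is_deriveM (Dp i) (Dq i)) IH.
apply: (@near_eq_is_derive _ _ _ _ _ _ _ _ _ (is_derive_eq D _)).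
  by apply: nearW => y; rewrite big_cons.
rewrite !big_cons /GRing.scale /= [q i z * _]mulrC.
move: (dp i * _) (p i z * dq i) (\sum_(_ <- r) _) (\sum_(_ <- r) _) => *.
by ring.
Qed.

Section Pullback.
Context (R : realType) (T : topologicalType) (m : nat) (A : charts R T m).
Hypothesis atlas : complex_atlas A.
Context (u : T -> R) (uC2 : mfd_Ck A 2 u) (i j : idx A).
Local Notation O := (overlap i j).
Local Notation tau := (trans i j).
Local Notation gi := (u \o param i).
Local Notation gj := (u \o param j).

Lemma pull_eq y : O y -> gi y = (gj \o tau) y.
Proof. by move=> oy /=; rewrite -(param_trans atlas oy). Qed.

Lemma pull_c2at z : O° z -> c2at gj (tau z).
Proof.
by move=> oz; exact: (Ck2_c2at (uC2 j) (trans_interior atlas oz)).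
Qed.

Lemma derive_pull_sum z v : O° z ->
  'D_v gi z = \sum_k crd k ('D_v tau z) * 'D_(bas R k) gj (tau z).
Proof.
move=> oz; have [E _] := derive_eq_open v (@open_interior _ O) oz
  (fun y oy => pull_eq (interior_subset oy)).
have [_ E2] := is_derive_comp_sum (trans_derivable atlas (v := v) oz)
  (c2at_c1at (pull_c2at oz)).
exact: (eq_trans E E2).
Qed.

(* For a holomorphic transition map the first term is annihilated by the
   passage to [i d dbar]. *)
Lemma hess_pull z a b : O° z ->
  'D_a ('D_b gi) z = 'D_('D_a ('D_b tau) z) gj (tau z) +
    'D_('D_a tau z) ('D_('D_b tau z) gj) (tau z).
Proof.
move=> oz; have gz := pull_c2at oz.
pose F y := \sum_k crd k ('D_b tau y) * 'D_(bas R k) gj (tau y).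
have [E _] := @derive_eq_open R _ _ O° (fun y => 'D_b gi y) F z a
  (@open_interior _ _) oz (fun y oy => derive_pull_sum b oy).
have d2 : derivable (fun y => 'D_b tau y) z a.
  by have [_ /(_ [:: b] isT)[+ _]] := @atlas_trans _ _ _ _ atlas i j 2; exact.
have D1 k := is_derive_crd k d2.
have D2 k := is_derive_comp (trans_derivable atlas (v := a) oz)
  (c2at_c1at_derive (bas R k) gz).
have [_ E2] := is_derive_sum_mul (index_enum _) D1 D2.
apply: (eq_trans E); apply: (eq_trans E2).
congr (_ + _); first exact: (esym (derive_sum_bas _ (c2at_c1at gz))).
apply: (eq_trans _ (hess_sym gz _ _)).
apply: (eq_trans _ (esym (derive_sum_bas _ (c2at_c1at_derive _ gz)))).
apply: eq_bigr => k _; apply: (congr1 (fun x => _ * x)).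
exact: (hess_sym gz).
Qed.

Lemma levi_int_pull z v w : O° z ->
  levi_int gi z v w = levi_int gj (tau z) ('D_v tau z) ('D_w tau z).
Proof.
move=> oz.
(* Here c is the derivative along J(D_v D_w tau). Both Hessians contain it because the transition is
   holomorphic, and it cancels in their difference. *)
have alg (p q c p' q' : R) : p = c + p' -> q = c + q' ->
    (p - q) / 2%:R = (p' - q') / 2%:R by move=> -> ->; field.
apply: alg.
  apply: (eq_trans (hess_pull (Jc v) w oz)).
  apply: (congr2 (fun x y : R => x + y)).
    exact: (congr1 (fun x => 'D_x gj (tau z)) (trans_holo2' atlas v w oz)).
  exact: (congr1 (fun x => 'D_x ('D_('D_w tau z) gj) (tau z))
    (atlas_holo atlas v oz)).
apply: (eq_trans (hess_pull v (Jc w) oz)).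
apply: (congr2 (fun x y : R => x + y)).
  exact: (congr1 (fun x => 'D_x gj (tau z)) (trans_holo2 atlas v w oz)).
exact: (congr1 (fun x => 'D_('D_v tau z) ('D_x gj) (tau z))
  (atlas_holo atlas w oz)).
Qed.

Lemma tau_within : {within O, continuous tau}.
Proof. by have [] := @atlas_trans _ _ _ _ atlas i j 0. Qed.

Lemma within_pull (G : Cn R m -> R) : {within img j, continuous G} ->
  {within O, continuous (fun z => G (tau z))}.
Proof.
apply: (@within_comp _ _ _ _ (img j) tau G); last exact: tau_within.
by move=> x ox; exact: trans_img.
Qed.

Lemma levi_pull z v w : O z ->
  levi (img i) gi z v w =
  levi (img j) gj (tau z) (dtr i j z v) (dtr i j z w).
Proof.
have regi := @atlas_regular _ _ _ _ atlas i.
have regj := @atlas_regular _ _ _ _ atlas j.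
(* The arguments of the form vary with y. Expanding them on the basis exhibits a sum of products of
   continuous functions, whence continuity up to the boundary. *)
have X y : O y -> levi (img j) gj (tau y) (dtr i j y v) (dtr i j y w) =
  \sum_k crd k (dtr i j y v) * \sum_l crd l (dtr i j y w) *
    levi (img j) gj (tau y) (bas R k) (bas R l).
  move=> oy; have ty := trans_img atlas oy; apply: bilin_expand.
    by move=> *; apply: (levi_linear regj (uC2 j)).
  by move=> *; apply: (levi_antisym regj (uC2 j)).
move=> oz; apply: (@within_uniqueR _ _ _
  (fun z => levi (img i) gi z v w)
  (fun z => levi (img j) gj (tau z) (dtr i j z v) (dtr i j z w))
  (@overlap_regular _ _ _ _ atlas i j) _ _ _ z oz).
- apply: (@continuous_subspaceW _ _ _ (img i)); first by move=> y /overlap_img; exact.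
  exact: (levi_continuous regi (uC2 i)).
- apply: (@within_eq _ _ _ _ _ (fun y oy => esym (X y oy))).
  apply: within_sumR => k; apply: within_mul.
    exact: crd_dtr_continuous.
  apply: within_sumR => l; apply: within_mul.
    exact: crd_dtr_continuous.
  apply: (@within_pull (fun y => levi (img j) gj y (bas R k) (bas R l))).
  exact: (levi_continuous regj (uC2 j)).
move=> y oy; rewrite (dtr_int atlas v oy) (dtr_int atlas w oy).
rewrite (levi_int_eq regi (uC2 i) v w (overlap_img_interior atlas oy)).
rewrite (levi_int_eq regj (uC2 j) _ _ (trans_interior atlas oy)).
exact: levi_int_pull.
Qed.

Lemma derive_bd_pull z v : O z ->
  derive_bd (img i) [:: v] gi z =
  derive_bd (img j) [:: dtr i j z v] gj (tau z).
Proof.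
have regi := @atlas_regular _ _ _ _ atlas i.
have regj := @atlas_regular _ _ _ _ atlas j.
have Dj w := @Ck_derive_bd R _ _ (img j) 2 [:: w] gj regj (uC2 j) isT.
have [Dic Dii] := @Ck_derive_bd R _ _ (img i) 2 [:: v] gi regi (uC2 i) isT.
have X y : O y -> derive_bd (img j) [:: dtr i j y v] gj (tau y) =
  \sum_k crd k (dtr i j y v) * derive_bd (img j) [:: bas R k] gj (tau y).
  by move=> oy; have := derive_bd_expand regj (uC2 j) _ (trans_img atlas oy); exact.
move=> oz; apply: (@within_uniqueR _ _ _
  (fun z => derive_bd (img i) [:: v] gi z)
  (fun z => derive_bd (img j) [:: dtr i j z v] gj (tau z))
  (@overlap_regular _ _ _ _ atlas i j) _ _ _ z oz).
- by apply: (@continuous_subspaceW _ _ _ (img i)) => // y /overlap_img; exact.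
- apply: (@within_eq _ _ _ _ _ (fun y oy => esym (X y oy))).
  apply: within_sumR => k; apply: within_mul.
    exact: crd_dtr_continuous.
  by have [Dk _] := Dj (bas R k); exact: within_pull.
move=> y oy; rewrite (X y (interior_subset oy)).
rewrite (Dii y (overlap_img_interior atlas oy)).
apply: (eq_trans (derive_pull_sum v oy)); apply: eq_bigr => k _.
rewrite (dtr_int atlas v oy); apply: (congr1 (fun x => _ * x)).
by have [_ E] := Dj (bas R k); exact: (esym (E _ (trans_interior atlas oy))).
Qed.
End Pullback.

Lemma iddbar_real11form (R : realType) (T : topologicalType) (m : nat)
    (A : charts R T m) (u : T -> R) :
  complex_atlas A -> mfd_Ck A 2 u -> real11form (iddbar u : form2 A).
Proof.
move=> atlas uC2.
have reg i := @atlas_regular _ _ _ _ atlas i.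
split=> [i p ip a v1 v2 w|].
  exact: (levi_linear (reg i) (uC2 i) a v1 v2 w (img_coord ip)).
split=> [i p ip v w|].
  exact: (levi_antisym (reg i) (uC2 i) v w (img_coord ip)).
split=> [i p ip v w|i j p ip jp v w d].
  exact: (levi_J (reg i) (uC2 i) v w (img_coord ip)).
have := levi_pull atlas uC2 v w (overlap_coord ip jp).
by rewrite (trans_coord atlas _ ip).
Qed.

(** * Eigenvalues of a real (1,1)-form *)

Section Codiagonalization.
Local Open Scope sesquilinear_scope.
Context (C : numClosedFieldType) (n : nat).
Implicit Types (A B G : 'M[C]_n) (z : 'rV[C]_n).

Definition qf A z : C := (z *m A *m z ^t*) 0 0.

Lemma trC_mul (m p q : nat) (A : 'M[C]_(m, p)) (B : 'M[C]_(p, q)) :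
  (A *m B) ^t* = B ^t* *m A ^t*.
Proof. by rewrite trmx_mul map_mxM. Qed.

Lemma qf_mul A G z : qf A (z *m G) = qf (G *m A *m G ^t*) z.
Proof. by rewrite /qf trC_mul !mulmxA. Qed.

Lemma qf_diag (l z : 'rV[C]_n) : qf (diag_mx l) z = \sum_j l 0 j * `|z 0 j| ^+ 2.
Proof.
rewrite /qf mxE; apply: eq_bigr => j _; rewrite !mxE.
rewrite (bigD1 j) //= big1 ?addr0.
  by rewrite !mxE eqxx mulr1n normCK mulrCA mulrA.
by move=> k kj; rewrite !mxE (negbTE kj) mulr0n mulr0.
Qed.

Lemma qf1 z : qf 1%:M z = \sum_j `|z 0 j| ^+ 2.
Proof.
rewrite -(_ : diag_mx (const_mx 1) = 1%:M) ?qf_diag; last first.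
  by apply/matrixP => i j; rewrite !mxE.
by apply: eq_bigr => j _; rewrite mxE mul1r.
Qed.

Lemma hermitian_diag A : A ^t* = A -> exists (U : 'M[C]_n) (l : 'rV[C]_n),
  [/\ U *m U ^t* = 1%:M, U *m A *m U ^t* = diag_mx l &
    forall i, l 0 i \is Num.real].
Proof.
move=> Ah; have Ahm : A \is hermsymmx.
  by apply/is_hermitianmxP; rewrite expr0 scale1r Ah.
have /hermitian_normalmx/orthomx_spectralP AE := Ahm.
have U_unitary := spectral_unitarymx A.
exists (spectralmx A), (spectral_diag A); split.
- exact/unitarymxP.
- rewrite [X in _ *m X *m _]AE !mulmxA mulmxV ?spectral_unit // mul1mx.
  by rewrite -mulmxA; move/unitarymxP: U_unitary => ->; rewrite mulmx1.
- move=> i; have /mxOverP := hermitian_spectral_diag_real Ahm; exact.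
Qed.

Lemma diag_pos B U (b : 'rV[C]_n) j : (forall z, z != 0 -> 0 < qf B z) ->
  U \in unitmx -> U *m B *m U ^t* = diag_mx b -> 0 < b 0 j.
Proof.
move=> Bpos Uunit UB; have := Bpos (delta_mx 0 j *m U).
rewrite qf_mul UB qf_diag (bigD1 j) //= big1 ?addr0.
  rewrite mxE !eqxx /= normr1 expr1n mulr1; apply.
  apply/eqP => /(congr1 (mulmx^~ (invmx U))); rewrite mulmxK // mul0mx.
  by move/matrixP/(_ 0 j); rewrite !mxE !eqxx => /eqP; rewrite oner_eq0.
by move=> k kj; rewrite mxE (negbTE kj) andbF normr0 expr0n mulr0.
Qed.

(** B is brought to the identity by a unitary diagonalization and a scaling by the inverse square
    roots of its eigenvalues; a unitary diagonalization of the transformed A keeps that identity. *)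
Lemma codiagonalize A B : A ^t* = A -> B ^t* = B ->
  (forall z, z != 0 -> 0 < qf B z) -> exists (G : 'M[C]_n) (l : 'rV[C]_n),
  [/\ G *m B *m G ^t* = 1%:M, G *m A *m G ^t* = diag_mx l &
    forall i, l 0 i \is Num.real].
Proof.
move=> Ah Bh Bpos; have [U [b [UU UB b_real]]] := hermitian_diag Bh.
have Uunit : U \in unitmx by apply/unitarymx_unit/unitarymxP.
have b_pos j : 0 < b 0 j := diag_pos j Bpos Uunit UB.
pose r : 'rV[C]_n := \row_j (sqrtC (b 0 j))^-1.
pose V := diag_mx r *m U.
have rC : (diag_mx r) ^t* = diag_mx r.
  rewrite tr_diag_mx map_diag_mx; congr diag_mx; apply/rowP => j; rewrite !mxE.
  by apply/CrealP; rewrite realV ger0_real // sqrtC_ge0 ltW.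
have VB : V *m B *m V ^t* = 1%:M.
  have -> : V *m B *m V ^t* = diag_mx r *m (U *m B *m U ^t*) *m diag_mx r.
    by rewrite /V trC_mul rC !mulmxA.
  rewrite UB !mulmx_diag; apply/matrixP => i j.
  rewrite !mxE; case: eqP => // _; rewrite !mulr1n.
  by rewrite mulrAC -expr2 exprVn sqrtCK mulVf // gt_eqF.
clearbody V.
have Hh : (V *m A *m V ^t*) ^t* = V *m A *m V ^t*.
  by rewrite !trC_mul trmxCK Ah mulmxA.
have [W [l [WW WA l_real]]] := hermitian_diag Hh.
exists (W *m V), l; split => //.
  have -> : W *m V *m B *m (W *m V) ^t* = W *m (V *m B *m V ^t*) *m W ^t*.
    by rewrite trC_mul !mulmxA.
  by rewrite VB mulmx1.
by rewrite trC_mul -WA !mulmxA.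
Qed.

Lemma char_poly_conj A G H : G *m H = 1%:M ->
  char_poly (H *m A *m G) = char_poly A.
Proof.
move=> GH; have HG := mulmx1C GH.
rewrite /char_poly; have -> : char_poly_mx (H *m A *m G) =
    map_mx polyC H *m char_poly_mx A *m map_mx polyC G.
  rewrite /char_poly_mx mulmxBr mulmxBl -!map_mxM; congr (_ - _).
  by rewrite scalar_mxC -mulmxA -map_mxM HG map_mx1 mulmx1.
by rewrite !det_mulmx mulrAC -det_mulmx -map_mxM HG map_mx1 det1 mul1r.
Qed.

(** The first equation says that the inverse of B is G^* G, so B^-1 A is conjugate to the diagonal
    matrix by G^*. *)
Lemma char_poly_codiag A B G (l : 'rV[C]_n) :
  G *m B *m G ^t* = 1%:M -> G *m A *m G ^t* = diag_mx l ->
  char_poly (invmx B *m A) = \prod_(i < n) ('X - (l 0 i)%:P).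
Proof.
move=> GB GA.
have GGB : G ^t* *m (G *m B) = 1%:M by apply: mulmx1C.
have Gu : G ^t* \in unitmx by case: (mulmx1_unit GGB).
have iB : invmx B = G ^t* *m G.
  have Bu : B \in unitmx.
    have [_] := mulmx1_unit GGB; rewrite unitmx_mul => /andP[_]; exact.
  by apply: (can_inj (mulmxK Bu)); rewrite mulVmx // -mulmxA.
have -> : invmx B *m A = G ^t* *m (diag_mx l) *m invmx (G ^t*).
  by rewrite -GA iB !mulmxA mulmxK.
rewrite char_poly_conj ?mulVmx //.
rewrite char_poly_trig ?diag_mx_is_trig //; apply: eq_bigr => i _.
by rewrite mxE eqxx mulr1n.
Qed.

(** Permuting the rows of G realizes any ordering of the roots, in particular the unspecified one of
    [eigen11]. *)
Lemma codiag_perm A B G (l l' : 'rV[C]_n) :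
  G *m B *m G ^t* = 1%:M -> G *m A *m G ^t* = diag_mx l ->
  \prod_(i < n) ('X - (l 0 i)%:P) = \prod_(i < n) ('X - (l' 0 i)%:P) ->
  exists2 G', G' *m B *m G' ^t* = 1%:M & G' *m A *m G' ^t* = diag_mx l'.
Proof.
move=> GB GA E.
have : perm_eq [tuple l' 0 i | i < n] [tuple l 0 i | i < n].
  apply: prod_XsubC_eq; rewrite !big_tuple.
  under eq_bigr do rewrite tnth_mktuple.
  by rewrite -E; apply: eq_bigr => i _; rewrite tnth_mktuple.
case/tuple_permP => s sE.
have sl i : l' 0 i = l 0 (s i).
  have := congr1 (fun t : seq C => nth 0 t i) sE.
  by rewrite -!tnth_nth !tnth_mktuple.
have pC : (perm_mx s : 'M[C]_n) ^t* = perm_mx s^-1.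
  by rewrite tr_perm_mx map_perm_mx.
exists (perm_mx s *m G).
  have -> : perm_mx s *m G *m B *m (perm_mx s *m G) ^t* =
      perm_mx s *m (G *m B *m G ^t*) *m (perm_mx s) ^t*.
    by rewrite trC_mul !mulmxA.
  by rewrite GB mulmx1 pC -perm_mxM mulgV perm_mx1.
have -> : perm_mx s *m G *m A *m (perm_mx s *m G) ^t* =
    perm_mx s *m (G *m A *m G ^t*) *m (perm_mx s) ^t*.
  by rewrite trC_mul !mulmxA.
rewrite GA pC -row_permE -col_permE; apply/matrixP => i j; rewrite !mxE sl.
by rewrite (inj_eq perm_inj).
Qed.
End Codiagonalization.

Local Close Scope classical_set_scope.

(** * Weyl's inequalities by a dimension count *)

Lemma sorting_perm (R : realType) (n : nat) (x : 'I_n -> R) :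
  exists p : 'S_n, forall i j : 'I_n, (i <= j)%N -> x (p j) <= x (p i).
Proof.
pose r := [rel i j : 'I_n | x j <= x i].
pose t := sort_tuple r (ord_tuple n).
have /tuple_permP[p pE] : perm_eq t (ord_tuple n) by rewrite perm_sort.
have pt i : p i = tnth t i.
  by rewrite -[t]/(t : n.-tuple _) (val_inj pE) tnth_mktuple tnth_ord_tuple.
exists p => i j ij; rewrite !pt !(tnth_nth i).
have rtr : transitive r by move=> a b c /= ba ac; exact: le_trans ac ba.
have rtot : total r by move=> a b /=; exact: le_total.
have rrefl : reflexive r by move=> a /=.
by apply: (sorted_leq_nth rtr rrefl _ (sort_sorted rtot _)) => //;
  rewrite inE size_sort size_tuple.
Qed.

(** Entries of equal rank in decreasing order are matched. If this failed at rank i, counted from 0,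
    at most i entries of y would reach the shifted threshold, whereas at least i + 1 entries of x
    reach the threshold itself. *)
Lemma count_perm (R : realType) (n : nat) (x y : 'I_n -> R) (e : R) :
  (forall i, #|[set j | (x i <= x j)%R]| <= #|[set j | (x i - e <= y j)%R]|)%N ->
  exists s : 'S_n, forall i, x i - e <= y (s i).
Proof.
move=> H; have [p pP] := sorting_perm x; have [q qP] := sorting_perm y.
exists (p^-1 * q)%g => i0; rewrite permM; set i := (p^-1)%g i0.
have -> : i0 = p i by rewrite /i permKV.
rewrite leNgt; apply/negP => lt; have := H (p i); apply/negP; rewrite -ltnNge.
have S1 : [set j | x (p i) - e <= y j] \subset q @: [set k : 'I_n | (k < i)%N].
  apply/fintype.subsetP => j; rewrite inE => jP; apply/imsetP.
  exists ((q^-1)%g j); last by rewrite permKV.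
  rewrite inE ltnNge; apply/negP => /qP; rewrite permKV => yj.
  by have := le_lt_trans (le_trans jP yj) lt; rewrite ltxx.
have S2 : p @: [set k : 'I_n | (k <= i)%N] \subset [set j | x (p i) <= x j].
  by apply/fintype.subsetP => j /imsetP[k]; rewrite !inE => /pP xk ->.
apply: (leq_ltn_trans (subset_leq_card S1)).
apply: (leq_trans _ (subset_leq_card S2)).
rewrite !card_imset; [|exact: perm_inj..].
apply: proper_card; rewrite properE; apply/andP; split.
  by apply/fintype.subsetP => k; rewrite !inE => /ltnW.
by apply/fintype.subsetPn; exists i; rewrite !inE ?leqnn ?ltnn.
Qed.

Section Weyl.
Local Open Scope sesquilinear_scope.
Context (R : realType) (m : nat).
Local Notation C := R[i].
Local Notation rc := (real_complex R).

(* If the conclusion failed, a dimension count would give a nonzero [z] whose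
   coordinates vanish where [l] is below [l 0 i], and such that those of
   [z *m P] vanish where [l'] is at least [l 0 i - e]. *)
Lemma weyl_comparison (A B A' B' G G' P : 'M[C]_m) (l l' : 'rV[R]_m) (e : R) :
  G *m B *m G ^t* = 1%:M -> G *m A *m G ^t* = diag_mx (map_mx rc l) ->
  G' *m B' *m G' ^t* = 1%:M -> G' *m A' *m G' ^t* = diag_mx (map_mx rc l') ->
  (forall z : 'rV[C]_m, z *m P = 0 -> z = 0) ->
  (forall i z, qf A z - rc (l 0 i) * qf B z <=
     qf A' (z *m P) - rc (l 0 i - e) * qf B' (z *m P)) ->
  exists s : 'S_m, forall i, l 0 i - e <= l' 0 (s i).
Proof.
move=> GB GA GB' GA' Pinj H; apply: (count_perm (x := fun i => l 0 i) (y := fun i => l' 0 i)) => i.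
rewrite leqNgt; apply/negP => lt.
set J := [set j | l 0 i <= l 0 j] in lt; set J' := [set j | _] in lt.
have unitG (M N : 'M[C]_m) : M *m N *m M ^t* = 1%:M -> M \in unitmx.
  by rewrite -mulmxA => /mulmx1_unit[].
have Gu := unitG _ _ GB; have Gu' := unitG _ _ GB'.
(* The condition z K = 0 says that w vanishes off J and w' on J'. As K has m - |J| + |J'| < m
   columns, it has a nonzero solution z. *)
pose K1 := \matrix_(a < m, b < #|~: J|) (invmx G) a (enum_val b).
pose K2 := \matrix_(a < m, b < #|J'|) (P *m invmx G') a (enum_val b).
pose K := row_mx K1 K2.
have rK : (\rank K < m)%N.
  apply: (leq_ltn_trans (rank_leq_col K)).
  have cJ : (#|J| + #|~: J| = m)%N by rewrite cardsC card_ord.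
  by rewrite -[X in (_ < X)%N]cJ addnC ltn_add2r.
have kK : kermx K != 0.
  by rewrite -mxrank_eq0 mxrank_ker -lt0n subn_gt0.
pose z := nz_row (kermx K).
have z0 : z != 0 by rewrite nz_row_eq0.
have zK : z *m K = 0 by apply/sub_kermxP; exact: nz_row_sub.
have [zK1 zK2] : z *m K1 = 0 /\ z *m K2 = 0.
  by move: zK; rewrite mul_mx_row -[0]row_mx0 => /eq_row_mx.
pose w := z *m invmx G; pose w' := z *m P *m invmx G'.
have wJ j : j \notin J -> w 0 j = 0.
  move=> jJ; have jC : j \in ~: J by rewrite inE.
  have /matrixP/(_ 0 (enum_rank_in jC j)) := zK1; rewrite !mxE => E.
  rewrite -[RHS]E; by apply: eq_bigr => a _; rewrite !mxE enum_rankK_in.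
have wJ' j : j \in J' -> w' 0 j = 0.
  move=> jJ; rewrite /w' -mulmxA.
  have /matrixP/(_ 0 (enum_rank_in jJ j)) := zK2; rewrite !mxE => E.
  rewrite -[RHS]E; by apply: eq_bigr => a _; rewrite !mxE enum_rankK_in.
have zw : z = w *m G by rewrite mulmxKV.
have zw' : z *m P = w' *m G' by rewrite mulmxKV.
have comb (M N : 'M[C]_m) (k : 'rV[R]_m) c v Q :
    Q *m N *m Q ^t* = 1%:M -> Q *m M *m Q ^t* = diag_mx (map_mx rc k) ->
    qf M (v *m Q) - rc c * qf N (v *m Q) =
    \sum_j rc (k 0 j - c) * `|v 0 j| ^+ 2.
  move=> QN QM; rewrite !qf_mul QN QM qf1 qf_diag mulr_sumr -sumrB.
  by apply: eq_bigr => j _; rewrite mxE rmorphB mulrBl.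
have := H i z; rewrite zw' zw (comb _ _ _ _ _ _ GB GA) (comb _ _ _ _ _ _ GB' GA').
move=> le1.
have ge0 : 0 <= \sum_j rc (l 0 j - l 0 i) * `|w 0 j| ^+ 2.
  apply: sumr_ge0 => j _; have [jJ|/wJ->] := boolP (j \in J).
    by rewrite mulr_ge0 ?exprn_ge0 // ler0c subr_ge0; rewrite inE in jJ.
  by rewrite normr0 expr0n mulr0.
have le0 j : 0 <= rc (l 0 i - e - l' 0 j) * `|w' 0 j| ^+ 2.
  have [/wJ'->|jJ] := boolP (j \in J').
    by rewrite normr0 expr0n mulr0.
  rewrite mulr_ge0 ?exprn_ge0 // ler0c subr_ge0.
  by move: jJ; rewrite inE -ltNge => /ltW.
(* The hypothesis bounds a nonnegative sum by a nonpositive one, so both vanish; off J' the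
   coefficients below are positive, which forces w' = 0. *)
have sum0 : \sum_j rc (l 0 i - e - l' 0 j) * `|w' 0 j| ^+ 2 = 0.
  apply/eqP; rewrite eq_le sumr_ge0 ?andbT //.
  rewrite -oppr_ge0 -sumrN; apply: (le_trans (le_trans ge0 le1)).
  by apply: ler_sum => j _; rewrite -mulNr -rmorphN (opprB (l 0 i - e)).
have w'0 : w' = 0.
  apply/rowP => j; rewrite [RHS]mxE; have [/wJ'->//|jJ] := boolP (j \in J').
  have /eqP := sum0; rewrite psumr_eq0 // => /allP/(_ j (mem_index_enum _)) /=.
  rewrite mulf_eq0 => /orP[/eqP E|]; last by rewrite expf_eq0 normr_eq0 /= => /eqP.
  move: jJ; rewrite inE -ltNge => jJ; have : rc (l 0 i - e - l' 0 j) != 0.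
    by rewrite fmorph_eq0 subr_eq0 gt_eqF.
  by rewrite E eqxx.
by move: z0; rewrite (Pinj z) ?eqxx // zw' w'0 mul0mx.
Qed.
End Weyl.

(** * The Hermitian matrix of a real (1,1)-form *)

Section Hermitian.
Local Open Scope sesquilinear_scope.
Context (R : realType) (m : nat).
Local Notation C := R[i].
Local Notation rc := (real_complex R).
Implicit Types (v w : Cn R m) (al om : Cn R m -> Cn R m -> R).

Definition form11 al :=
  [/\ forall (a : R) v1 v2 w, al (a *: v1 + v2) w = a * al v1 w + al v2 w,
      forall v w, al v w = - al w v &
      forall v w, al (Jc v) (Jc w) = al v w].

Definition pos11 om := forall v, v != 0 -> 0 < om v (Jc v).

Definition toC v : 'rV[C]_m := \row_j Complex (v.1 0 j) (v.2 0 j).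
Definition ofC (z : 'rV[C]_m) : Cn R m :=
  (\row_j complex.Re (z 0 j), \row_j complex.Im (z 0 j)).

Lemma ofCK z : toC (ofC z) = z.
Proof. by apply/rowP => j; rewrite !mxE; case: (z 0 j). Qed.

Lemma toC_eq0 v : toC v = 0 -> v = 0.
Proof.
move=> E; apply: crd_inj => -[b j]; have /rowP/(_ j) := E.
by rewrite !mxE /crd => -[-> ->]; case: b; rewrite mxE.
Qed.

Lemma complex_linear_expand (L : Cn R m -> C) :
  (forall a v w, L (a *: v + w) = rc a * L v + L w) ->
  (forall v, L (Jc v) = Complex 0 1 * L v) ->
  forall v, L v = \sum_j toC v 0 j * L (evec R j).
Proof.
move=> Ll LJ v; have L0 : L 0 = 0.
  have := Ll (-1) 0 0; rewrite scaler0 addr0 rmorphN rmorph1 mulN1r addNr.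
  by [].
have -> : L v = \sum_b rc (crd b v) * L (bas R b).
  rewrite [in LHS](bas_expand v); elim: (index_enum _) => [|k r IH].
    by rewrite !big_nil.
  by rewrite !big_cons Ll IH.
rewrite -(pair_bigA _ (fun x j => rc (crd (x, j) v) * L (bas R (x, j)))) /=.
rewrite big_bool /= -big_split /=; apply: eq_bigr => j _.
rewrite /crd /bas /= LJ mxE mulrA -mulrDl; congr (_ * _).
by rewrite /real_complex_def; apply/eqP; rewrite eq_complex /=; apply/andP; split;
  apply/eqP; ring.
Qed.

(** The Hermitian form with matrix [coef11 al], complex linear in v; on the diagonal it is al(v, Jv)
    / 2. *)
Definition herm al v w : C :=
  Complex (al v (Jc w) / 2%:R) (- al v w / 2%:R).

Lemma form11N al v w : form11 al -> al (- v) w = - al v w.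
Proof.
move=> [Hl _ _]; have H0 : al 0 w = 0.
  by have := Hl 1 0 0 w; rewrite scaler0 addr0 mul1r; lra.
by have := Hl (-1) v 0 w; rewrite scaleN1r addr0 H0; lra.
Qed.

Lemma form11_swap al v w : form11 al -> al v (Jc w) = al w (Jc v).
Proof.
move=> H; have [_ Ha HJ] := H.
by rewrite -HJ JcK Ha form11N // opprK.
Qed.

Lemma form11_Jl al v w : form11 al -> al (Jc v) w = - al v (Jc w).
Proof. by move=> H; have [_ _ HJ] := H; rewrite -HJ JcK form11N. Qed.

Lemma herm_conj al v w : form11 al -> (herm al v w)^* = herm al w v.
Proof.
move=> H; have [_ Ha _] := H.
rewrite /herm (form11_swap v w H) (Ha v w); apply/eqP.
rewrite eq_complex /= eqxx /=; apply/eqP; ring.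
Qed.

Lemma herm_expand al v w : form11 al ->
  herm al v w = \sum_j toC v 0 j * herm al (evec R j) w.
Proof.
move=> H; have [Hl _ HJ] := H.
apply: (@complex_linear_expand (fun v => herm al v w)) => [a v1 v2|v1].
  rewrite /herm !Hl /real_complex_def; apply/eqP; rewrite eq_complex /=.
  by apply/andP; split; apply/eqP; field.
rewrite /herm HJ form11_Jl //; apply/eqP; rewrite eq_complex /=.
by apply/andP; split; apply/eqP; field.
Qed.

Lemma coef11E al j k : coef11 al j k = herm al (evec R j) (evec R k).
Proof. by rewrite mxE. Qed.

Lemma coef11_herm al : form11 al -> (coef11 al) ^t* = coef11 al.
Proof. by move=> H; apply/matrixP => j k; rewrite !mxE; exact: herm_conj. Qed.

Lemma qf_coef11 al v : form11 al ->
  qf (coef11 al) (toC v) = rc (al v (Jc v) / 2%:R).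
Proof.
move=> H; have [_ Ha _] := H.
have -> : rc (al v (Jc v) / 2%:R) = herm al v v.
  have a0 : al v v = 0 by have := Ha v v; lra.
  by rewrite /herm a0 oppr0 mul0r.
rewrite (herm_expand v v H) /qf -mulmxA mxE; apply: eq_bigr => j _.
congr (_ * _); rewrite -herm_conj // (herm_expand v _ H) rmorph_sum mxE.
apply: eq_bigr => k _; rewrite rmorphM coef11E -(herm_conj _ _ H) mulrC.
by congr (_ * _); rewrite 2!mxE.
Qed.

Lemma coef11_pos om : form11 om -> pos11 om ->
  forall z : 'rV[C]_m, z != 0 -> 0 < qf (coef11 om) z.
Proof.
move=> H Hp z z0; rewrite -(ofCK z) qf_coef11 // ltcR divr_gt0 //.
apply: Hp; apply: contraNneq z0 => E; rewrite -(ofCK z) E; apply/eqP/rowP => j.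
by rewrite !mxE.
Qed.

Lemma diag_eigen11 om al : form11 om -> pos11 om -> form11 al ->
  exists G : 'M[C]_m, G *m coef11 om *m G ^t* = 1%:M /\
    G *m coef11 al *m G ^t* = diag_mx (map_mx rc (eigen11 om al)).
Proof.
move=> Ho Hp Ha.
have [G [l [GB GA l_real]]] :=
  codiagonalize (coef11_herm Ha) (coef11_herm Ho) (coef11_pos Ho Hp).
have cp := char_poly_codiag GB GA.
(* [eigen11] is a choice: it has the defining property only once some real list of roots is
   exhibited. *)
have ex : exists l0 : 'rV[R]_m, char_poly (invmx (coef11 om) *m coef11 al) =
    \prod_(i < m) ('X - (real_complex R (l0 0 i))%:P).
  exists (\row_j complex.Re (l 0 j)); rewrite cp; apply: eq_bigr => i _.
  by rewrite mxE RRe_real.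
have eP : char_poly (invmx (coef11 om) *m coef11 al) =
    \prod_(i < m) ('X - (real_complex R (eigen11 om al 0 i))%:P).
  exact: (@getPex _ (fun l : 'rV[R]_m =>
    char_poly (invmx (coef11 om) *m coef11 al) =
    \prod_(i < m) ('X - (real_complex R (l 0 i))%:P)) ex).
have [|G' GB' GA'] := @codiag_perm _ _ (coef11 al) (coef11 om) G l
    (map_mx rc (eigen11 om al)) GB GA.
  by rewrite -cp eP; apply: eq_bigr => i _; rewrite mxE.
by exists G'.
Qed.

(* Weyl's inequalities, with a different metric and a change of coordinates [d]
   on the right-hand side. *)
Lemma eigen11_comparison om al om' al' (d : Cn R m -> Cn R m) (e : R) :
  form11 om -> pos11 om -> form11 al -> form11 om' -> pos11 om' -> form11 al' ->
  linear d -> (forall v, d (Jc v) = Jc (d v)) -> (forall v, d v = 0 -> v = 0) ->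
  (forall i v, let l := eigen11 om al 0 i in
    al v (Jc v) - l * om v (Jc v) <=
    al' (d v) (Jc (d v)) - (l - e) * om' (d v) (Jc (d v))) ->
  exists s : 'S_m, forall i, eigen11 om al 0 i - e <= eigen11 om' al' 0 (s i).
Proof.
move=> Ho Hp Ha Ho' Hp' Ha' dl dJ d0 H.
have [G [GB GA]] := diag_eigen11 Ho Hp Ha.
have [G' [GB' GA']] := diag_eigen11 Ho' Hp' Ha'.
(* As d commutes with J it is complex linear, so its values on the vectors d/dx_j form a complex
   matrix acting on rows. *)
pose P : 'M[C]_m := \matrix_(j, k) toC (d (evec R j)) 0 k.
have dP v : toC v *m P = toC (d v).
  apply/rowP => k; rewrite mxE.
  rewrite (@complex_linear_expand (fun v => toC (d v) 0 k)).
  - by apply: eq_bigr => j _; rewrite [P _ _]mxE.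
  - move=> a v1 v2; rewrite dl !mxE /=; apply/eqP; rewrite eq_complex /=.
    by apply/andP; split; apply/eqP; ring.
  - move=> v1; rewrite dJ !mxE /=; apply/eqP; rewrite eq_complex /=.
    by apply/andP; split; apply/eqP; ring.
apply: (@weyl_comparison _ _ _ _ _ _ G G' P _ _ _ GB GA GB' GA').
  move=> z; rewrite -(ofCK z) dP => /toC_eq0/d0 ->.
  by apply/rowP => j; rewrite !mxE.
move=> i z; rewrite -(ofCK z) dP !qf_coef11 // -!rmorphM -!rmorphB /= lecR.
have := H i (ofC z); rewrite /=.
by move=> h; rewrite !mulrA -!mulrBl ler_pM2r // invr_gt0.
Qed.
End Hermitian.
Local Open Scope classical_set_scope.
Local Open Scope ring_scope.

(** * Symmetric cones *)

Section Cone.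
Context (R : realType) (n : nat) (Gam : set 'rV[R]_n) (f : 'rV[R]_n -> R).
Hypotheses (Gam_cone : symmetric_cone Gam) (f_sym : smooth_symmetric Gam f).
Hypothesis f_incr : increasing_on Gam f.

Lemma cone_shift (l : 'rV[R]_n) : Gam l ->
  \forall e \near (0 : R), Gam (l - e *: const_mx 1).
Proof.
move=> Gl; have [Go _] := Gam_cone.
have c : l - e *: const_mx 1 @[e --> (0 : R)] --> l - 0 *: const_mx 1.
  by apply: cvgB; [exact: cvg_cst|apply: cvgZr_tmp; exact: cvg_id].
by apply: c; rewrite scale0r subr0; exact: open_nbhs_nbhs.
Qed.

(** Write l + y as twice the midpoint of l - c 1 and y + c 1, for a small c > 0: the former is in
    [Gam] by openness, the latter lies in the positive orthant. *)
Lemma cone_add (l y : 'rV[R]_n) : Gam l -> (forall i, 0 <= y 0 i) -> Gam (l + y).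
Proof.
move=> Gl y0; have [_ [_ [conv [scal [pos _]]]]] := Gam_cone.
have /nbhs_ballP[d /= d0 dP] := cone_shift Gl.
have Gd : Gam (l - (d / 2) *: const_mx 1).
  apply: dP; rewrite -ball_normE /= sub0r normrN gtr0_norm ?divr_gt0 //.
  by rewrite ltr_pdivrMr // ltr_pMr // ltr1n.
have Gy : Gam (y + (d / 2) *: const_mx 1).
  by apply: pos => i /=; rewrite !mxE mulr1 ltr_wpDl // divr_gt0.
have h01 : 0 <= (2^-1 : R) <= 1 by apply/andP; split; lra.
have := scal 2 _ (ltr0n _ 2) (conv _ _ _ Gd Gy h01).
congr Gam; apply/rowP => i; rewrite !mxE; lra.
Qed.

(** The coordinates of y are added one at a time; each segment stays in [Gam] by [cone_add], and the
    mean value theorem applies along it. *)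
Lemma increasing_add (l y : 'rV[R]_n) : Gam l -> (forall i, 0 <= y 0 i) -> f l <= f (l + y).
Proof.
move=> Gl y0; have [Go _] := Gam_cone.
rewrite [in X in _ <= X](row_sum_delta y).
elim: (index_enum _) => [|i r IH]; first by rewrite big_nil addr0.
apply: (le_trans IH); rewrite big_cons addrCA addrC -subr_ge0.
set x := l + _.
have Gx s : 0 <= s -> Gam (x + s *: delta_mx 0 i).
  move=> s0; apply: cone_add; last first.
    by move=> j; rewrite !mxE mulr_ge0 // ler0n.
  apply: cone_add => // j; rewrite summxE sumr_ge0 // => k _.
  by rewrite !mxE mulr_ge0 // ler0n.
have [|c /andP[c0 _] ->] := @mvt_pos R _ f x (delta_mx 0 i) (y 0 i) (y0 i).
  move=> s /andP[s0 _]; have [/(_ 1%N)[_ /(_ [::] isT)[+ _]] _] := f_sym.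
  by apply => //; exact: (open_nbhs_nbhs (conj Go (Gx s s0))).
by rewrite mulr_ge0 // ltW //; apply: f_incr; exact: Gx.
Qed.

(** Comparisons up to a permutation are enough, so the order in which eigenvalues are listed becomes
    harmless. *)
Lemma dominate_perm (l l' : 'rV[R]_n) (s : 'S_n) : Gam l ->
  (forall i, l 0 i <= l' 0 (s i)) -> Gam l' /\ f l <= f l'.
Proof.
move=> Gl H; have [_ [sym _]] := Gam_cone; have [_ fs] := f_sym.
have y0 i : 0 <= (col_perm s l' - l) 0 i.
  by rewrite !mxE subr_ge0.
have := cone_add Gl y0; have := increasing_add Gl y0.
rewrite addrC subrK => fl Gp.
have Gl' : Gam l'.
  have := sym s^-1%g _ Gp; rewrite -col_permM mulVg col_perm1; exact.
by split => //; rewrite -(fs s l').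
Qed.
End Cone.

(** * The product manifold *)

Section ProductCoordinates.
Context (R : realType) (m n : nat).

Lemma cvg_crd (T : Type) (F : set_system T) {FF : Filter F} (k : nat)
    (f : T -> Cn R k) (l : Cn R k) :
  (forall b, crd b (f t) @[t --> F] --> crd b l) -> f @ F --> l.
Proof.
move=> H; rewrite (bas_expand l).
rewrite (_ : f = fun t => \sum_b crd b (f t) *: bas R b); last first.
  by apply/funext => t; rewrite -bas_expand.
elim: (index_enum _) => [|b r IH].
  by under eq_fun do rewrite big_nil; rewrite big_nil; exact: cvg_cst.
under eq_fun do rewrite big_cons; rewrite big_cons.
by apply: cvgD => //; apply: cvgZr_tmp.
Qed.

Lemma Cn_fst_lin : linear (@Cn_fst R m n).
Proof.
move=> a v w; rewrite /Cn_fst; apply/pair_equal_spec.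
by split; apply/rowP => j; rewrite !mxE.
Qed.

Lemma Cn_snd_lin : linear (@Cn_snd R m n).
Proof.
move=> a v w; rewrite /Cn_snd; apply/pair_equal_spec.
by split; apply/rowP => j; rewrite !mxE.
Qed.

Lemma Cn_fst_continuous : continuous (@Cn_fst R m n).
Proof.
move=> z; apply: cvg_crd => -[b j].
rewrite (_ : (fun t => _) = crd (b, lshift n j)).
  by rewrite (_ : crd (b, j) _ = crd (b, lshift n j) z);
    [exact: crd_continuous|case: b; rewrite /crd /= !mxE].
by apply/funext => t; case: b; rewrite /crd /= !mxE.
Qed.

Lemma Cn_snd_continuous : continuous (@Cn_snd R m n).
Proof.
move=> z; apply: cvg_crd => -[b j].
rewrite (_ : (fun t => _) = crd (b, rshift m j)).
  by rewrite (_ : crd (b, j) _ = crd (b, rshift m j) z);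
    [exact: crd_continuous|case: b; rewrite /crd /= !mxE].
by apply/funext => t; case: b; rewrite /crd /= !mxE.
Qed.

Lemma Cn_pairK1 (x : Cn R m) (y : Cn R n) : Cn_fst (Cn_pair x y) = x.
Proof. by case: x => ? ?; rewrite /Cn_fst /= !row_mxKl. Qed.

Lemma Cn_pairK2 (x : Cn R m) (y : Cn R n) : Cn_snd (Cn_pair x y) = y.
Proof. by case: y => ? ?; rewrite /Cn_snd /= !row_mxKr. Qed.

Lemma Cn_pair_eta (z : Cn R (m + n)) : Cn_pair (Cn_fst z) (Cn_snd z) = z.
Proof. by case: z => ? ?; rewrite /Cn_pair /= !hsubmxK. Qed.

Lemma Cn_snd_J (z : Cn R (m + n)) : Cn_snd (Jc z) = Jc (Cn_snd z).
Proof.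
by rewrite /Cn_snd /Jc /=; apply/pair_equal_spec; split => //; apply/rowP => j;
  rewrite !mxE.
Qed.

Lemma Cn_fst_J (z : Cn R (m + n)) : Cn_fst (Jc z) = Jc (Cn_fst z).
Proof.
by rewrite /Cn_fst /Jc /=; apply/pair_equal_spec; split => //; apply/rowP => j;
  rewrite !mxE.
Qed.

Lemma Cn_pair_J (x : Cn R m) (y : Cn R n) :
  Cn_pair (Jc x) (Jc y) = Jc (Cn_pair x y).
Proof. by rewrite -[RHS]Cn_pair_eta Cn_fst_J Cn_snd_J Cn_pairK1 Cn_pairK2. Qed.

Lemma crd_pair b (x : Cn R m) (y : Cn R n) : crd b (Cn_pair x y) =
  match fintype.split b.2 with inl j => crd (b.1, j) x | inr j => crd (b.1, j) y end.
Proof. by case: b => -[] j; rewrite /crd /= !mxE; case: fintype.split. Qed.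

Lemma cvg_Cn_pair (T : Type) (F : set_system T) {FF : Filter F}
    (f : T -> Cn R m) (g : T -> Cn R n) x y :
  f @ F --> x -> g @ F --> y -> Cn_pair (f t) (g t) @[t --> F] --> Cn_pair x y.
Proof.
move=> fx gy; apply: cvg_crd => b; rewrite crd_pair.
rewrite (_ : (fun t => _) = fun t => match fintype.split b.2 with
  inl j => crd (b.1, j) (f t) | inr j => crd (b.1, j) (g t) end); last first.
  by apply/funext => t; rewrite crd_pair.
case: (fintype.split b.2) => j.
  exact: (cvg_comp _ _ fx (@crd_continuous _ _ (b.1, j) x)).
exact: (cvg_comp _ _ gy (@crd_continuous _ _ (b.1, j) y)).
Qed.

Definition prodset (A : set (Cn R m)) (B : set (Cn R n)) : set (Cn R (m + n)) :=
  [set z | A (Cn_fst z) /\ B (Cn_snd z)].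

Lemma prodset_int A B z :
  (prodset A B)° z <-> A° (Cn_fst z) /\ B° (Cn_snd z).
Proof.
split=> [H|[H1 H2]].
  split.
    have c : Cn_pair x (Cn_snd z) @[x --> Cn_fst z] --> z.
      rewrite -[X in _ --> X]Cn_pair_eta; apply: cvg_Cn_pair; first exact: cvg_id.
      exact: cvg_cst.
    have cH : nbhs (Cn_fst z) [set x | prodset A B (Cn_pair x (Cn_snd z))].
      exact: (c _ H).
    by apply: filterS cH => x /= -[]; rewrite Cn_pairK1.
  have c : Cn_pair (Cn_fst z) x @[x --> Cn_snd z] --> z.
    rewrite -[X in _ --> X]Cn_pair_eta; apply: cvg_Cn_pair; last exact: cvg_id.
    exact: cvg_cst.
  have cH : nbhs (Cn_snd z) [set x | prodset A B (Cn_pair (Cn_fst z) x)].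
    exact: (c _ H).
  by apply: filterS cH => x /= -[] _; rewrite Cn_pairK2.
have c1 : nbhs z [set y | A (Cn_fst y)] by exact: (Cn_fst_continuous H1).
have c2 : nbhs z [set y | B (Cn_snd y)] by exact: (Cn_snd_continuous H2).
by apply: filterS2 c1 c2 => y.
Qed.

Lemma prodset_regular A B : regular A -> regular B -> regular (prodset A B).
Proof.
move=> rA rB z [Az Bz] N Nz.
have c : Cn_pair p.1 p.2 @[p --> (Cn_fst z, Cn_snd z)] --> z.
  rewrite -[X in _ --> X]Cn_pair_eta; apply: cvg_Cn_pair; [exact: cvg_fst|exact: cvg_snd].
have [[P Q] /= [Pz Qz] PQ] := c _ Nz.
have [x [Ax Px]] := rA _ Az _ Pz; have [y [By Qy]] := rB _ Bz _ Qz.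
exists (Cn_pair x y); split; last exact: (PQ (x, y)).
by apply/prodset_int; rewrite Cn_pairK1 Cn_pairK2.
Qed.
End ProductCoordinates.

Section ProductAtlas.
Context (R : realType) (X S : topologicalType) (m n : nat).
Context (AX : charts R X m) (AS : charts R S n).
Hypotheses (X_atlas : complex_atlas AX) (S_atlas : complex_atlas AS).
Local Notation AP := (prod_charts AX AS).

Lemma img_prod (k : idx AP) : img k = prodset (img k.1) (img k.2).
Proof.
apply/seteqP; split=> [z [[p q] [/= kp kq] <-]|z [[p kp pE] [q kq qE]]].
  by split; rewrite ?Cn_pairK1 ?Cn_pairK2; exact: img_coord.
by exists (p, q) => //=; rewrite pE qE Cn_pair_eta.
Qed.

Lemma overlap_prod (k l : idx AP) :
  overlap k l = prodset (overlap k.1 l.1) (overlap k.2 l.2).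
Proof.
apply/seteqP; split=> [z [[p q] [[/= kp kq] [/= lp lq]] <-]|z].
  by split; rewrite ?Cn_pairK1 ?Cn_pairK2; exact: overlap_coord.
move=> [[p [kp lp] pE] [q [kq lq] qE]].
by exists (p, q) => //=; rewrite pE qE Cn_pair_eta.
Qed.

Lemma img_prod_int (k : idx AP) z :
  (img k)° z <-> (img k.1)° (Cn_fst z) /\ (img k.2)° (Cn_snd z).
Proof. by rewrite img_prod; exact: prodset_int. Qed.

Lemma overlap_prod_int (k l : idx AP) z :
  (overlap k l)° z <->
  (overlap k.1 l.1)° (Cn_fst z) /\ (overlap k.2 l.2)° (Cn_snd z).
Proof. by rewrite overlap_prod; exact: prodset_int. Qed.

Definition inj1 (x : Cn R m) : Cn R (m + n) := Cn_pair x 0.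
Definition inj2 (y : Cn R n) : Cn R (m + n) := Cn_pair 0 y.

Lemma inj1_lin : linear inj1.
Proof.
move=> a v w; rewrite -[RHS]Cn_pair_eta (@Cn_fst_lin R m n) (@Cn_snd_lin R m n).
by rewrite !Cn_pairK1 !Cn_pairK2 scaler0 addr0.
Qed.

Lemma inj2_lin : linear inj2.
Proof.
move=> a v w; rewrite -[RHS]Cn_pair_eta (@Cn_fst_lin R m n) (@Cn_snd_lin R m n).
by rewrite !Cn_pairK1 !Cn_pairK2 scaler0 addr0.
Qed.

Lemma inj1_continuous : continuous inj1.
Proof. by move=> x; apply: cvg_Cn_pair; [exact: cvg_id|exact: cvg_cst]. Qed.

Lemma inj2_continuous : continuous inj2.
Proof. by move=> x; apply: cvg_Cn_pair; [exact: cvg_cst|exact: cvg_id]. Qed.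

Lemma Cn_pair_sum (x : Cn R m) (y : Cn R n) :
  Cn_pair x y = inj1 x + 1 *: inj2 y.
Proof.
rewrite -[RHS]Cn_pair_eta scale1r.
rewrite (linD (@Cn_fst_lin R m n)) (linD (@Cn_snd_lin R m n)).
by rewrite !Cn_pairK1 !Cn_pairK2 addr0 add0r.
Qed.

(** The transition map is the sum of two factors' maps composed with linear projections and
    injections, so the lemmas on linear composition and on sums apply. *)
Lemma trans_prod_Ck (k l : idx AP) r : Ck r (overlap k l) (trans k l) /\
  forall vs, (size vs <= r)%N -> forall z, (overlap k l)° z ->
    iterD vs (trans k l) z =
    Cn_pair (iterD (map (@Cn_fst R m n) vs) (trans k.1 l.1) (Cn_fst z))
            (iterD (map (@Cn_snd R m n) vs) (trans k.2 l.2) (Cn_snd z)).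
Proof.
have C1 : Ck r (overlap k l) (trans k.1 l.1 \o @Cn_fst R m n).
  apply: (@Ck_lin_pre R _ _ _ _ _ _ (overlap k.1 l.1)).
  - exact: Cn_fst_lin.
  - exact: Cn_fst_continuous.
  - by move=> z; rewrite overlap_prod => -[].
  - by move=> z /overlap_prod_int[].
  - exact: atlas_trans.
have C2 : Ck r (overlap k l) (trans k.2 l.2 \o @Cn_snd R m n).
  apply: (@Ck_lin_pre R _ _ _ _ _ _ (overlap k.2 l.2)).
  - exact: Cn_snd_lin.
  - exact: Cn_snd_continuous.
  - by move=> z; rewrite overlap_prod => -[].
  - by move=> z /overlap_prod_int[].
  - exact: atlas_trans.
have [D1 E1] := Ck_lin_post inj1_lin inj1_continuous C1.
have [D2 E2] := Ck_lin_post inj2_lin inj2_continuous C2.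
have [D E] := Ck_add_scale 1 D1 D2.
have TE : trans k l = fun z => (inj1 \o (trans k.1 l.1 \o @Cn_fst R m n)) z +
    1 *: (inj2 \o (trans k.2 l.2 \o @Cn_snd R m n)) z.
  by apply/funext => z; rewrite /= -Cn_pair_sum.
rewrite TE; split => // vs sr z oz.
rewrite (E vs sr z oz) (E1 vs sr z oz) (E2 vs sr z oz) -Cn_pair_sum.
by rewrite !iterD_lin_pre //; [exact: Cn_snd_lin|exact: Cn_fst_lin].
Qed.

Lemma prod_atlas : complex_atlas AP.
Proof.
split=> [[p q]|].
  have [i ip] := atlas_cover X_atlas p; have [j jq] := atlas_cover S_atlas q.
  by exists (i, j).
split=> [k|].
  rewrite openE => -[p q] [/= kp kq].
  exists (dom k.1, dom k.2) => //=; split.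
    exact: (open_nbhs_nbhs (conj (@atlas_open _ _ _ _ X_atlas _) kp)).
  exact: (open_nbhs_nbhs (conj (@atlas_open _ _ _ _ S_atlas _) kq)).
split=> [k|].
  apply/withinP => -[p q] [/= kp kq]; apply: cvg_within_filter.
  apply: cvg_Cn_pair.
    apply: (@cvg_comp _ _ _ fst (coord k.1)); first exact: cvg_fst.
    exact: (coord_continuous_at X_atlas kp).
  apply: (@cvg_comp _ _ _ snd (coord k.2)); first exact: cvg_snd.
  exact: (coord_continuous_at S_atlas kq).
split=> [k|].
  have c1 : {within img k, continuous (param k.1 \o @Cn_fst R m n)}.
    apply: (@within_comp _ _ _ _ (img k.1)); last exact: atlas_param.
      by move=> z; rewrite img_prod => -[].
    by apply: continuous_subspaceT; exact: Cn_fst_continuous.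
  have c2 : {within img k, continuous (param k.2 \o @Cn_snd R m n)}.
    apply: (@within_comp _ _ _ _ (img k.2)); last exact: atlas_param.
      by move=> z; rewrite img_prod => -[].
    by apply: continuous_subspaceT; exact: Cn_snd_continuous.
  apply/withinP => z kz; move/withinP: c1 => /(_ z kz) c1.
  move/withinP: c2 => /(_ z kz) c2.
  exact: (cvg_pair c1 c2).
split=> [k [p q] [/= kp kq]|].
  by rewrite Cn_pairK1 Cn_pairK2 (atlas_paramK X_atlas kp) (atlas_paramK S_atlas kq).
split=> [k|].
  rewrite img_prod; apply: prodset_regular; exact: atlas_regular.
split=> [k l r|]; first by have [] := trans_prod_Ck k l r.
split=> [k l z oz v|k l [p q] [/= kp kq] [/= lp lq]].
  have [_ E] := trans_prod_Ck k l 1.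
  have [z1 z2] := (overlap_prod_int k l z).1 oz.
  have E1 := E [:: Jc v] isT z oz; have E2 := E [:: v] isT z oz.
  apply: (eq_trans E1); rewrite /= Cn_fst_J Cn_snd_J.
  rewrite (atlas_holo X_atlas (Cn_fst v) z1) (atlas_holo S_atlas (Cn_snd v) z2).
  by rewrite Cn_pair_J; exact: (congr1 (@Jc R (m + n)) (esym E2)).
move=> /img_prod_int; rewrite Cn_pairK1 Cn_pairK2 => -[H1 H2].
apply/img_prod_int; rewrite Cn_pairK1 Cn_pairK2; split.
  exact: (atlas_interior X_atlas kp lp).
exact: (atlas_interior S_atlas kq lq).
Qed.

Lemma Cn_snd_img (k : idx AP) z : img k z -> img k.2 (Cn_snd z).
Proof. by rewrite img_prod => -[]. Qed.

Lemma Cn_snd_img_int (k : idx AP) z : (img k)° z -> (img k.2)° (Cn_snd z).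
Proof. by move=> /img_prod_int[]. Qed.

Lemma mfd_Ck_pr2 (h : S -> R) r : mfd_Ck AS r h ->
  mfd_Ck AP r (fun p => h p.2).
Proof.
move=> hC k.
exact: (@Ck_lin_pre R _ _ _ _ (h \o param k.2) (img k) (img k.2) r
  (@Cn_snd_lin R m n) (@Cn_snd_continuous R m n) (@Cn_snd_img k)
  (@Cn_snd_img_int k) (hC k.2)).
Qed.

Lemma derive_bd_pr2 (h : S -> R) r (k : idx AP) vs z : mfd_Ck AS r h ->
  (size vs <= r)%N -> img k z ->
  derive_bd (img k) vs ((fun p => h p.2) \o param k) z =
  derive_bd (img k.2) (map (@Cn_snd R m n) vs) (h \o param k.2) (Cn_snd z).
Proof.
move=> hC sr kz.
exact: (@derive_bd_lin_pre R _ _ _ _ (h \o param k.2) (img k) (img k.2) r vs z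
  (@Cn_snd_lin R m n) (@Cn_snd_continuous R m n) (@Cn_snd_img k)
  (@Cn_snd_img_int k) (atlas_regular prod_atlas (i := k))
  (atlas_regular S_atlas (i := k.2)) (hC k.2) sr kz).
Qed.
End ProductAtlas.

(** * Lower semicontinuity of the eigenvalues *)

Lemma finite_lower_bound (R : realType) (I : finType) (x : I -> R) :
  (forall i, 0 < x i) -> exists2 c : R, 0 < c & forall i, c <= x i.
Proof.
(* The inverse of s is below every x_i; the summand 1 keeps s positive when I is empty. *)
move=> x0; pose s := 1 + \sum_i (x i)^-1.
have s0 : 0 < s by rewrite ltr_wpDr // sumr_ge0 // => i _; rewrite invr_ge0 ltW.
exists s^-1; first by rewrite invr_gt0.
move=> i; rewrite -[leRHS]invrK lef_pV2 ?posrE ?invr_gt0 //.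
rewrite /s (bigD1 i) //= addrCA lerDl addr_ge0 // sumr_ge0 // => j _.
by rewrite invr_ge0 ltW.
Qed.

Lemma near_finite (T : Type) (F : set_system T) {FF : Filter F} (I : finType)
    (P : I -> T -> Prop) :
  (forall i, \forall t \near F, P i t) -> \forall t \near F, forall i, P i t.
Proof.
move=> H; have : \forall t \near F, forall i, i \in enum I -> P i t.
  elim: (enum I) => [|i r IH]; first exact: nearW.
  apply: filterS2 (H i) IH => t Pi Pr j; rewrite inE => /orP[/eqP->//|].
  exact: Pr.
by apply: filterS => t Pt i; apply: Pt; rewrite mem_enum.
Qed.

Section Norm.
Context (R : realType) (m : nat).
Implicit Types (v w : Cn R m) (B : Cn R m -> Cn R m -> R).

(** The squared Euclidean norm, preferred to the norm of the type because unitary matrices preserve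
    it. *)
Definition nrm2 v : R := \sum_b crd b v ^+ 2.
(** The real dimension 2m. *)
Definition ncrd : R := #|{: bool * 'I_m}|%:R.

Lemma nrm2E v : nrm2 v = \sum_j (v.1 0 j ^+ 2 + v.2 0 j ^+ 2).
Proof.
rewrite /nrm2 -(pair_bigA _ (fun x j => crd (x, j) v ^+ 2)) /= big_bool /=.
by rewrite -big_split /=; apply: eq_bigr => j _; rewrite /crd /= addrC.
Qed.

Lemma nrm2_ge0 v : 0 <= nrm2 v.
Proof. by apply: sumr_ge0 => b _; exact: sqr_ge0. Qed.

Lemma nrm2_J v : nrm2 (Jc v) = nrm2 v.
Proof.
rewrite !nrm2E; apply: eq_bigr => j _.
by rewrite /Jc /= mxE sqrrN addrC.
Qed.

(** Each product of coordinates is at most half the sum of their squares, and each square occurs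
    [ncrd] times in the double sum. *)
Lemma bilinear_bound B (d : R) v w : 0 <= d ->
  (forall v w, B v w =
     \sum_k crd k v * \sum_l crd l w * B (bas R k) (bas R l)) ->
  (forall k l, `|B (bas R k) (bas R l)| <= d) ->
  `|B v w| <= d * ncrd * ((nrm2 v + nrm2 w) / 2).
Proof.
move=> d0 BE Bd; rewrite BE.
apply: (@le_trans _ _ (\sum_k \sum_l d * ((crd k v ^+ 2 + crd l w ^+ 2) / 2))).
  apply: (le_trans (ler_norm_sum _ _ _)); apply: ler_sum => k _.
  rewrite normrM; apply: (@le_trans _ _
    (`|crd k v| * \sum_l `|crd l w| * d)).
    apply: ler_wpM2l => //; apply: (le_trans (ler_norm_sum _ _ _)).
    by apply: ler_sum => l _; rewrite normrM; apply: ler_wpM2l.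
  rewrite mulr_sumr; apply: ler_sum => l _.
  rewrite mulrA [leLHS]mulrC; apply: ler_wpM2l => //.
  rewrite -(real_normK (num_real (crd k v))) -(real_normK (num_real (crd l w))).
  move: `|crd k v| `|crd l w| => x y.
  rewrite ler_pdivlMr // -subr_ge0.
  rewrite (_ : _ - _ = (x - y) ^+ 2) ?sqr_ge0 //; by ring.
have E (x : R) : \sum_(k : bool * 'I_m) x = ncrd * x.
  by rewrite sumr_const /ncrd mulr_natl.
under eq_bigr => k _.
  rewrite -mulr_sumr -mulr_suml big_split /= E -/(nrm2 w). over.
rewrite -mulr_sumr -mulr_suml big_split /= E -mulr_sumr -/(nrm2 v).
by rewrite le_eqVlt; apply/orP; left; apply/eqP; ring.
Qed.
End Norm.

Section NearPositivity.
Local Open Scope sesquilinear_scope.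
Context (R : realType) (m : nat).
Implicit Types (v w : Cn R m) (om al : Cn R m -> Cn R m -> R).

(** The constant is twice a positive lower bound for the eigenvalues of [coef11 om]; the factor 2
    undoes the halving in [qf_coef11]. *)
Lemma pos11_bound om : form11 om -> pos11 om ->
  exists2 c : R, 0 < c & forall v, c * nrm2 v <= om v (Jc v).
Proof.
move=> Ho Hp; have [U [l [UU UB l_real]]] := hermitian_diag (coef11_herm Ho).
have Uu : U \in unitmx by apply/unitarymx_unit/unitarymxP.
have l0 j : 0 < l 0 j := diag_pos j (coef11_pos Ho Hp) Uu UB.
have [|c c0 cP] := @finite_lower_bound R _ (fun j => complex.Re (l 0 j)).
  by move=> j; have := l0 j; rewrite ltcE => /andP[].
exists (2 * c); first by rewrite mulr_gt0.
move=> v; set z := toC v; pose w := z *m U ^t*.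
have zw : z = w *m U by rewrite /w -mulmxA (mulmx1C UU) mulmx1.
have n1 : qf 1%:M w = real_complex R (nrm2 v).
  have <- : qf 1%:M z = qf 1%:M w by rewrite zw qf_mul mulmx1 UU.
  rewrite qf1 nrm2E rmorph_sum; apply: eq_bigr => j _.
  by rewrite -add_Re2_Im2 mxE.
have := qf_coef11 v Ho; rewrite -/z [in X in X = _ -> _]zw qf_mul UB qf_diag => E.
have : real_complex R (c * nrm2 v) <= real_complex R (om v (Jc v) / 2%:R).
  have -> : real_complex R (c * nrm2 v) = real_complex R c * qf 1%:M w.
    by rewrite n1 -rmorphM.
  rewrite -E qf1 mulr_sumr; apply: ler_sum => j _.
  apply: ler_wpM2r; first exact: exprn_ge0.
  by rewrite -(RRe_real (l_real j)) lecR.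
by rewrite lecR -mulrA; move: (c * _) => x; lra.
Qed.

Lemma form11_sub al om : form11 al -> form11 om ->
  form11 (fun v w => al v w - om v w).
Proof.
move=> [al1 al2 al3] [om1 om2 om3]; split=> *.
- by rewrite al1 om1; ring.
- by rewrite al2 om2; ring.
- by rewrite al3 om3.
Qed.

Lemma form11_scale (c : R) om : form11 om -> form11 (fun v w => c * om v w).
Proof.
move=> [om1 om2 om3]; split=> *.
- by rewrite om1; ring.
- by rewrite om2; ring.
- by rewrite om3.
Qed.

(** Convergence on pairs of basis vectors makes the difference of the forms at most c |v|^2,
    uniformly in v, while the limit form is at least c |v|^2. *)
Lemma form11_near_pos (T : Type) (F : set_system T) {FF : Filter F}
    (q : T -> Cn R m -> Cn R m -> R) (q0 : Cn R m -> Cn R m -> R) :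
  form11 q0 -> pos11 q0 -> (\forall t \near F, form11 (q t)) ->
  (forall v w, q t v w @[t --> F] --> q0 v w) ->
  \forall t \near F, forall v, 0 <= q t v (Jc v).
Proof.
move=> H0 Hp Hq qc; have [c c0 cP] := pos11_bound H0 Hp.
pose N := ncrd R m; have N0 : 0 <= N by rewrite /N /ncrd.
have N1 : 0 < N + 1 by rewrite ltr_wpDl.
(* This ensures d N <= c; the denominator N + 1 is positive even if m = 0. *)
pose d := c / (N + 1); have d0 : 0 < d by rewrite divr_gt0.
have Hd : \forall t \near F, forall kl : (bool * 'I_m) * (bool * 'I_m),
    `|q t (bas R kl.1) (bas R kl.2) - q0 (bas R kl.1) (bas R kl.2)| <= d.
  apply: near_finite => kl.
  have /cvgrPdist_le/(_ d d0) := qc (bas R kl.1) (bas R kl.2).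
  by apply: filterS => t; rewrite distrC.
apply: filterS2 Hq Hd => t qt dt v.
have Hs := form11_sub qt H0; have [s1 s2 _] := Hs.
have := @bilinear_bound R m _ d v (Jc v) (ltW d0) (bilin_expand s1 s2)
  (fun k l => dt (k, l)).
rewrite nrm2_J -/N => /ler_normlP[+ _]; have := cP v; have := nrm2_ge0 v.
move: (nrm2 v) (q t v _) (q0 v _) => n a b n0 cn.
have -> : (n + n) / 2 = n by field.
have dN : d * N <= c.
  rewrite /d mulrAC ler_pdivrMr // ler_wpM2l ?ltW //; lra.
have := ler_wpM2r n0 dN; lra.
Qed.
End NearPositivity.

Section FormsOnManifold.
Context (R : realType) (T : topologicalType) (m : nat) (A : charts R T m).
Hypothesis atlas : complex_atlas A.

Lemma near_dom (i : idx A) p : dom i p -> \forall q \near p, dom i q.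
Proof. by move=> ip; exact: (open_nbhs_nbhs (conj (@atlas_open _ _ _ _ atlas i) ip)). Qed.

Lemma chart_cvg (i : idx A) p (G : Cn R m -> R) : dom i p ->
  {within img i, continuous G} -> G (coord i q) @[q --> p] --> G (coord i p).
Proof.
move=> ip /withinP/(_ _ (img_coord ip)) Gc P /Gc.
rewrite /= !nbhs_simpl /within /= => H.
have := coord_continuous_at atlas ip H; rewrite /= !nbhs_simpl /=.
apply: filterS2 (near_dom ip) => q iq; apply; exact: img_coord.
Qed.

Lemma smooth_form_cvg (al : form2 A) (i : idx A) p v w : smooth_form al ->
  dom i p -> al i q v w @[q --> p] --> al i p v w.
Proof.
move=> als ip; have [c _] := als i 0%N v w.
have := chart_cvg ip c; rewrite (atlas_paramK atlas ip); apply: cvg_trans.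
apply: near_eq_cvg; apply: filterS (near_dom ip) => q iq.
by rewrite (atlas_paramK atlas iq).
Qed.

Lemma iddbar_cvg (u : T -> R) (i : idx A) p v w : mfd_Ck A 2 u ->
  dom i p -> iddbar u i q v w @[q --> p] --> (iddbar u : form2 A) i p v w.
Proof.
move=> uC2 ip.
have c : {within img i, continuous (fun z => levi (img i) (u \o param i) z v w)}.
  by apply: levi_continuous; [exact: atlas_regular|exact: uC2].
exact: (chart_cvg ip c).
Qed.

Lemma derive_bd_cvg (u : T -> R) (i : idx A) p v : mfd_Ck A 2 u -> dom i p ->
  derive_bd (img i) [:: v] (u \o param i) (coord i q) @[q --> p] -->
  derive_bd (img i) [:: v] (u \o param i) (coord i p).
Proof.
move=> uC2 ip; apply: (chart_cvg ip).
by have [] := @Ck_derive_bd R _ _ _ 2 [:: v] _ (@atlas_regular _ _ _ _ atlas i) (uC2 i) isT.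
Qed.

Lemma real11_form11 (al : form2 A) (i : idx A) p : real11form al -> dom i p ->
  form11 (al i p).
Proof.
move=> [a1 [a2 [a3 _]]] ip.
by split; [exact: a1|exact: a2|exact: a3].
Qed.

Lemma real11_chart (al : form2 A) (i j : idx A) p v w : real11form al ->
  dom i p -> dom j p ->
  al i p v w = al j p (dtr i j (coord i p) v) (dtr i j (coord i p) w).
Proof. by move=> [_ [_ [_ a4]]] ip jp; exact: a4. Qed.

Lemma metric_pos (om : form2 A) (i : idx A) p : hermitian_metric om ->
  dom i p -> pos11 (om i p).
Proof. by move=> [_ [_ omP]] ip v; exact: omP. Qed.

(** The differential preserves the metric, so a vector that it kills has length zero. *)
Lemma dtr_inj (om : form2 A) (i j : idx A) p v : hermitian_metric om ->
  dom i p -> dom j p -> dtr i j (coord i p) v = 0 -> v = 0.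
Proof.
move=> omM ip jp d0; apply/eqP; apply: contraT => v0.
have := metric_pos omM ip v0; have [om11 _] := omM.
rewrite (real11_chart _ _ om11 ip jp) d0.
have [oml _ _] := real11_form11 om11 jp.
have := oml 1 0 0 (dtr i j (coord i p) (Jc v)).
rewrite scaler0 addr0 mul1r => E; move: E.
by move: (om j p _ _) => x E; rewrite (_ : x = 0) ?ltxx //; lra.
Qed.

Lemma real11_add (al be : form2 A) : real11form al -> real11form be ->
  real11form (form_add al be).
Proof.
move=> [a1 [a2 [a3 a4]]] [b1 [b2 [b3 b4]]]; rewrite /form_add.
split=> [i p ip a v1 v2 w|]; first by rewrite a1 // b1 //; ring.
split=> [i p ip v w|]; first by rewrite a2 // b2 //; ring.
split=> [i p ip v w|i j p ip jp v w]; first by rewrite a3 // b3.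
by rewrite /= (a4 i j p ip jp v w) (b4 i j p ip jp v w).
Qed.

(* The neighbourhood must not depend on the chart [k]: there may be infinitely
   many charts around a point. *)
Lemma lambda_lsc (om al : form2 A) (k0 : idx A) p0 (e : R) :
  hermitian_metric om -> real11form al ->
  (forall v w, al k0 p v w @[p --> p0] --> al k0 p0 v w) ->
  dom k0 p0 -> 0 < e ->
  \forall p \near p0, forall k : idx A, dom k p -> exists s : 'S_m, forall i,
    lambda om al k0 p0 0 i - e <= lambda om al k p 0 (s i).
Proof.
move=> omM al11 alc kp0 e0; have [om11 [oms _]] := omM.
pose l := lambda om al k0 p0.
(* Nonnegativity of q on (v, Jv) is the hypothesis of [eigen11_comparison]; at p = p0 the form q is
   e times the metric, hence positive. *)
pose q i p v w := (al k0 p v w - (l 0 i - e) * om k0 p v w) -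
  (al k0 p0 v w - l 0 i * om k0 p0 v w).
have omc v w : om k0 p v w @[p --> p0] --> om k0 p0 v w.
  exact: smooth_form_cvg.
have key : \forall p \near p0, forall i v, 0 <= q i p v (Jc v).
  apply: near_finite => i.
  apply: (@form11_near_pos R m T (nbhs p0) _ (q i)
    (fun v w => e * om k0 p0 v w)).
  - exact: form11_scale (real11_form11 om11 kp0).
  - by move=> v v0; rewrite mulr_gt0 //; exact: (metric_pos omM kp0).
  - apply: filterS (near_dom kp0) => p kp; apply: form11_sub.
      apply: form11_sub; first exact: real11_form11.
      exact: form11_scale (real11_form11 om11 kp).
    apply: form11_sub; first exact: real11_form11.
    exact: form11_scale (real11_form11 om11 kp0).
  - move=> v w.
    rewrite (_ : e * _ = (al k0 p0 v w - (l 0 i - e) * om k0 p0 v w) -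
      (al k0 p0 v w - l 0 i * om k0 p0 v w)); last by ring.
    apply: cvgB; last exact: cvg_cst.
    by apply: cvgB; [exact: alc|apply: cvgM; [exact: cvg_cst|exact: omc]].
apply: filterS2 (near_dom kp0) key => p k0p qp k kp.
have okp := overlap_coord k0p kp.
apply: (@eigen11_comparison R m _ _ _ _ (dtr k0 k (coord k0 p))).
- exact: real11_form11.
- exact: metric_pos.
- exact: real11_form11.
- exact: real11_form11.
- exact: metric_pos.
- exact: real11_form11.
- by move=> a v w; exact: dtr_linear.
- by move=> v; exact: dtr_J.
- by move=> v; exact: (dtr_inj omM).
move=> i v /=; have := qp i v; rewrite /q subr_ge0.
rewrite (real11_chart v (Jc v) al11 k0p kp) (real11_chart v (Jc v) om11 k0p kp).
by rewrite (dtr_J atlas v okp).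
Qed.
End FormsOnManifold.

(** * Behaviour of the potential at the boundary *)

Section Rays.
Context (R : realType) (V : normedModType R) (A : set V) (z v : V) (d : R).
Hypotheses (Az : A z) (ray : forall s, 0 < s < d -> A° (z + s *: v)).

(** Only the open segment need lie in the interior of A, g being continuous up to z. *)
Lemma ray_mvt (g : V -> R) s : {within A, continuous g} ->
  (forall x, A° x -> derivable g x v) -> 0 < s < d ->
  exists2 c, 0 < c < s & g (z + s *: v) - g z = 'D_v g (z + c *: v) * s.
Proof.
move=> gc gd /andP[s0 sd]; pose k r := g (z + r *: v).
have [r|r|c] := @MVT R k (fun r => 'D_v g (z + r *: v)) 0 s s0.
- rewrite in_itv /= => /andP[r0 rs]; apply: is_derive_line; apply: gd.
  by apply: ray; rewrite r0 (lt_trans rs).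
- have lc : {within [set` `[0, s]], continuous (fun r : R => z + r *: v)}.
    apply: continuous_subspaceT => x; apply: cvgD; first exact: cvg_cst.
    by apply: cvgZr_tmp; exact: cvg_id.
  have lA x : [set` `[0, s]] x -> A (z + x *: v).
    rewrite /= in_itv /= => /andP[x0 xs].
    have [->|xn0] := eqVneq x 0; first by rewrite scale0r addr0.
    apply: interior_subset; apply: ray.
    by rewrite lt_neqAle eq_sym xn0 x0 (le_lt_trans xs).
  exact: (within_comp lA lc gc).
rewrite in_itv /= /k scale0r addr0 subr0 => cs E; by exists c.
Qed.

Lemma ray_pos (G : V -> R) : {within A, continuous G} -> 0 < d -> 0 < G z ->
  exists2 s, 0 < s < d & forall c, 0 < c < s -> 0 < G (z + c *: v).
Proof.
move=> /withinP/(_ z Az)/cvgrPdist_lt Gc d0 Gz.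
have := Gc (G z) Gz; rewrite /within /= => /nbhs_ballP[r /= r0 rP].
pose s := Num.min (d / 2) (r / (`|v| + 1)).
have v1 : 0 < `|v| + 1 by rewrite ltr_wpDl.
have s0 : 0 < s by rewrite lt_min !divr_gt0.
exists s; first by rewrite s0 /= gt_min; apply/orP; left; lra.
move=> c /andP[c0 cs].
have cd : c < d.
  by apply: (lt_trans cs); rewrite gt_min; apply/orP; left; lra.
have cr : c < r / (`|v| + 1).
  by apply: (lt_le_trans cs); rewrite ge_min lexx orbT.
have bc : ball z r (z + c *: v).
  rewrite -ball_normE /= opprD addrA subrr sub0r normrN normrZ gtr0_norm //.
  move: cr; rewrite ltr_pdivlMr //; apply: le_lt_trans.
  by apply: ler_wpM2l; [exact: ltW|rewrite lerDl].
have := rP _ bc (interior_subset (ray (introT andP (conj c0 cd)))).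
by move=> /ltr_normlP[_]; rewrite ltrBlDr -subr_gt0 => ?; lra.
Qed.
End Rays.

Section OneSided.
Context (R : realType) (m : nat) (A : set (Cn R m)) (g : Cn R m -> R).
Hypotheses (regA : regular A) (gA : Ck 2 A g).
Context (z v : Cn R m) (d : R).
Hypotheses (Az : A z) (d0 : 0 < d).
Hypothesis ray : forall s, 0 < s < d -> A° (z + s *: v).
Hypothesis gmax : forall s, 0 < s < d -> g (z + s *: v) <= g z.

Lemma Ck2_derivable x w : A° x -> derivable g x w.
Proof. by move=> Ax; exact: (derivable_c1at (c2at_c1at (Ck2_c2at gA Ax))). Qed.

(** Otherwise the derivative stays positive along the ray near z, and g would exceed [g z] there. *)
Lemma one_sided1 : derive_bd A [:: v] g z <= 0.
Proof.
rewrite leNgt; apply/negP => pos.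
have [Gc GE] := @Ck_derive_bd R _ _ A 2 [:: v] g regA gA isT.
have [s /andP[s0 sd] sP] := ray_pos Az ray Gc d0 pos.
have [gc _] := gA.
have [c /andP[c0 cs] E] := ray_mvt Az ray gc (fun x Ax => Ck2_derivable (w := v) Ax)
  (introT andP (conj s0 sd)).
have cd := lt_trans cs sd.
have := gmax (introT andP (conj s0 sd)); rewrite -subr_le0 E.
have := sP c (introT andP (conj c0 cs)).
have E1 : derive_bd A [:: v] g (z + c *: v) = 'D_v g (z + c *: v).
  exact: (GE _ (ray (introT andP (conj c0 cd)))).
rewrite E1; move: ('D_v g _) => x x0.
by rewrite leNgt mulr_gt0.
Qed.

(** Applying [ray_mvt] to g and then to its derivative, which vanishes at z, gives g (z + s v) - g z
    = s c D^2 g (v, v) at a point of the ray, with c > 0. *)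
Lemma one_sided2 : derive_bd A [:: v] g z = 0 -> derive_bd A [:: v; v] g z <= 0.
Proof.
move=> G0; rewrite leNgt; apply/negP => pos.
have [Gc GE] := @Ck_derive_bd R _ _ A 2 [:: v] g regA gA isT.
have [Hc HE] := @Ck_derive_bd R _ _ A 2 [:: v; v] g regA gA isT.
have [s /andP[s0 sd] sP] := ray_pos Az ray Hc d0 pos.
have [gc _] := gA.
have [c /andP[c0 cs] E] := ray_mvt Az ray gc (fun x Ax => Ck2_derivable (w := v) Ax)
  (introT andP (conj s0 sd)).
have cd := lt_trans cs sd.
have GE' x : A° x -> (fun y => 'D_v g y) x = derive_bd A [:: v] g x.
  by move=> Ax; exact: (esym (GE x Ax)).
have dG x : A° x -> derivable (derive_bd A [:: v] g) x v.
  move=> Ax.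
  have [_] := derive_eq_open v (@open_interior _ A) Ax GE'; apply.
  exact: (derivable_c1at (c2at_c1at_derive v (Ck2_c2at gA Ax))).
have [b /andP[b0 bc] E2] := ray_mvt Az ray Gc dG (introT andP (conj c0 cd)).
have Ab := ray (introT andP (conj b0 (lt_trans bc cd))).
have E3 : 'D_v (derive_bd A [:: v] g) (z + b *: v) =
    derive_bd A [:: v; v] g (z + b *: v).
  have [D _] := derive_eq_open v (@open_interior _ A) Ab GE'.
  exact: (eq_trans (esym D) (esym (HE _ Ab))).
have := sP b (introT andP (conj b0 (lt_trans bc cs))).
rewrite -E3; move: E2; move: ('D_v (derive_bd _ _ _) _) => x; rewrite G0 subr0 => E2 x0.
have := gmax (introT andP (conj s0 sd)); rewrite -subr_le0 E.
have E1 : derive_bd A [:: v] g (z + c *: v) = 'D_v g (z + c *: v).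
  exact: (GE _ (ray (introT andP (conj c0 cd)))).
rewrite -E1 E2; by rewrite leNgt !mulr_gt0.
Qed.
End OneSided.

Section BoundaryDerivatives.
Context (R : realType) (m : nat) (A : set (Cn R m)) (g : Cn R m -> R).
Hypotheses (regA : regular A) (gA : Ck 2 A g).

Lemma derive_bd_linear z a v w : A z ->
  derive_bd A [:: a *: v + w] g z =
  a * derive_bd A [:: v] g z + derive_bd A [:: w] g z.
Proof.
move=> Az; have E := derive_bd_expand regA gA _ Az.
rewrite (E (a *: v + w)) (E v) (E w) mulr_sumr -big_split /=.
apply: eq_bigr => b _; rewrite (crd_lin b a v w) mulrDl mulrA.
by [].
Qed.

(** Identities that follow from bilinearity and symmetry of the Hessian need only be checked in the
    interior; F is the expression in the Hessian under consideration. *)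
Lemma hess_ext (F : (Cn R m -> Cn R m -> R) -> R) (G : Cn R m -> R) z :
  A z -> {within A, continuous (fun x => F (fun a b => derive_bd A [:: a; b] g x))} ->
  {within A, continuous G} ->
  (forall x, A° x -> (forall H : Cn R m -> Cn R m -> R,
     (forall a v1 v2 w, H (a *: v1 + v2) w = a * H v1 w + H v2 w) ->
     (forall v w, H v w = H w v) ->
     (forall a b, H a b = derive_bd A [:: a; b] g x) -> F H = G x)) ->
  F (fun a b => derive_bd A [:: a; b] g z) = G z.
Proof.
move=> Az Fc Gc H; apply: (within_uniqueR regA Fc Gc _ Az) => x Ax.
have gx := Ck2_c2at gA Ax.
have E a b : derive_bd A [:: a; b] g x = 'D_a ('D_b g) x.
  have [_ E] := @Ck_derive_bd R _ _ A 2 [:: a; b] g regA gA isT.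
  exact: (E x Ax).
apply: (H x Ax (fun a b => derive_bd A [:: a; b] g x)) =>
  [a v1 v2 w|v w|a b]; last by [].
  apply: (eq_trans (E _ _)); apply: (eq_trans (hess_linear gx a v1 v2 w)).
  exact: (congr2 (fun p q => a * p + q) (esym (E v1 w)) (esym (E v2 w))).
exact: (eq_trans (E v w) (eq_trans (hess_sym gx v w) (esym (E w v)))).
Qed.

Lemma hess_continuous a b : {within A, continuous (derive_bd A [:: a; b] g)}.
Proof. by have [] := @Ck_derive_bd R _ _ A 2 [:: a; b] g regA gA isT. Qed.

Lemma hess_even z v : A z ->
  derive_bd A [:: - v; - v] g z = derive_bd A [:: v; v] g z.
Proof.
move=> Az; apply: (@hess_ext (fun H => H (- v) (- v))
  (derive_bd A [:: v; v] g) z Az); try exact: hess_continuous.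
move=> x _ H Hl Hs <-.
have HN u w : H (- u) w = - H u w.
  have H0 : H 0 w = 0.
    by have := Hl 1 0 0 w; rewrite scaler0 addr0 mul1r; lra.
  by have := Hl (-1) u 0 w; rewrite scaleN1r addr0 H0; lra.
by rewrite HN Hs HN opprK.
Qed.

(** Since J^2 = -1, setting w = Jv leaves half the trace of the Hessian on the plane of v and Jv. *)
Lemma levi_diag z v : A z -> levi A g z v (Jc v) =
  (derive_bd A [:: Jc v; Jc v] g z + derive_bd A [:: v; v] g z) / 2%:R.
Proof.
move=> Az; apply: (@hess_ext (fun H => (H (Jc v) (Jc v) - H v (Jc (Jc v))) / 2%:R)
  (fun z => (derive_bd A [:: Jc v; Jc v] g z + derive_bd A [:: v; v] g z) / 2%:R)
  z Az).
- by apply: (@levi_continuous _ _ A g regA gA v (Jc v)).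
- apply: within_mul; last exact: within_cst.
  by apply: within_addR; exact: hess_continuous.
move=> x _ H Hl Hs HE; rewrite JcK -!HE.
have HN u w : H (- u) w = - H u w.
  have H0 : H 0 w = 0.
    by have := Hl 1 0 0 w; rewrite scaler0 addr0 mul1r; lra.
  by have := Hl (-1) u 0 w; rewrite scaleN1r addr0 H0; lra.
by rewrite (Hs v (- v)) HN opprK.
Qed.
End BoundaryDerivatives.

Lemma functional0 (R : realType) (V : lmodType R) (D : V -> R) :
  (forall a v w, D (a *: v + w) = a * D v + D w) -> D 0 = 0.
Proof. by move=> L; have := L 1 0 0; rewrite scaler0 addr0 mul1r; lra. Qed.

Lemma functionalN (R : realType) (V : lmodType R) (D : V -> R) v :
  (forall a v w, D (a *: v + w) = a * D v + D w) -> D (- v) = - D v.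
Proof.
move=> L; have := L (-1) v 0.
by rewrite scaleN1r addr0 (functional0 L) addr0 mulN1r.
Qed.

Lemma functional_le0 (R : realType) (V : lmodType R) (D : V -> R) v :
  (forall a v w, D (a *: v + w) = a * D v + D w) -> (forall w, D w <= 0) ->
  D v = 0.
Proof.
move=> L D0; apply/eqP; rewrite eq_le D0 /=.
by have := D0 (- v); rewrite (functionalN _ L) oppr_le0.
Qed.

Lemma interior_ray (R : realType) (V : normedModType R) (B : set V) (z v : V) : B° z ->
  exists2 d : R, 0 < d & forall s, 0 < s < d -> B° (z + s *: v).
Proof.
move=> Bz; have c : z + s *: v @[s --> (0 : R)] --> z + 0 *: v.
  by apply: cvgD; [exact: cvg_cst|apply: cvgZr_tmp; exact: cvg_id].
have : \forall s \near (0 : R), B° (z + s *: v).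
  apply: c; rewrite scale0r addr0.
  exact: (open_nbhs_nbhs (conj (@open_interior _ B) Bz)).
move=> /nbhs_ballP[d /= d0 dP]; exists d => // s /andP[s0 sd].
by apply: dP; rewrite -ball_normE /= sub0r normrN gtr0_norm.
Qed.

Section DefiningFunction.
Context (R : realType) (m : nat) (A W : set (Cn R m)) (z : Cn R m).
Context (rho : Cn R m -> R).
Hypothesis rhoP : defining_fun A z W rho.

Lemma defining_c1at x : W x -> c1at rho x.
Proof.
move=> Wx; have [Wo [_ [rC _]]] := rhoP.
exact: (Ck_open_c1at (vs := [::]) rC isT (open_nbhs_nbhs (conj Wo Wx))).
Qed.

Lemma defining_negative_interior x : W x -> rho x < 0 -> A° x.
Proof.
move=> Wx rx; have [Wo [_ [[rc _] [_ [AW _]]]]] := rhoP.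
have Wn : nbhs x W by exact: (open_nbhs_nbhs (conj Wo Wx)).
move/withinP: rc => /(_ x Wx); rewrite (within_interior Wn) => /cvgrPdist_lt.
have nrx : 0 < - rho x by rewrite oppr_gt0.
move=> /(_ _ nrx) near_rho.
apply: filterS2 Wn near_rho => y Wy /ltr_normlP[+ _]; rewrite opprB => ry.
have : ([set y | rho y <= 0] `&` W) y by split => //=; lra.
by rewrite -AW => -[].
Qed.

Lemma defining_ray v : 'D_v rho z < 0 ->
  exists2 d : R, 0 < d & forall s, 0 < s < d -> A° (z + s *: v).
Proof.
move=> Dneg; have [Wo [Wz [_ [rz _]]]] := rhoP.
have D := derivable_cvg (derivable_c1at (v := v) (defining_c1at Wz)).
have nD : 0 < - 'D_v rho z by rewrite oppr_gt0.
have near1 : \forall h \near (0 : R)^', h^-1 * (rho (h *: v + z) - rho z) < 0.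
  move/cvgrPdist_lt: D => /(_ _ nD); apply: filterS => h.
  move: ('D_v rho z) => D; rewrite /GRing.scale /=.
  by move=> /ltr_normlP[+ _]; rewrite opprB => ?; lra.
have cW : h *: v + z @[h --> (0 : R)] --> 0 *: v + z.
  by apply: cvgD; [apply: cvgZr_tmp; exact: cvg_id|exact: cvg_cst].
have near2 : \forall h \near (0 : R), W (h *: v + z).
  by apply: cW; rewrite scale0r add0r; exact: (open_nbhs_nbhs (conj Wo Wz)).
have : \forall h \near (0 : R), h != 0 ->
    W (h *: v + z) /\ h^-1 * (rho (h *: v + z) - rho z) < 0.
  move: near1; rewrite /dnbhs near_withinE => near1.
  by apply: filterS2 near1 near2 => h h1 h2 h0; split => //; exact: h1.
move=> /nbhs_ballP[d /= d0 dP]; exists d => // s /andP[s0 sd].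
have bs : ball (0 : R) d s by rewrite -ball_normE /= sub0r normrN gtr0_norm.
have [Ws] := dP s bs (lt0r_neq0 s0); rewrite rz subr0 => neg.
rewrite addrC; apply: defining_negative_interior => //.
by rewrite -(pmulr_rlt0 _ (_ : 0 < s^-1)) // invr_gt0.
Qed.

Lemma defining_linear a v w :
  'D_(a *: v + w) rho z = a * 'D_v rho z + 'D_w rho z.
Proof. by have [_ [Wz _]] := rhoP; exact: derive_linear (defining_c1at Wz). Qed.
End DefiningFunction.

Section StrictlySubharmonic.
Context (R : realType) (T : topologicalType) (m : nat) (A : charts R T m).
Context (om : form2 A) (h : T -> R).
Hypotheses (atlas : complex_atlas A) (omM : hermitian_metric om).
Hypothesis hC2 : mfd_Ck A 2 h.
Hypothesis h_laplace : forall s, ~ bdry A s ->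
  forall i, dom i s -> forall v w, iddbar h i s v w = 1 * om i s v w.

Lemma not_bdryP (i : idx A) s : dom i s ->
  ~ bdry A s <-> (img i)° (coord i s).
Proof.
move=> si; split=> [nb|iz [j sj nj]].
  by apply: contrapT => ni; apply: nb; exists i.
by apply: nj; exact: (atlas_interior atlas si sj).
Qed.

Lemma iddbar_metric (i : idx A) s v w : dom i s ->
  iddbar h i s v w = om i s v w.
Proof.
move=> si; have regi := @atlas_regular _ _ _ _ atlas i.
have [_ [oms _]] := omM; have [omc _] := oms i 0%N v w.
rewrite -[in RHS](atlas_paramK atlas si).
apply: (@within_uniqueR _ _ _ (fun z => levi (img i) (h \o param i) z v w)
  (fun z => om i (param i z) v w) regi _ omc _ _ (img_coord si)).
  exact: (levi_continuous regi (hC2 i)).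
move=> z iz; have iz' := interior_subset iz.
have dz := dom_param atlas iz'; have cz := coord_param atlas iz'.
have nb : ~ bdry A (param i z) by apply/(not_bdryP dz); rewrite cz.
have := h_laplace nb dz v w; rewrite mul1r => <-.
by rewrite /iddbar /levi cz.
Qed.

Lemma levi_diag_pos (i : idx A) s v : dom i s -> v != 0 ->
  0 < derive_bd (img i) [:: Jc v; Jc v] (h \o param i) (coord i s) +
      derive_bd (img i) [:: v; v] (h \o param i) (coord i s).
Proof.
move=> si v0; have := metric_pos omM si v0; rewrite -(iddbar_metric _ _ si).
have := levi_diag (@atlas_regular _ _ _ _ atlas i) (hC2 i) v (img_coord si).
rewrite /iddbar /levi => ->; move: (_ + _) => x; lra.
Qed.

Lemma mfd_continuous : continuous h.
Proof.
move=> s; have [i si] := atlas_cover atlas s.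
have [hc _] := hC2 i; have := chart_cvg atlas si hc.
rewrite /= (atlas_paramK atlas si); apply: cvg_trans; apply: near_eq_cvg.
by apply: filterS (near_dom atlas si) => q qi /=; rewrite (atlas_paramK atlas qi).
Qed.

(** At a maximum both diagonal entries of the Hessian at v and Jv are at most 0, against
    [levi_diag_pos]. *)
Lemma interior_not_max s (v : Cn R m) : ~ bdry A s -> v != 0 ->
  ~ (forall s', h s' <= h s).
Proof.
move=> nb v0 hmax; have [i si] := atlas_cover atlas s.
have iz := (not_bdryP si).1 nb; have regi := @atlas_regular _ _ _ _ atlas i.
have Az := img_coord si.
have gm w d t : 0 < t < d -> (h \o param i) (coord i s + t *: w) <=
    (h \o param i) (coord i s).
  by move=> _ /=; rewrite (atlas_paramK atlas si); exact: hmax.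
have D1 w : derive_bd (img i) [:: w] (h \o param i) (coord i s) <= 0.
  have [d d0 ray] := interior_ray w iz.
  by apply: (one_sided1 regi (hC2 i) Az d0 ray) => t; exact: gm.
have D0 w : derive_bd (img i) [:: w] (h \o param i) (coord i s) = 0.
  exact: (@functional_le0 _ _
    (fun w => derive_bd (img i) [:: w] (h \o param i) (coord i s)) w
    (fun a v w => derive_bd_linear regi (hC2 i) a v w Az) D1).
have D2 w : derive_bd (img i) [:: w; w] (h \o param i) (coord i s) <= 0.
  have [d d0 ray] := interior_ray w iz.
  by apply: (one_sided2 regi (hC2 i) Az d0 ray) => // t; exact: gm.
have := levi_diag_pos si v0; have := D2 v; have := D2 (Jc v).
by move: (derive_bd _ _ _ _) (derive_bd _ _ _ _) => x y; lra.
Qed.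

Lemma max_principle (v : Cn R m) : compact [set: T] -> v != 0 ->
  (forall s, bdry A s -> h s = 0) -> forall s, h s <= 0.
Proof.
move=> Tc v0 hb s.
have hc : {within [set: T], continuous h}.
  by apply: continuous_subspaceT; exact: mfd_continuous.
have [s0 _ s0max] := compact_EVT_max (ex_intro _ s I : [set: T] !=set0) Tc hc.
have hmax s' : h s' <= h s0 by apply: s0max; rewrite inE.
have [/hb h0|nb] := pselect (bdry A s0); first by rewrite -h0.
by have := interior_not_max nb v0 hmax.
Qed.

(* Since [h] is C^2 up to the boundary, no barrier is needed: if [dh] vanished at
   a boundary point, then [D^2 h (v, v) <= 0] for [v] pointing inwards, hence by
   parity for every transverse [v], against [i d dbar h > 0]. *)
Lemma hopf (i : idx A) s W rho : dom i s ->
  defining_fun (img i) (coord i s) W rho ->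
  (forall s', h s' <= 0) -> h s = 0 ->
  exists w, derive_bd (img i) [:: w] (h \o param i) (coord i s) != 0.
Proof.
move=> si rhoP h_le0 hs; apply: contrapT => nex.
have D0 w : derive_bd (img i) [:: w] (h \o param i) (coord i s) = 0.
  by apply/eqP; apply: contrapT => /negP nw; apply: nex; exists w.
have regi := @atlas_regular _ _ _ _ atlas i; have Az := img_coord si.
have neg w : 'D_w rho (coord i s) < 0 ->
    derive_bd (img i) [:: w; w] (h \o param i) (coord i s) <= 0.
  move=> /(defining_ray rhoP)[d d0 ray].
  apply: (one_sided2 regi (hC2 i) Az d0 ray) => // t _ /=.
  by rewrite (atlas_paramK atlas si) hs; exact: h_le0.
have L := defining_linear rhoP.
have rho0 : 'D_0 rho (coord i s) = 0 by exact: derive0.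
have LN w : 'D_(- w) rho (coord i s) = - 'D_w rho (coord i s).
  exact: (@functionalN _ _ (fun w => 'D_w rho (coord i s)) w L).
have D2 w : 'D_w rho (coord i s) != 0 ->
    derive_bd (img i) [:: w; w] (h \o param i) (coord i s) <= 0.
  rewrite neq_lt => /orP[/neg//|pos]; rewrite -(hess_even regi (hC2 i) w Az).
  by apply: neg; rewrite LN oppr_lt0.
(* If v0 is transverse but J v0 is tangent, then v0 + J v0 and its image J v0 - v0 are both
   transverse. *)
have [v [v1 v2]] : exists v, 'D_v rho (coord i s) != 0 /\
    'D_(Jc v) rho (coord i s) != 0.
  have [_ [_ [_ [_ [_ [v0 v0P]]]]]] := rhoP.
  have [b0|b0] := eqVneq ('D_(Jc v0) rho (coord i s)) 0; last by exists v0.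
  exists (1 *: v0 + Jc v0); rewrite (Jc_lin 1 v0 (Jc v0)) JcK.
  rewrite (L 1 v0 (Jc v0)) (L 1 (Jc v0) (- v0)) LN b0.
  by rewrite addr0 mulr0 add0r mul1r oppr_eq0.
have vn0 : v != 0 by apply: contraNneq v1 => ->; rewrite rho0.
have := levi_diag_pos si vn0; have := D2 v v1; have := D2 (Jc v) v2.
by move: (derive_bd _ _ _ _) (derive_bd _ _ _ _) => x y; lra.
Qed.
End StrictlySubharmonic.

(** * The normal derivative at the boundary *)

(** A functional with a sign on the half-space r < 0 vanishes on the hyperplane r = 0, hence is a
    multiple of r. *)
Lemma halfspace_functional (R : realType) (V : lmodType R) (D r : V -> R) nu v :
  (forall a v w, D (a *: v + w) = a * D v + D w) ->
  (forall a v w, r (a *: v + w) = a * r v + r w) ->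
  r nu < 0 -> (forall v, r v < 0 -> D v <= 0) -> D v = r v / r nu * D nu.
Proof.
move=> DL rL rnu H.
have tang w : r w = 0 -> D w = 0.
  move=> rw; apply/eqP; apply: contraT => Dw.
  (* The multiple of w is chosen so that D takes the value 1 while r keeps its value at [nu]. *)
  have := H (((1 - D nu) / D w) *: w + nu).
  rewrite rL rw mulr0 add0r DL divfK // subrK => /(_ rnu).
  by rewrite leNgt ltr01.
have rn0 : r nu != 0 by rewrite lt_eqF.
have := tang ((- (r v / r nu)) *: nu + v).
rewrite rL DL mulNr divfK // addNr => /(_ erefl).
by rewrite mulNr addrC => /subr0_eq.
Qed.

Lemma near_half_square (R : realType) (T : Type) (F : set_system T)
    {FF : Filter F} (f : T -> R) (l : R) : f @ F --> l -> l != 0 ->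
  \forall t \near F, (l / 2) ^+ 2 <= f t ^+ 2.
Proof.
move=> fl l0; have f2 : f t * f t @[t --> F] --> l * l by exact: cvgM.
have l20 : 0 < l * l by rewrite -expr2 exprn_even_gt0.
have ll : (l / 2) ^+ 2 < l * l by rewrite expr_div_n expr2; lra.
by apply: filterS (cvgr_gt _ f2 _ ll) => t; rewrite -expr2 => /ltW.
Qed.

Lemma near_le (R : realType) (T : Type) (F : set_system T)
    {FF : Filter F} (f : T -> R) (l b : R) : f @ F --> l -> l < b ->
  \forall t \near F, f t <= b.
Proof. by move=> fl lb; apply: filterS (cvgr_lt _ fl _ lb) => t /ltW. Qed.

Section Normal.
Context (R : realType) (m : nat) (om : Cn R m -> Cn R m -> R).
Hypotheses (om11 : form11 om) (omP : pos11 om).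

Lemma form11_linear_r nu a v w :
  om nu (Jc (a *: v + w)) = a * om nu (Jc v) + om nu (Jc w).
Proof.
have [ol oa _] := om11.
by rewrite Jc_lin oa ol (oa (Jc v) nu) (oa (Jc w) nu); ring.
Qed.

(** Both sides are functionals of v that vanish where r does and equal 1 at [nu]. *)
Lemma normal_ratio (r : Cn R m -> R) nu v :
  (forall a v w, r (a *: v + w) = a * r v + r w) -> r nu < 0 ->
  om nu (Jc nu) = 1 -> (forall v, r v = 0 -> om nu (Jc v) = 0) ->
  r v / r nu = om nu (Jc v).
Proof.
move=> rL rnu on ot; have rn0 : r nu != 0 by rewrite lt_eqF.
have := ot ((- (r v / r nu)) *: nu + v).
rewrite rL mulNr divfK // addNr => /(_ erefl).
by rewrite form11_linear_r on mulr1 addrC => /subr0_eq.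
Qed.

(** Expand the squared length of w - c nu, the component of w orthogonal to [nu]. *)
Lemma form11_cauchy_schwarz nu w : om nu (Jc nu) = 1 ->
  om nu (Jc w) ^+ 2 <= om w (Jc w).
Proof.
move=> on; set c := om nu (Jc w).
have o0 v : 0 <= om v (Jc v).
  have [->|/omP/ltW//] := eqVneq v 0.
  have := form11_linear_r 0 (1 : R) 0 0.
  have [ol _ _] := om11; have := ol 1 0 0 (Jc 0).
  by rewrite scaler0 addr0 mul1r => E _; move: E; move: (om 0 _) => x; lra.
have [ol _ _] := om11.
have := o0 ((- c) *: nu + w); rewrite ol !form11_linear_r on -/c.
rewrite -(form11_swap nu w om11) -/c.
by move: (om w _) => x; rewrite expr2; nra.
Qed.
End Normal.

Section NormalDerivative.
Context (R : realType) (T : topologicalType) (m : nat) (A : charts R T m).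
Context (om : form2 A) (phi H : T -> R).
Hypotheses (atlas : complex_atlas A) (omM : hermitian_metric om).
Hypotheses (phiC2 : mfd_Ck A 2 phi) (HC2 : mfd_Ck A 2 H).
Hypothesis H_le0 : forall p, H p <= 0.

Local Notation D u k p v := (derive_bd (img k) [:: v] (u \o param k) (coord k p)).

Lemma derive_bd_chart (u : T -> R) (i j : idx A) p v : mfd_Ck A 2 u ->
  dom i p -> dom j p -> D u i p v = D u j p (dtr i j (coord i p) v).
Proof.
move=> uC2 ip jp.
apply: (eq_trans (derive_bd_pull atlas uC2 v (overlap_coord ip jp))).
exact: (congr1 (derive_bd (img j) [:: dtr i j (coord i p) v] (u \o param j))
  (trans_coord atlas j ip)).
Qed.

(* On the boundary [H] attains its maximum, so [dH] is a nonnegative multiple of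
   the differential of a defining function. *)
Lemma normal_derive_factor (k : idx A) p nu : dom k p -> H p = 0 ->
  unit_inner_normal om k p nu ->
  D H k p nu <= 0 /\ forall v, D H k p v = om k p nu (Jc v) * D H k p nu.
Proof.
move=> kp Hp [on [W [rho [rhoP [ot rnu]]]]].
have regk := @atlas_regular _ _ _ _ atlas k; have Az := img_coord kp.
have neg v : 'D_v rho (coord k p) < 0 -> D H k p v <= 0.
  move=> /(defining_ray rhoP)[d d0 ray].
  apply: (one_sided1 regk (HC2 k) Az d0 ray) => t _ /=.
  by rewrite (atlas_paramK atlas kp) Hp; exact: H_le0.
split=> [|v]; first exact: neg.
have [om11 _] := omM; have o11 := real11_form11 om11 kp.
have E1 := @halfspace_functional R _ (fun v => D H k p v)
  (fun v => 'D_v rho (coord k p)) nu v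
  (fun a v w => derive_bd_linear regk (HC2 k) a v w Az)
  (defining_linear rhoP) rnu neg.
have E2 := @normal_ratio R m _ o11 (fun v => 'D_v rho (coord k p)) nu v
  (defining_linear rhoP) rnu on ot.
exact: (eq_trans E1 (congr1 (fun x => x * _) E2)).
Qed.

(** Apply [bilinear_bound] to the product L v L w. *)
Lemma functional_square_bound (L : Cn R m -> R) (K : R) v :
  (forall a v w, L (a *: v + w) = a * L v + L w) ->
  (forall b, `|L (bas R b)| <= K) -> 0 <= K ->
  L v ^+ 2 <= K ^+ 2 * ncrd R m * nrm2 v.
Proof.
move=> LL Lb K0.
have := @bilinear_bound R m (fun v w => L v * L w) (K ^+ 2) v v (sqr_ge0 _).
have -> : (nrm2 v + nrm2 v) / 2 = nrm2 v by field.
rewrite [L v ^+ 2]expr2 => H'; apply: le_trans (ler_norm _) (H' _ _).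
  move=> v1 v2; rewrite (lin_expand LL v1) mulr_suml; apply: eq_bigr => k _.
  rewrite -mulrA (lin_expand LL v2) mulr_sumr; congr (_ * _).
  by apply: eq_bigr => l _; rewrite mulrCA.
by move=> k l; rewrite normrM expr2 ler_pM.
Qed.

(** For x the derivative of phi and y that of H: were x >= -t y, then t^2 y^2 <= x^2 <= c. But y^2
    >= a / b, and t >= 1 gives t^2 >= t > c b / a. *)
Lemma normal_arith (x y t a b c : R) : 0 < a -> 0 < b -> 0 <= c -> y <= 0 ->
  a <= b * y ^+ 2 -> x ^+ 2 <= c -> 1 + c * b / a <= t -> x + t * y < 0.
Proof.
move=> a0 b0 c0 y0 ay xc tP; rewrite ltNge; apply/negP => xty.
have cba0 : 0 <= c * b / a by rewrite divr_ge0 ?mulr_ge0 // ltW.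
have t1 : 1 <= t by lra.
have t0 : 0 <= t by lra.
have nx : 0 <= - (t * y) by rewrite oppr_ge0 mulr_ge0_le0.
have x2 : t ^+ 2 * y ^+ 2 <= x ^+ 2.
  rewrite -exprMn -sqrrN lerXn2r ?nnegrE //; last by lra.
  by lra.
have t2 : c * b / a < t ^+ 2.
  have tt : t <= t ^+ 2 by rewrite expr2 ler_peMl.
  by lra.
rewrite ltr_pdivrMr // in t2.
have h1 : t ^+ 2 * a <= t ^+ 2 * (b * y ^+ 2) by rewrite ler_wpM2l // sqr_ge0.
have h2 := ler_wpM2l (ltW b0) (le_trans x2 xc).
rewrite mulrCA in h1; have := le_trans h1 h2.
by rewrite leNgt [b * c]mulrC t2.
Qed.

(** A unit vector at p has length s <= 2 for the metric at p0, squared lengths being meant, so its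
    squared Euclidean norm n is at most 2 / c. *)
Lemma square_arith (q K N n c s : R) : 0 < c -> 0 <= N ->
  q ^+ 2 <= K ^+ 2 * N * n -> 0 <= 1 - 2^-1 * s -> c * n <= s ->
  q ^+ 2 <= K ^+ 2 * N * (2 / c).
Proof.
move=> c0 N0 rn sP sn; apply: (le_trans rn); apply: ler_wpM2l.
  by rewrite mulr_ge0 // sqr_ge0.
by rewrite ler_pdivlMr //; lra.
Qed.

(** By [normal_derive_factor] and Cauchy-Schwarz, the square of the normal derivative of H is at
    least that of its derivative along w, divided by om(w, Jw). With w the fixed vector [w0] seen in
    the chart k, this stays away from 0 near p0. *)
Lemma normal_derive_near (k0 : idx A) p0 w0 : dom k0 p0 ->
  D H k0 p0 w0 != 0 ->
  exists t0 : R, \forall p \near p0, forall (k : idx A) nu t, dom k p ->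
    H p = 0 -> unit_inner_normal om k p nu -> t0 <= t ->
    D phi k p nu + t * D H k p nu < 0.
Proof.
move=> kp0 Hw0; have [om11 [oms _]] := omM.
have o11 := real11_form11 om11 kp0; have oP := metric_pos omM kp0.
have [c c0 cP] := pos11_bound o11 oP.
have w0n : w0 != 0.
  apply: contraNneq Hw0 => ->; apply/eqP.
  exact: (@functional0 _ _ (fun w => D H k0 p0 w)
    (fun a v w => derive_bd_linear (@atlas_regular _ _ _ _ atlas k0) (HC2 k0)
      a v w (img_coord kp0))).
(* Near p0, a bounds from below the square of the derivative of H along [w0], b bounds om(w0, J w0),
   K the partial derivatives of phi, and C the square of its derivative along any unit vector. *)
pose a := (D H k0 p0 w0 / 2) ^+ 2.
pose b := om k0 p0 w0 (Jc w0) + 1.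
pose K := 1 + \sum_b `|D phi k0 p0 (bas R b)|.
pose C := K ^+ 2 * ncrd R m * (2 / c).
have a0 : 0 < a by rewrite exprn_even_gt0 //= mulf_neq0 // invr_neq0.
have b0 : 0 < b by rewrite addr_gt0 // oP.
have K0 : 0 <= K by rewrite addr_ge0 // sumr_ge0.
have N0 : 0 <= ncrd R m by rewrite /ncrd ler0n.
have c20 : 0 <= 2 / c by rewrite divr_ge0 // ltW.
have C0 : 0 <= C by rewrite mulr_ge0 // mulr_ge0 // sqr_ge0.
exists (1 + C * b / a).
have n1 : \forall p \near p0, a <= D H k0 p w0 ^+ 2.
  by apply: near_half_square => //; exact: derive_bd_cvg.
have n2 : \forall p \near p0, om k0 p w0 (Jc w0) <= b.
  apply: (@near_le _ _ _ _ _ (om k0 p0 w0 (Jc w0))); first exact: smooth_form_cvg.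
  by rewrite /b ltrDl.
have n3 : \forall p \near p0, forall b, `|D phi k0 p (bas R b)| <= K.
  apply: near_finite => b'.
  apply: (@near_le _ _ _ _ _ `|D phi k0 p0 (bas R b')|).
    by apply: cvg_norm; exact: derive_bd_cvg.
  rewrite /K (bigD1 b') //= addrCA ltrDl.
  by apply: (lt_le_trans ltr01); rewrite lerDl sumr_ge0.
have n4 : \forall p \near p0, forall v,
    0 <= om k0 p v (Jc v) - 2^-1 * om k0 p0 v (Jc v).
  apply: (@form11_near_pos R m T (nbhs p0) _
    (fun p v w => om k0 p v w - 2^-1 * om k0 p0 v w)
    (fun v w => 2^-1 * om k0 p0 v w)).
  - exact: form11_scale.
  - by move=> v v0; rewrite mulr_gt0 ?invr_gt0 // oP.
  - apply: filterS (near_dom atlas kp0) => p kp; apply: form11_sub.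
      exact: real11_form11.
    exact: form11_scale.
  - move=> v w; rewrite [X in _ --> X](_ : _ = om k0 p0 v w - 2^-1 * om k0 p0 v w); last by field.
    by apply: cvgB; [exact: smooth_form_cvg|exact: cvg_cst].
apply: filterS3 (filterI n1 n2) (filterI n3 n4) (near_dom atlas kp0).
move=> p [p1 p2] [p3 p4] k0p k nu t kp Hp nuP tP.
have [y0 yE] := normal_derive_factor kp Hp nuP.
have okp := overlap_coord kp k0p; have ok0p := overlap_coord k0p kp.
have ok11 := real11_form11 om11 kp; have okP := metric_pos omM kp.
have [on _] := nuP.
(* [w0] is carried to the chart k in which [nu] is given, and [nu] to the chart k0 in which the
   constants were fixed. *)
have [w Ew ow] : exists2 w, D H k0 p w0 = D H k p w & om k p w (Jc w) <= b.
  exists (dtr k0 k (coord k0 p) w0).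
    exact: derive_bd_chart.
  have := real11_chart w0 (Jc w0) om11 k0p kp.
  by rewrite (dtr_J atlas w0 ok0p) => <-.
have [x Ex ox] : exists2 x, D phi k p nu = D phi k0 p x & om k0 p x (Jc x) = 1.
  exists (dtr k k0 (coord k p) nu).
    exact: derive_bd_chart.
  apply: (eq_trans (congr1 (om k0 p _) (esym (dtr_J atlas nu okp)))).
  exact: (eq_trans (esym (real11_chart nu (Jc nu) om11 kp k0p)) on).
have y2 : a <= b * D H k p nu ^+ 2.
  move: p1 y0 (eq_trans Ew (yE w)) (form11_cauchy_schwarz ok11 okP w on) ow.
  move: (D H k0 p w0) (D H k p nu) (om k p nu _) (om k p w _) => q y r s.
  move=> aq _ E rs sb; apply: (le_trans aq); rewrite E exprMn.
  by apply: ler_wpM2r; [exact: sqr_ge0|exact: le_trans rs sb].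
have x2 : D phi k p nu ^+ 2 <= C.
  have L s v1 v2 := derive_bd_linear (@atlas_regular _ _ _ _ atlas k0) (phiC2 k0)
    s v1 v2 (img_coord k0p).
  have h1 := @functional_square_bound (fun v => D phi k0 p v) K x L p3 K0.
  have h2 := p4 x; rewrite ox in h2.
  have h3 := square_arith c0 N0 h1 h2 (cP x).
  by rewrite Ex; exact: h3.
exact: (normal_arith a0 b0 C0 y0 y2 x2 tP).
Qed.
End NormalDerivative.

(** * Passage from pointwise to uniform large t *)

(** Monotonicity makes the limit exist, as a supremum; it is known for t >= 0 only, hence the
    truncation by [Num.max 0 t]. *)
Lemma lim_monotone_gt (R : realType) (g : R -> R) (x : R) :
  (forall s t, 0 <= s -> s <= t -> g s <= g t) ->
  (x%:E < lim ((g t)%:E @[t --> +oo%R]))%E ->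
  exists2 t, 0 <= t & x < g t.
Proof.
move=> gm xl; pose k t := (g (Num.max 0 t))%:E.
have kl : k t @[t --> +oo%R] --> ereal_sup (range k).
  apply: nondecreasing_cvge => s t st; rewrite lee_fin; apply: gm.
    by rewrite le_max lexx.
  by rewrite ge_max !le_max lexx /= st orbT.
have gl : (g t)%:E @[t --> +oo%R] --> ereal_sup (range k).
  apply: cvg_trans kl; apply: near_eq_cvg; near=> t.
  rewrite /k max_r //; near: t; exact: nbhs_pinfty_ge.
move: xl; rewrite (cvg_lim _ gl) // => /ereal_sup_gt[_ [t _ <-] xt].
by exists (Num.max 0 t); [rewrite le_max lexx|rewrite -lte_fin].
Unshelve. all: by end_near. Qed.

Lemma interior_preimage (T U : topologicalType) (g : T -> U) (x : T) (B : set U) :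
  {for x, continuous g} -> B° (g x) -> \forall y \near x, B° (g y).
Proof.
by move=> gc Bx; exact: (gc _ (open_nbhs_nbhs (conj (@open_interior _ B) Bx))).
Qed.

Lemma evec_neq0 (R : realType) (m : nat) (j : 'I_m) : evec R j != 0.
Proof.
apply/eqP => E; have /eqP := congr1 (crd (false, j)) E.
by rewrite /crd /evec /= !mxE !eqxx oner_eq0.
Qed.

Lemma not_bdry_near (R : realType) (T : topologicalType) (m : nat)
    (A : charts R T m) s : complex_atlas A -> ~ bdry A s ->
  \forall s' \near s, ~ bdry A s'.
Proof.
move=> atlas nb; have [i si] := atlas_cover atlas s.
have ci := (not_bdryP atlas si).1 nb.
have ni' := interior_preimage (coord_continuous_at atlas si) ci.
by apply: filterS2 (near_dom atlas si) ni' => s' si' iz; apply/(not_bdryP atlas si').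
Qed.

Lemma near_snd (X S : topologicalType) (p0 : X * S) (P : S -> Prop) :
  (\forall s \near p0.2, P s) -> \forall p \near p0, P p.2.
Proof.
case: p0 => x s /= Ps; exists ([set: X], P); last by move=> [a b] [].
by split => //=; exact: filterT.
Qed.

Lemma near_prodI (T U : Type) (F : set_system T) (G : set_system U)
    (P : T -> Prop) (Q : U -> Prop) :
  (\forall x \near F, P x) -> (\forall y \near G, Q y) ->
  \forall x \near F & y \near G, P x /\ Q y.
Proof. by move=> FP GQ; exists (P, Q). Qed.

(* MathComp-Analysis. The complex dimension of X is m >= 1 and that of M = X x S
   is n = m + 1; S here denotes the surface with its boundary. *)
Theorem mainTheorem7 (R : realType) (m : nat) (m_ge1 : (1 <= m)%N)
    (beta : R) (beta01 : 0 < beta < 1)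
    (X : topologicalType) (AX : charts R X m) (omX : form2 AX)
    (X_hausdorff : hausdorff_space X) (X_compact : compact [set: X])
    (X_atlas : complex_atlas AX) (X_closed : bdry AX = set0)
    (omX_metric : hermitian_metric omX)
    (S : topologicalType) (AS : charts R S 1) (omS : form2 AS)
    (S_hausdorff : hausdorff_space S) (S_compact : compact [set: S])
    (S_atlas : complex_atlas AS) (S_bdry : bdry_class AS 2 beta)
    (omS_metric : hermitian_metric omS)
    (om chi : form2 (prod_charts AX AS))
    (om_metric : hermitian_metric om)
    (chi_form : real11form chi) (chi_smooth : smooth_form chi)
    (h : S -> R)
    (h_smooth : mfd_smooth_int AS h) (h_holder : mfd_CkHolder AS 2 beta h)
    (h_laplace : forall s, ~ bdry AS s -> is_laplacian omS h s 1)
    (h_bdry : forall s, bdry AS s -> h s = 0)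
    (Gam : set 'rV[R]_(m + 1)) (f : 'rV[R]_(m + 1) -> R)
    (Gam_cone : symmetric_cone Gam) (f_sym : smooth_symmetric Gam f)
    (f_incr : increasing_on Gam f) (f_concave : concave_on Gam f)
    (psi : X * S -> R) (psi_cont : continuous psi)
    (phi : X * S -> R) (phi_C21 : mfd_CkHolder (prod_charts AX AS) 2 1 phi)
    (phi_adm : admissible om chi Gam phi)
    (phi_lim : forall (k : idx (prod_charts AX AS)) p, dom k p ->
       ((psi p)%:E <
        lim ((f (lambda om
                 (form_add (gform chi phi) (form_scale t (pull2 omS))) k p))%:E
             @[t --> +oo%R]))%E) :
  \forall t \near +oo%R,
    let u := fun p : X * S => phi p + t * h p.2 in
    admissible om chi Gam u /\
    (forall (k : idx (prod_charts AX AS)) p, dom k p ->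
       psi p < f (lambda om (gform chi u) k p)) /\
    (forall p : X * S, bdry AS p.2 -> u p = phi p) /\
    (forall (k : idx (prod_charts AX AS)) p nu, dom k p -> bdry AS p.2 ->
       unit_inner_normal om k p nu -> normal_derive u k p nu < 0).
Proof.
pose AP := prod_charts AX AS.
have P_atlas : complex_atlas AP := prod_atlas X_atlas S_atlas.
have hC2 : mfd_Ck AS 2 h by move=> i; have [] := h_holder i.
have phiC2 : mfd_Ck AP 2 phi by move=> k; have [] := phi_C21 k.
pose H (p : X * S) := h p.2.
have HC2 : mfd_Ck AP 2 H := @mfd_Ck_pr2 _ _ _ _ _ AX AS h 2 hC2.
pose u t (p : X * S) := phi p + t * h p.2.
have uC2 t : mfd_Ck AP 2 (u t).
  by move=> k; have [] := Ck_add_scale t (phiC2 k) (HC2 k).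
have regP (k : idx AP) : regular (img k) := @atlas_regular _ _ _ _ P_atlas k.
have uD t (k : idx AP) vs z : (size vs <= 2)%N -> img k z ->
    derive_bd (img k) vs (u t \o param k) z =
    derive_bd (img k) vs (phi \o param k) z +
    t * derive_bd (img k) vs (H \o param k) z.
  exact: (derive_bd_add_scale t (regP k) (phiC2 k) (HC2 k)).
have u0 : u 0 = phi by apply/funext => p; rewrite /u mul0r addr0.
have iddH i s v w : dom i s -> iddbar h i s v w = omS i s v w.
  exact: (iddbar_metric S_atlas omS_metric hC2 h_laplace).
(* The Hessian of h o pi_2 is that of h in the second chart, so the added term is t times the
   pullback of [omS], at boundary points as well. *)
have gE t (k : idx AP) p v w : dom k p -> gform chi (u t) k p v w =
    gform chi phi k p v w + t * omS k.2 p.2 (Cn_snd v) (Cn_snd w).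
  move=> kp; have kz := img_coord kp.
  have [_ kp2] := kp; rewrite -(iddH _ _ _ _ kp2) /gform /form_add /iddbar.
  rewrite (uD t k [:: Jc v; w] _ isT kz) (uD t k [:: v; Jc w] _ isT kz).
  rewrite (derive_bd_pr2 X_atlas S_atlas hC2 (vs := [:: Jc v; w]) isT kz).
  rewrite (derive_bd_pr2 X_atlas S_atlas hC2 (vs := [:: v; Jc w]) isT kz).
  rewrite /= !Cn_snd_J Cn_pairK2.
  move: (chi _ _ _ _) (derive_bd _ _ _ _) (derive_bd _ _ _ _) => c a b.
  move: (derive_bd _ _ _ _) (derive_bd _ _ _ _) => a' b'.
  by field.
pose lam t := lambda om (gform chi (u t)).
have lamE t (k : idx AP) p : dom k p ->
    lambda om (form_add (gform chi phi) (form_scale t (pull2 omS))) k p = lam t k p.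
  move=> kp; rewrite /lam /lambda; congr eigen11; apply/funext => v.
  by apply/funext => w; rewrite gE.
have g11 t : real11form (gform chi (u t) : form2 AP).
  exact: (real11_add chi_form (iddbar_real11form P_atlas (uC2 t))).
have [om11 [om_smooth _]] := om_metric.
have lam_mono s t (k : idx AP) p : s <= t -> dom k p ->
    exists pi : 'S_(m + 1), forall i, lam s k p 0 i <= lam t k p 0 (pi i).
  move=> st kp.
  have o11 := real11_form11 om11 kp; have oP := metric_pos om_metric kp.
  (* Point, chart and metric are the same on both sides, so the comparison is made with e = 0 and d
     the identity. *)
  have key i v : let l := eigen11 (om k p) (gform chi (u s) k p) 0 i in
      gform chi (u s) k p v (Jc v) - l * om k p v (Jc v) <=
      gform chi (u t) k p v (Jc v) - (l - 0) * om k p v (Jc v).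
    rewrite /= subr0 lerD2r !gE // lerD2l.
    apply: ler_wpM2r => //; rewrite Cn_snd_J.
    have [->|v0] := eqVneq (Cn_snd v) 0; last first.
      by apply/ltW; have [_ kp2] := kp; apply: (metric_pos omS_metric kp2).
    have [omS11 _] := omS_metric; have [_ kp2] := kp.
    have [oSl _ _] := real11_form11 omS11 kp2.
    have E := oSl 1 0 0 (Jc 0); rewrite scaler0 addr0 mul1r in E.
    by move: E; move: (omS _ _ _ _) => x; lra.
  have idl : linear (id : Cn R (m + 1) -> Cn R (m + 1)) by [].
  have [pi piP] := eigen11_comparison o11 oP (real11_form11 (g11 s) kp) o11 oP
    (real11_form11 (g11 t) kp) idl (fun v => erefl) (fun v => id) key.
  by exists pi => i; have := piP i; rewrite subr0.
have lam_step s t (k : idx AP) p : s <= t -> dom k p -> Gam (lam s k p) ->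
    Gam (lam t k p) /\ f (lam s k p) <= f (lam t k p).
  move=> st kp Gs; have [pi piP] := lam_mono s t k p st kp.
  exact: (dominate_perm Gam_cone f_sym f_incr Gs piP).
have lam_adm t (k : idx AP) p : 0 <= t -> dom k p -> Gam (lam t k p).
  move=> t0 kp; have [] // := lam_step 0 t k p t0 kp.
  by rewrite /lam u0; have [_] := phi_adm; exact.
(* Nearness in p and in t jointly is what [compact_near_coveringP] turns into one t for all
   points. *)
have claimA (p0 : X * S) : \forall p \near p0 & t \near +oo%R,
    forall k : idx AP, dom k p -> Gam (lam t k p) /\ psi p < f (lam t k p).
  have [k0 kp0] := atlas_cover P_atlas p0.
  have [T0 T00 psiT0] : exists2 t, 0 <= t & psi p0 < f (lam t k0 p0).
    have gm s t : 0 <= s -> s <= t -> f (lambda om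
        (form_add (gform chi phi) (form_scale s (pull2 omS))) k0 p0) <=
        f (lambda om
        (form_add (gform chi phi) (form_scale t (pull2 omS))) k0 p0).
      move=> s0 st; rewrite (lamE s k0 p0 kp0) (lamE t k0 p0 kp0).
      by have [] := lam_step s t k0 p0 st kp0 (lam_adm s k0 p0 s0 kp0).
    have [t t0 pt] := lim_monotone_gt gm (phi_lim k0 p0 kp0).
    exists t; first exact: t0.
    by rewrite -(lamE t k0 p0 kp0); exact: pt.
  pose y := lam T0 k0 p0; have Gy : Gam y by exact: lam_adm.
  (* M separates psi near p0 from f at y - e 1 for small e, which makes the loss e of [lambda_lsc]
     affordable. *)
  pose M := (psi p0 + f y) / 2.
  have [Gam_open _] := Gam_cone.
  have f_near : \forall e \near (0 : R), M < f (y - e *: const_mx 1).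
    have [/(_ 0%N)[fc _] _] := f_sym.
    move/withinP: fc => /(_ y Gy).
    rewrite (within_interior (open_nbhs_nbhs (conj Gam_open Gy))) => fy.
    have ye : y - e *: const_mx 1 @[e --> (0 : R)] --> y.
      rewrite -[X in _ --> X]subr0 -[X in _ - X](scale0r (const_mx 1)).
      by apply: cvgB; [exact: cvg_cst|apply: cvgZr_tmp; exact: cvg_id].
    have fye := cvg_comp _ _ ye fy.
    have My : M < f y by rewrite /M; move: psiT0; rewrite -/y; lra.
    exact: (cvgr_gt _ fye _ My).
  have [e e0 [Ge fe]] : exists2 e : R, 0 < e &
      Gam (y - e *: const_mx 1) /\ M < f (y - e *: const_mx 1).
    have : \forall e \near (0 : R), Gam (y - e *: const_mx 1) /\
        M < f (y - e *: const_mx 1).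
      exact: (filterI (cone_shift Gam_cone Gy) f_near).
    move=> /nbhs_ballP[d /= d0 dP].
    exists (d / 2); first by rewrite divr_gt0.
    apply: dP; rewrite -ball_normE /= sub0r normrN gtr0_norm ?divr_gt0 //.
    by lra.
  have psi_near : \forall p \near p0, psi p < M.
    have pM : psi p0 < M by rewrite /M; move: psiT0; rewrite -/y; lra.
    exact: (cvgr_lt _ (psi_cont p0) _ pM).
  have lsc := lambda_lsc P_atlas om_metric (g11 T0) _ kp0 e0.
  have {}lsc : \forall p \near p0, forall k : idx AP, dom k p ->
      exists s : 'S_(m + 1), forall i, y 0 i - e <= lam T0 k p 0 (s i).
    apply: lsc => v w; apply: cvgD.
      exact: (smooth_form_cvg P_atlas chi_smooth kp0).
    exact: (iddbar_cvg P_atlas (uC2 T0) kp0).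
  apply: filterS (near_prodI (filterI psi_near lsc)
    (nbhs_pinfty_ge (num_real T0))) => -[p t] [/= [pM sP] tT] k kp.
  (* The estimate is obtained at [T0] for all p near p0 and propagated to every t >= T0 by
     [lam_step]. *)
  have [s sE] := sP k kp.
  have [|G1 f1] := @dominate_perm R _ Gam f Gam_cone f_sym f_incr _ (lam T0 k p) s Ge.
    by move=> i; rewrite !mxE mulr1; exact: sE.
  have [G2 f2] := lam_step T0 t k p tT kp G1.
  split; first exact: G2.
  exact: (lt_trans pM (lt_le_trans fe (le_trans f1 f2))).
have claimB (p0 : X * S) : \forall p \near p0 & t \near +oo%R,
    forall (k : idx AP) nu, dom k p -> bdry AS p.2 ->
      unit_inner_normal om k p nu -> normal_derive (u t) k p nu < 0.
  (* Points off the boundary form an open set, around which the claim is void. *)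
  have [b0|nb0] := pselect (bdry AS p0.2); last first.
    apply: filterS (near_prodI (near_snd (not_bdry_near S_atlas nb0))
      (@filterT _ (+oo%R : set_system R) _)) => -[p t] [/= nb _] k nu _ pb.
    by case: (nb pb).
  have [i ip ni] := b0; have [W [rho [rhoP _]]] := S_bdry i p0.2 ip ni.
  have h_le0 := max_principle S_atlas omS_metric hC2 h_laplace S_compact
    (evec_neq0 R ord0) h_bdry.
  have [w wP] := hopf S_atlas omS_metric hC2 h_laplace ip rhoP h_le0 (h_bdry _ b0).
  have [i1 ip1] := atlas_cover X_atlas p0.1.
  pose k0 : idx AP := (i1, i).
  have kp0 : dom k0 p0 by split.
  (* The direction w given by the Hopf lemma on S is lifted to (0, w). *)
  have Hw : derive_bd (img k0) [:: Cn_pair 0 w] (H \o param k0) (coord k0 p0) != 0.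
    rewrite (derive_bd_pr2 X_atlas S_atlas hC2 (vs := [:: Cn_pair 0 w]) isT (img_coord kp0)).
    by rewrite /= !Cn_pairK2.
  have [t0 near_t0] := normal_derive_near P_atlas om_metric phiC2 HC2
    (fun p => h_le0 p.2) kp0 Hw.
  apply: filterS (near_prodI near_t0 (nbhs_pinfty_ge (num_real t0))) =>
    -[p t] [/= pP tt] k nu kp pb nuP.
  rewrite /normal_derive (uD t k [:: nu] _ isT (@img_coord _ _ _ AP k p kp)).
  exact: (pP k nu t kp (h_bdry _ pb) nuP tt).
have XS_compact : compact [set: X * S].
  by rewrite -setXTT; exact: compact_setX.
have near_t : \forall t \near +oo%R, [set: X * S] `<=` [set p |
    (forall k : idx AP, dom k p -> Gam (lam t k p) /\ psi p < f (lam t k p)) /\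
    (forall (k : idx AP) nu, dom k p -> bdry AS p.2 ->
      unit_inner_normal om k p nu -> normal_derive (u t) k p nu < 0)].
  move/compact_near_coveringP: XS_compact; apply => p0 _.
  exact: (filterI (claimA p0) (claimB p0)).
apply: filterS near_t => t tP; split.
  split; first exact: uC2.
  by move=> k p kp; have [/(_ k kp)[G1 _] _] := tP p I; exact: G1.
split.
  by move=> k p kp; have [/(_ k kp)[_ f1] _] := tP p I; exact: f1.
split; first by move=> p pb; rewrite (h_bdry _ pb) mulr0 addr0.
by move=> k p nu kp pb nuP; have [_ B1] := tP p I; exact: (B1 k nu kp pb nuP).
Qed.
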